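(* Let $(S_n)_{n\in\mathbf{N}}$ be a time-homogeneous Markov process on $\mathbf{P}^{d-1}_{\mathbf{R}}$ (that is, of Steiner symmetrizations) with transition function $P$ and initial distribution $\mu$. Suppose there exists $\mathfrak{s}_\star\in\mathbf{P}^{d-1}_{\mathbf{R}}$ such that (i) (Recurrence) for every open set $\mathcal{O}\subseteq\mathbf{P}^{d-1}_{\mathbf{R}}$ containing $\mathfrak{s}_\star$, $$\mathbb{P}\big((S_n)_{n\in\mathbf{N}}\text{ enters }\mathcal{O}\text{ infinitely often}\big)=1;$$ (ii) (Continuity) for every $n\in\mathbf{N}$ and every open set $\mathcal{O}\subseteq(\mathbf{P}^{d-1}_{\mathbf{R}})^n$, the map $s\in\mathbf{P}^{d-1}_{\mathbf{R}}\mapsto P^n_s(\mathcal{O})$ is lower semi-continuous at $\mathfrak{s}_\star$; (iii) (Discrimination) for every Lebesgue measurable set $X\subseteq\mathbf{R}^d$ of finite measure with $m(X\Delta X^\star)>0$, $$\sum_{n\in\mathbf{N}}P^n_{\mathfrak{s}_\star}\big((\mathbf{P}^{d-1}_{\mathbf{R}})^{n-1}\times\{u\in\mathbf{P}^{d-1}_{\mathbf{R}}: m(X\Delta X^u)>0\}\big)>0.$$ Then for every Lebesgue measurable set $X\subseteq\mathbf{R}^d$ of finite measure, the sequence $(X^{S_1\dots S_n})_{n\in\mathbf{N}}$ converges in measure to $X^\star$ almost surely.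
   Context: $\mathbf{N}=\{1,2,\dots\}$; $m$ is Lebesgue measure on $\mathbf{R}^d$; $\Delta$ is symmetric difference; $\mathbf{P}^{d-1}_{\mathbf{R}}$ is the real projective space of directions (lines through the origin) of $\mathbf{R}^d$ with its usual topology. Measurable sets are considered up to null sets. $X^\star$ is the spherical nonincreasing rearrangement of $X$: the open Euclidean ball centered at $0$ with $m(X^\star)=m(X)$. For $u\in\mathbf{P}^{d-1}_{\mathbf{R}}$ with linear span $\langle u\rangle$, the Steiner symmetrization $X^u$ is the set (well defined up to null sets) such that for (almost) every $x\in u^\perp$, the section $X^u\cap(x+\langle u\rangle)$ is the open interval of the line $x+\langle u\rangle$ centered at $x$ with the same one-dimensional measure as $X\cap(x+\langle u\rangle)$. $X^{s_1\dots s_n}=(\cdots(X^{s_1})^{s_2}\cdots)^{s_n}$. Convergence in measure of $X_n$ to $Y$ means $m(X_n\Delta Y)\to0$. A transition function on a metrizable second-countable space $\mathscr{S}$ is a map $P:\mathscr{S}\times\mathscr{B}(\mathscr{S})\to[0,1]$, $(s,A)\mapsto P_s(A)$, where $\mathscr{B}(\mathscr{S})$ is the Borel $\sigma$-algebra, such that each $P_s$ is a probability measure and $s\mapsto\int f\,dP_s$ is Borel measurable for every bounded Borel $f$. The iterated kernel $P^n_s$ is the probability measure on $\mathscr{S}^n$ given by $$P^n_s(B)=\int_{\mathscr{S}}\cdots\int_{\mathscr{S}}\chi_B(s_1,\dots,s_n)\,P_{s_{n-1}}(ds_n)\cdots P_{s_1}(ds_2)\,P_s(ds_1).$$ A sequence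 $(S_n)_{n\in\mathbf{N}}$ of $\mathscr{S}$-valued random variables is a time-homogeneous Markov process with transition function $P$ and initial distribution $\mu$ if $S_1$ has law $\mu$ and $\mathbb{P}\{S_{n+1}\in A\mid S_1,\dots,S_n\}=P_{S_n}(A)$ almost surely for all $n\in\mathbf{N}$ and Borel $A\subseteq\mathscr{S}$. *)

(* Defs.v *)
From HB Require Import structures.
From mathcomp Require Import all_boot all_order all_algebra.
From mathcomp Require Import all_classical all_reals all_analysis.
From mathcomp Require Import measurable_realfun.

Set Implicit Arguments.
Unset Strict Implicit.
Unset Printing Implicit Defensive.

Import Order.TTheory GRing.Theory Num.Theory.
Import numFieldNormedType.Exports.

Local Open Scope classical_set_scope.
Local Open Scope ring_scope.

(* R^d, d >= 1, is 'rV[R]_d.+1 throughout (d : nat being the dimension minus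
   one). The library norm on 'rV[R]_d.+1 is the sup norm, whence [enorm]. *)
Section euclidean.
Variables (R : realType) (d : nat).
Notation V := 'rV[R]_d.+1.

Definition dot (x y : V) : R := \sum_(i < d.+1) x 0 i * y 0 i.

Definition enorm (x : V) : R := Num.sqrt (dot x x).

Definition eball (r : R) : set V := [set x | enorm x < r].

Definition box (a b : V) : set V :=
  [set x | forall i, a 0 i < x 0 i <= b 0 i].

Definition box_volume (a b : V) : R := \prod_(i < d.+1) (b 0 i - a 0 i).

Definition box_cover (X : set V) (a b : nat -> V) : Prop :=
  (forall k i, a k 0 i <= b k 0 i) /\ X `<=` \bigcup_k box (a k) (b k).

(* Lebesgue outer measure; it is Lebesgue measure on the sets X such that
   [lebesgue_measurable X]. *)
Definition lebesgue (X : set V) : \bar R :=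
  ereal_inf [set v | exists a b, box_cover X a b /\
    v = (\sum_(0 <= k <oo) (box_volume (a k) (b k))%:E)%E].

Definition lebesgue_measurable (X : set V) : Prop :=
  caratheodory_measurable lebesgue X.

(* [xget set0] picks the unique set with the stated property. The empty set
   is the open ball of radius 0. *)
Definition rearrangement (X : set V) : set V :=
  xget set0 [set B | exists r : R,
    [/\ 0 <= r, B = eball r & lebesgue B = lebesgue X]].

(* The real projective space: the lines through the origin of R^d. *)
Record proj_space := ProjSpace {
  line : {vspace V};
  line_dim : \dim line == 1%N }.

HB.instance Definition _ := [isSub for line].
HB.instance Definition _ := [Choice of proj_space by <:].

Lemma dim_line1 : \dim <[const_mx 1 : V]>%VS == 1%N.
Proof.
rewrite dim_vline; suff -> : (const_mx 1 : V) != 0 by [].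
by apply/eqP => /rowP /(_ 0) /eqP; rewrite !mxE oner_eq0.
Qed.

HB.instance Definition _ := isPointed.Build proj_space (ProjSpace dim_line1).

(* The line spanned by v, when v != 0. *)
Definition line_of (v : V) : proj_space := insubd (point : proj_space) <[v]>%VS.

(* The quotient topology of V \ {0} -> proj_space; as V \ {0} is open in V,
   openness may be tested in V. *)
Definition proj_space_open (A : set proj_space) : Prop :=
  open [set v : V | v != 0 /\ A (line_of v)].

Lemma proj_space_openT : proj_space_open setT.
Proof.
rewrite /proj_space_open.
have -> : [set v : V | v != 0 /\ [set: proj_space] (line_of v)] = ~` [set 0].
  by apply/seteqP; split => v /= => [[/eqP]|/eqP].
apply: closed_openC; apply: accessible_closed_set1.
exact/hausdorff_accessible/norm_hausdorff.
Qed.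

Lemma proj_space_openI : setI_closed proj_space_open.
Proof.
move=> A B oA oB; rewrite /proj_space_open.
have -> : [set v : V | v != 0 /\ (A `&` B) (line_of v)] =
    [set v | v != 0 /\ A (line_of v)] `&` [set v | v != 0 /\ B (line_of v)].
  by apply/seteqP; split => v /= => [[? []]|[[? ?] []]].
exact: openI.
Qed.

Lemma proj_space_open_bigU (I : Type) (f : I -> set proj_space) :
  (forall i, proj_space_open (f i)) -> proj_space_open (\bigcup_i f i).
Proof.
move=> of_; rewrite /proj_space_open.
have -> : [set v : V | v != 0 /\ (\bigcup_i f i) (line_of v)] =
    \bigcup_i [set v | v != 0 /\ f i (line_of v)].
  by apply/seteqP; split => v /= => [[? [i ? ?]]|[i ? []]];
     [exists i|split => //; exists i].
by apply: bigcup_open => i _; exact: of_.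
Qed.

HB.instance Definition _ := isOpenTopological.Build proj_space
  proj_space_openT proj_space_openI proj_space_open_bigU.

HB.instance Definition _ := Measurable.copy proj_space
  (g_sigma_algebraType (@open proj_space)).

(* A unit vector spanning the line u; [steiner] does not depend on the choice
   between the two. *)
Definition unit_vector (u : proj_space) : V :=
  (enorm (vpick (line u)))^-1 *: vpick (line u).

Definition line_section (X : set V) (e x : V) : set R :=
  [set t | X (x + t *: e)].

(* Writing y = x + s *: e with x orthogonal to the unit vector e spanning u,
   y belongs to X^u iff |s| is less than half the length of
   X `&` (x + <u>). Lebesgue null sets aside, this only depends on the class
   of X. *)
Definition steiner (X : set V) (u : proj_space) : set V :=
  let e := unit_vector u in
  [set y | let s := dot y e in let x := y - s *: e in
    ((2 * `|s|)%:E < completed_lebesgue_measure (line_section X e x))%E].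

Definition steiner_seq (X : set V) (us : seq proj_space) : set V :=
  foldl steiner X us.

End euclidean.

Section markov.
Local Open Scope ereal_scope.
Context (R : realType) {dS : measure_display} {S : measurableType dS}.

Definition fcons n (s : S) (t : 'I_n -> S) : 'I_n.+1 -> S :=
  fun i => if unlift ord0 i is Some j then t j else s.

(* The iterated kernel P^n_s(B), for B a set of n-tuples 'I_n -> S; the
   outermost integral is that over s_1, with respect to P_s. *)
Fixpoint iter_kernel (P : R.-pker S ~> S) (n : nat) (s : S) :
    set ('I_n -> S) -> \bar R :=
  match n with
  | 0 => fun B => (\1_B (fun=> s))%:E
  | m.+1 => fun B =>
      \int[P s]_s1 iter_kernel P s1 [set t : 'I_m -> S | B (fcons s1 t)]
  end.

Context {dO : measure_display} {Omega : measurableType dO}.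
Variable Pr : probability Omega R.

Definition cond_prob_version (G : set (set Omega)) (E : set Omega)
    (g : Omega -> \bar R) : Prop :=
  [/\ forall B : set (\bar R), measurable B -> G (g @^-1` B),
      Pr.-integrable setT g &
      forall F, G F -> \int[Pr]_(w in F) g w = Pr (E `&` F)].

Definition sigma_past (X : nat -> Omega -> S) (n : nat) : set (set Omega) :=
  <<s [set E | exists i A, [/\ (i <= n)%N, measurable A & E = X i @^-1` A]] >>.

(* Time is shifted by one: X n is S_(n+1). *)
Definition markov_process (P : R.-pker S ~> S) (mu : probability S R)
    (X : nat -> {mfun Omega >-> S}) : Prop :=
  (forall A, measurable A -> Pr (X 0%N @^-1` A) = mu A) /\
  (forall n A, measurable A ->
    exists2 g, cond_prob_version (sigma_past X n) (X n.+1 @^-1` A) g &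
      {ae Pr, forall w, g w = P (X n w) A}).

End markov.

(* The pointwise form of [lower_semicontinuous]. *)
Definition lsc_at (R : realType) (T : topologicalType) (f : T -> \bar R)
    (x : T) : Prop :=
  forall a : R, (a%:E < f x)%E -> \forall y \near x, (a%:E < f y)%E.

(* Main.v *)
From HB Require Import structures.
Require Import Defs.
From mathcomp Require Import all_boot all_order all_algebra.
From mathcomp Require Import all_classical all_reals all_analysis.
From mathcomp Require Import measurable_realfun.
From mathcomp Require Import ring lra.
Import Order.TTheory GRing.Theory Num.Theory.
Import numFieldNormedType.Exports.
Set Implicit Arguments.
Unset Strict Implicit.
Unset Printing Implicit Defensive.

Local Open Scope classical_set_scope.
Local Open Scope ring_scope.

(** Symmetrizing never decreases the volume of a set inside a centered ball, and
    a direction that increases none of these volumes fixes the set up to a null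
    set ([steiner_sdist_eq0]). Hence, if some letter of a word of directions moves
    a set, symmetrizing the set along the word increases its volume in some ball
    of rational radius ([gains_exists]). As symmetrization is continuous in
    the direction ([steiner_seq_continuous]), the same gain, up to a factor, is
    achieved along all the words of a product of small open sets of directions,
    and for all sets close to the given one ([gains_near]). By lower
    semicontinuity the probability that the process follows such a product of
    open sets is bounded below for all starting states near [s0]
    ([rect_kernel_near]).

    Call a time [k] an occurrence when [S_k] is near [s0] and the current set is
    one that gains a fixed amount along that product. Each occurrence has a
    conditional chance at least [eps] to be followed by the gain
    ([markov_escape]), so infinitely many occurrences would almost surely be
    followed by infinitely many gains ([conditional_borel_cantelli],
    [recurring_visits]); but the volume in a ball is monotone along the process
    and bounded by the volume of the set. So almost surely there are only
    finitely many occurrences ([occurs_finitely_often]), simultaneously for the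
    countably many products of basic open sets, radii and amounts. It is an event
    of the past of the process that a time is an occurrence because the condition
    on the current set is closed ([sigma_past_closed_words]).

    The rest is deterministic ([sdist_trajectory_small]). Along an ultrafilter of
    times at which the directions approach [s0], the current sets converge to
    some [Y], because the orbit of a set under symmetrizations is totally bounded
    ([orbit_totally_bounded], [steiner_ultralimit]). If [Y] were not a ball,
    discrimination would provide a gain for [Y], hence occurrences at infinitely
    many times. So [Y] is the ball of the right volume, and the distance to that
    ball, which does not increase along the process, tends to [0].

    All of this rests on the properties of a single symmetrization: it
    contracts the symmetric difference ([steiner_dir_contract]), commutes with
    enlargements up to inclusion ([enlarge_steiner_dir]) and is continuous in the
    direction ([steiner_dir_continuous]). They are derived from Cavalieri's
    principle along the first axis, and carried to the other directions by the
    invariance of Lebesgue measure under reflections ([lebesgue_isometry]). *)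

(** * Borel sets of row vectors and product measures *)

Section rV_measurable.
Context (R : realType) (n : nat).

Let coord (i : 'I_n) (x : 'rV[R]_n) : R := x 0 i.

(* The sigma-algebra generated by the coordinates. *)
HB.instance Definition _ := @isMeasurable.Build (measure_tuple_display default_measure_display)
  ('rV[R]_n) (g_sigma_preimage coord)
  (@sigma_algebra0 _ _ _)
  (fun A => @sigma_algebraC _ _ A)
  (@sigma_algebra_bigcup _ _ _).

End rV_measurable.

Section rV_measurable_fun.
Context (R : realType).

Lemma measurable_coord n (i : 'I_n) :
  measurable_fun setT (fun x : 'rV[R]_n => x 0 i).
Proof.
move=> _ Y mY; rewrite setTI; apply: sub_sigma_algebra => /=.
rewrite -bigcup_seq/=; exists i => /=; first by rewrite mem_index_enum.
by exists Y => //; rewrite setTI.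
Qed.

Lemma measurable_fun_rowP d (T : measurableType d) n (f : T -> 'rV[R]_n) :
  (forall i, measurable_fun setT (fun x => f x 0 i)) -> measurable_fun setT f.
Proof.
move=> mf.
suff prefS : g_sigma_preimage (fun i (x : T) => f x 0 i) `<=` measurable.
  have := @g_sigma_preimage_comp _ _ n _ (fun i (x : 'rV[R]_n) => x 0 i) _ f.
  rewrite /comp => E; rewrite E in prefS => _ A mA.
  by apply: prefS; exists A.
apply: smallest_sub; first exact: sigma_algebra_measurable.
move=> A; rewrite -bigcup_seq => -[i _ [B mB <-]]; exact: mf.
Qed.

Lemma measurable_rowD n :
  measurable_fun setT (fun z : 'rV[R]_n * 'rV[R]_n => z.1 + z.2).
Proof.
apply: measurable_fun_rowP => i; under eq_fun do rewrite mxE.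
apply: measurable_funD.
  exact: (measurableT_comp (measurable_coord i) measurable_fst).
exact: (measurableT_comp (measurable_coord i) measurable_snd).
Qed.

Lemma measurable_rowN n : measurable_fun setT (fun z : 'rV[R]_n => - z).
Proof.
apply: measurable_fun_rowP => i; under eq_fun do rewrite mxE.
exact: (measurable_funN (@measurable_coord n i)).
Qed.

End rV_measurable_fun.

Section vcons.
Context (R : realType).

(** Splitting off the first coordinate identifies [R^(n+1)] with [R^n * R]. *)
Definition vcons n (t : R) (z : 'rV[R]_n) : 'rV[R]_n.+1 :=
  \row_i (if unlift ord0 i is Some j then z 0 j else t).

Definition vtail n (x : 'rV[R]_n.+1) : 'rV[R]_n := \row_j x 0 (lift ord0 j).

Lemma vcons0 n t (z : 'rV[R]_n) : vcons t z 0 ord0 = t.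
Proof. by rewrite mxE unlift_none. Qed.

Lemma vconsS n t (z : 'rV[R]_n) j : vcons t z 0 (lift ord0 j) = z 0 j.
Proof. by rewrite mxE liftK. Qed.

Lemma vconsK n t (z : 'rV[R]_n) : vtail (vcons t z) = z.
Proof. by apply/rowP => j; rewrite mxE vconsS. Qed.

Lemma measurable_vcons n :
  measurable_fun setT (fun z : 'rV[R]_n * R => vcons z.2 z.1).
Proof.
apply: measurable_fun_rowP => i; under eq_fun do rewrite mxE.
case: (unlift ord0 i) => [j|]; last exact: measurable_snd.
exact: (measurableT_comp (measurable_coord j) measurable_fst).
Qed.

Lemma measurable_vtail n : measurable_fun setT (@vtail n).
Proof.
apply: measurable_fun_rowP => i; under eq_fun do rewrite mxE.
exact: measurable_coord.
Qed.

(** [box] in any dimension, zero included, for the induction on the dimension. *)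
Definition row_box n (a b : 'rV[R]_n) : set 'rV[R]_n :=
  [set x | forall i, a 0 i < x 0 i <= b 0 i].

Definition row_box_volume n (a b : 'rV[R]_n) : R :=
  \prod_(i < n) (b 0 i - a 0 i).

Lemma measurable_row_box n (a b : 'rV[R]_n) : measurable (row_box a b).
Proof.
have -> : row_box a b =
    \bigcap_(i in [set: 'I_n]) ((fun x : 'rV[R]_n => x 0 i) @^-1` `]a 0 i, b 0 i]).
  apply/seteqP; split => x /=.
    by move=> h i _ /=; rewrite in_itv /= h.
  by move=> h i; have := h i I; rewrite /= in_itv.
apply: fin_bigcap_measurable => // i _; rewrite -[X in measurable X]setTI.
exact: (@measurable_coord R n i).
Qed.

Lemma row_box_vcons n (a b : 'rV[R]_n.+1) t z :
  row_box a b (vcons t z) <->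
  row_box (vtail a) (vtail b) z /\ a 0 ord0 < t <= b 0 ord0.
Proof.
split=> [h|[h1 h2] i].
  split; last by have := h ord0; rewrite vcons0.
  by move=> j; have := h (lift ord0 j); rewrite vconsS !mxE.
by case: (unliftP ord0 i) => [j|] ->; rewrite ?vcons0// vconsS; have := h1 j; rewrite !mxE.
Qed.

Definition row_cst n (c : R) : 'rV[R]_n := const_mx c.

Lemma row_box_cover n : \bigcup_k row_box (row_cst n (- k%:R)) (row_cst n k%:R) = setT.
Proof.
apply/seteqP; split => // x _.
pose M : R := \sum_(i < n) `|x 0 i|.
have xM i : `|x 0 i| <= M by rewrite /M (bigD1 i)//= lerDl sumr_ge0.
exists (Num.truncn M).+1 => // i; rewrite !mxE.
have := le_lt_trans (xM i) (truncnS_gt M); rewrite ltr_norml => /andP[-> h].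
exact: ltW.
Qed.

End vcons.

Section cons_measure.
Context (R : realType) (n : nat) (nu : {sigma_finite_measure set 'rV[R]_n -> \bar R}).
Local Open Scope ereal_scope.

Definition vconsp (z : 'rV[R]_n * measurableTypeR R) : 'rV[R]_n.+1 := vcons z.2 z.1.

Lemma measurable_vconsp : measurable_fun setT vconsp.
Proof. exact: measurable_vcons. Qed.

(** The product of [nu] with Lebesgue measure on the first coordinate. *)
Definition cons_measure : set 'rV[R]_n.+1 -> \bar R :=
  pushforward (nu \x @lebesgue_measure R) vconsp.

Let pm : {measure set 'rV[R]_n.+1 -> \bar R} :=
  measure_function_pushforward__canonical__measure_function_Measure
    (nu \x @lebesgue_measure R) measurable_vconsp.

HB.instance Definition _ := isMeasure.Build _ _ _ cons_measure
  (measure0 pm) (measure_ge0 pm) (@measure_semi_sigma_additive _ _ _ pm).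

Lemma cons_measureE A :
  cons_measure A = \int[nu]_z lebesgue_measure ((fun t => vcons t z) @^-1` A).
Proof.
rewrite /cons_measure /pushforward /product_measure1 /=.
apply: eq_integral => z _ /=; congr (lebesgue_measure _).
by apply/seteqP; split => t /=; rewrite /xsection /= in_setE.
Qed.

Lemma measurable_cons_section (A : set 'rV[R]_n.+1) : measurable A ->
  measurable_fun setT (fun z : 'rV[R]_n => lebesgue_measure ((fun t => vcons t z) @^-1` A)).
Proof.
move=> mA.
have := measurable_fun_xsection (@lebesgue_measure R) (measurable_vconsp measurableT mA).
congr measurable_fun; apply/funext => z /=; congr (lebesgue_measure _).
by apply/seteqP; split => t /=; rewrite /xsection /= in_setE //= => -[].
Qed.

Hypothesis nu_box : forall a b : 'rV[R]_n, (forall i, (a 0 i <= b 0 i)%R) ->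
  nu (row_box a b) = (row_box_volume a b)%:E.

Lemma cons_measure_box (a b : 'rV[R]_n.+1) : (forall i, (a 0 i <= b 0 i)%R) ->
  cons_measure (row_box a b) = (row_box_volume a b)%:E.
Proof.
move=> ab; rewrite cons_measureE.
have mb := @measurable_row_box R n (vtail a) (vtail b).
rewrite (eq_integral (fun z => (b 0%R ord0 - a 0%R ord0)%:E *
    (\1_(row_box (vtail a) (vtail b)) z)%:E)); last first.
  move=> z _; rewrite indicE; have [zb|zb] := boolP (z \in _).
    rewrite mule1 (_ : _ @^-1` _ = `]a 0%R ord0, b 0%R ord0]%classic).
      by rewrite lebesgue_measure_itv/= lte_fin; have := ab ord0;
        rewrite le_eqVlt => /orP[/eqP ->|->]; rewrite ?ltxx ?subrr// EFinB.
    rewrite inE in zb; apply/seteqP; split => t /=; rewrite in_itv/=.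
      by move/row_box_vcons => [].
    by move=> h; apply/row_box_vcons.
  rewrite mule0 (_ : _ @^-1` _ = set0) ?measure0//.
  apply/seteqP; split => t //= /row_box_vcons[h _].
  by move: zb; rewrite notin_setE; apply.
rewrite ge0_integralZl//; last 2 first.
- exact/measurable_EFinP/measurable_indic.
- by rewrite lee_fin subr_ge0.
have -> : \int[nu]_x (\1_(row_box (vtail a) (vtail b)) x)%:E =
    (row_box_volume (vtail a) (vtail b))%:E.
  by rewrite integral_indic// setIT; apply: nu_box => i; rewrite !mxE.
rewrite -EFinM /row_box_volume big_ord_recl; congr (_ * _)%:E%R.
by apply: eq_bigr => i _; rewrite !mxE.
Qed.

Lemma cons_measure_sigma_finite : sigma_finite setT cons_measure.
Proof.
exists (fun k : nat => row_box (row_cst n.+1 (- k%:R)) (row_cst n.+1 k%:R)).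
  by rewrite row_box_cover.
move=> k; split; first exact: measurable_row_box.
rewrite cons_measure_box ?ltry// => i; rewrite !mxE.
by rewrite (@le_trans _ _ 0%R)// lerNl oppr0.
Qed.

End cons_measure.

(** Iterated products of the one-dimensional Lebesgue measure; only its values
    on boxes matter, since these determine the outer measure. *)
Lemma box_measure_exists (R : realType) n :
  exists nu : {sigma_finite_measure set 'rV[R]_n -> \bar R},
  forall a b : 'rV[R]_n, (forall i, a 0 i <= b 0 i) ->
  nu (row_box a b) = (row_box_volume a b)%:E.
Proof.
elim: n => [|n [nu nuE]].
  exists (\d_(0 : 'rV[R]_0)) => a b _.
  rewrite /row_box_volume big_ord0; suff -> : row_box a b = setT by exact: probability_setT.
  by apply/seteqP; split => // x _ [].
pose s := Measure_isSigmaFinite.Build _ _ _ (cons_measure nu) (cons_measure_sigma_finite nuE).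
pose nu' : {sigma_finite_measure set _ -> \bar R} := HB.pack (cons_measure nu) s.
by exists nu' => a b ab; exact: cons_measure_box.
Qed.

(** * Lebesgue outer measure and its Borel restriction *)

Section lebesgue_outer.
Context (R : realType) (d : nat).
Notation V := 'rV[R]_d.+1.
Local Open Scope ereal_scope.
Implicit Types (X Y : set V) (a b : nat -> V).

Lemma box_volume_ge0 (a b : V) : (forall i, a 0%R i <= b 0%R i)%R -> (0 <= box_volume a b)%R.
Proof. by move=> ab; rewrite /box_volume prodr_ge0// => i _; rewrite subr_ge0. Qed.

Lemma lebesgue_le_cover X a b : box_cover X a b ->
  lebesgue X <= \sum_(0 <= k <oo) (box_volume (a k) (b k))%:E.
Proof. by move=> h; apply: ereal_inf_lbound; exists a, b. Qed.

Lemma le_lebesgue_cover X c :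
  (forall a b, box_cover X a b -> c <= \sum_(0 <= k <oo) (box_volume (a k) (b k))%:E) ->
  c <= lebesgue X.
Proof. by move=> h; apply: le_ereal_inf_tmp => _ [a [b [ab ->]]]; exact: h. Qed.

Lemma lebesgue_ge0 X : 0 <= lebesgue X.
Proof.
apply: le_lebesgue_cover => a b [ab _]; apply: nneseries_ge0 => k _ _.
by rewrite lee_fin box_volume_ge0.
Qed.

Lemma lebesgue_cover_adherent X (e : R) : lebesgue X < +oo -> (0 < e)%R ->
  exists a b, box_cover X a b /\
    \sum_(0 <= k <oo) (box_volume (a k) (b k))%:E <= lebesgue X + e%:E.
Proof.
move=> Xoo e0; have Xf : lebesgue X \is a fin_num by rewrite ge0_fin_numE ?lebesgue_ge0.
have [_ [a [b [ab ->]]] h] := lb_ereal_inf_adherent e0 Xf.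
by exists a, b; split => //; exact: ltW.
Qed.

Lemma le_lebesgue X Y : X `<=` Y -> lebesgue X <= lebesgue Y.
Proof.
move=> XY; apply: le_lebesgue_cover => a b [ab Yab]; apply: lebesgue_le_cover.
by split => //; exact: subset_trans Yab.
Qed.

Lemma lebesgue0 : lebesgue (set0 : set V) = 0.
Proof.
apply/eqP; rewrite eq_le lebesgue_ge0 andbT.
have /lebesgue_le_cover : box_cover set0 (fun=> 0%R : V) (fun=> 0%R) by split.
by rewrite eseries0// => k _ _; rewrite /box_volume big_ord_recl subrr mul0r.
Qed.

Lemma lebesgue_sigma_subadditive : sigma_subadditive (@lebesgue R d).
Proof.
move=> A; have [Aoo|] := pselect (forall n, lebesgue (A n) < +oo); last first.
  move=> /existsNP[n /negP]; rewrite -leNgt leye_eq => /eqP An.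
  rewrite (eseries_pinfty _ _ An) ?leey// => m _.
  by rewrite -ltNye; exact: lt_le_trans (lebesgue_ge0 _).
apply/lee_addgt0Pr => e e0.
have /choice[ab abP] : forall n, exists ab : (nat -> V) * (nat -> V),
    box_cover (A n) ab.1 ab.2 /\
    \sum_(0 <= j <oo) (box_volume (ab.1 j) (ab.2 j))%:E <=
      lebesgue (A n) + (e / (2 ^ n.+1)%:R)%:E.
  move=> n; have [|a [b h]] := lebesgue_cover_adherent (Aoo n) (e := (e / (2 ^ n.+1)%:R)%R).
    by rewrite divr_gt0// ltr0n expn_gt0.
  by exists (a, b).
pose vol n j := (box_volume ((ab n).1 j) ((ab n).2 j))%:E.
have vol0 n j : 0 <= vol n j.
  by rewrite lee_fin box_volume_ge0// => i; have [[h _] _] := abP n; exact: h.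
apply: le_trans (epsilon_trick xpredT (fun n => lebesgue_ge0 (A n)) (ltW e0)).
apply: (@le_trans _ _ (\sum_(0 <= n <oo) \sum_(0 <= j <oo) vol n j)); last first.
  apply: lee_nneseries => [n _ _|n _]; last exact: (abP n).2.
  by apply: nneseries_ge0 => j _ _; exact: vol0.
have /card_esym/card_set_bijP[f fbij] := card_nat2.
have -> : \sum_(0 <= n <oo) \sum_(0 <= j <oo) vol n j =
    \sum_(0 <= k <oo) vol (f k).1 (f k).2.
  rewrite [LHS]nneseries_esumT => [|n]; last by apply: nneseries_ge0 => j _ _; exact: vol0.
  rewrite (eq_esum (b := fun n => \esum_(j in setT) vol n j)); last first.
    by move=> n _; exact: nneseries_esumT.
  rewrite esum_esum// (_ : setT `*`` (fun=> setT) = setT); last by apply/seteqP; split.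
  by rewrite (reindex_esum _ _ _ _ fbij) nneseries_esumT.
apply: lebesgue_le_cover; split=> [k|x [n _ Anx]].
  by have [[h _] _] := abP (f k).1; exact: h.
have [[_ /(_ _ Anx)[j _ xj]] _] := abP n.
have [_ _ /(_ (n, j) I)[k _ fk]] := fbij.
by exists k => //; rewrite fk.
Qed.

HB.instance Definition _ := isOuterMeasure.Build R V (@lebesgue R d)
  lebesgue0 lebesgue_ge0 le_lebesgue lebesgue_sigma_subadditive.

End lebesgue_outer.

Section lebesgue_cara.
Context (R : realType) (d : nat).
Let om : {outer_measure set 'rV[R]_d.+1 -> \bar R} := @lebesgue R d.
Definition lebesgue_cara : set (caratheodory_type (@lebesgue R d)) -> \bar R := @lebesgue R d.
HB.instance Definition _ := isMeasure.Build _ _ _ lebesgue_cara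
   (@caratheodory_measure0 _ _ om) (@caratheodory_measure_ge0 _ _ om)
  (@caratheodory_measure_sigma_additive _ _ om).
End lebesgue_cara.

Section borel_lebesgue.
Context (R : realType) (d : nat).
Notation V := 'rV[R]_d.+1.
Local Open Scope ereal_scope.
Implicit Types (X Y : set V) (a b : V).

Let upd (x : V) i (v : R) : V := \row_j (if j == i then v else x 0%R j).

(** Cutting every box of a cover along the hyperplane splits the cover without
    changing its total volume. *)
Lemma caratheodory_halfspace i (c : R) :
  lebesgue_measurable [set x : V | x 0 i <= c]%R.
Proof.
apply: le_caratheodory_measurable => Z; apply: le_lebesgue_cover => a b [ab Zab].
pose m k := Num.max (a k 0%R i) (Num.min (b k 0%R i) c).
have am k : (a k 0 i <= m k)%R by rewrite /m le_max lexx.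
have mb k : (m k <= b k 0 i)%R by rewrite /m ge_max ab ge_min lexx.
have vol_split k : (box_volume (a k) (b k))%:E =
    (box_volume (a k) (upd (b k) i (m k)))%:E +
    (box_volume (upd (a k) i (m k)) (b k))%:E.
  pose Q := (\prod_(j < d.+1 | j != i) (b k 0 j - a k 0 j))%R.
  have -> : box_volume (a k) (b k) = ((b k 0 i - a k 0 i) * Q)%R.
    by rewrite /box_volume (bigD1 i).
  have -> : box_volume (a k) (upd (b k) i (m k)) = ((m k - a k 0 i) * Q)%R.
    rewrite /box_volume (bigD1 i)//= !mxE eqxx; congr (_ * _)%R.
    by apply: eq_bigr => j ji; rewrite mxE (negbTE ji).
  have -> : box_volume (upd (a k) i (m k)) (b k) = ((b k 0 i - m k) * Q)%R.
    rewrite /box_volume (bigD1 i)//= !mxE eqxx; congr (_ * _)%R.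
    by apply: eq_bigr => j ji; rewrite mxE (negbTE ji).
  by rewrite -EFinD; congr (_%:E); ring.
rewrite (eq_eseriesr (fun k _ => vol_split k)) nneseriesD; last 2 first.
- move=> k _ _; rewrite lee_fin box_volume_ge0// => j; rewrite mxE.
  by case: eqP => [->|].
- move=> k _ _; rewrite lee_fin box_volume_ge0// => j; rewrite mxE.
  by case: eqP => [->|].
apply: leeD; apply: lebesgue_le_cover; split.
- by move=> k j; rewrite mxE; case: eqP => [->|].
- move=> x [Zx /= xc]; have [k _ abx] := Zab _ Zx; exists k => // j.
  have /andP[h1 h2] := abx j; rewrite mxE h1 /=; case: eqP => [ji|//].
  by rewrite /m le_max le_min -ji h2 ji xc orbT.
- by move=> k j; rewrite mxE; case: eqP => [->|].
- move=> x [Zx /= /negP]; rewrite -ltNge => xc.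
  have [k _ abx] := Zab _ Zx; exists k => // j.
  have /andP[h1 h2] := abx j; rewrite mxE h2 andbT; case: eqP => [ji|//].
  by rewrite /m gt_max -ji h1 gt_min ji xc orbT.
Qed.

Lemma borel_lebesgue_measurable X : measurable X -> lebesgue_measurable X.
Proof.
pose C := caratheodory_type (@lebesgue R d).
have mc i : measurable_fun setT (fun x : C => (x : V) 0%R i : measurableTypeR R).
  apply: (measurability (@RGenOInfty.G R)); first exact: RGenOInfty.measurableE.
  move=> _ [_ [u ->] <-]; rewrite setTI.
  rewrite (_ : _ @^-1` _ = ~` [set x : V | x 0 i <= u]%R).
    by apply: (@measurableC _ C); exact: caratheodory_halfspace.
  apply/seteqP; split => x /=; rewrite in_itv /= andbT.
    by move=> ux; apply/negP; rewrite -ltNge.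
  by move=> /negP; rewrite -ltNge => ->.
suff : measurable_fun setT (id : C -> V).
  by move=> mid mX; have := mid measurableT X mX; rewrite setTI.
exact: (measurable_fun_rowP mc).
Qed.

Lemma measurable_box a b : measurable (box a b).
Proof. exact: measurable_row_box. Qed.

Variable nu : {measure set V -> \bar R}.
Hypothesis nu_box : forall a b, (forall i, (a 0 i <= b 0 i)%R) ->
  nu (row_box a b) = (row_box_volume a b)%:E.

Lemma box_measure_le_lebesgue X : measurable X -> nu X <= lebesgue X.
Proof.
move=> mX; apply: le_lebesgue_cover => a b [ab Xab].
rewrite (eq_eseriesr (fun k _ => esym (nu_box (ab k)))).
apply: measure_sigma_subadditive => // k; exact: measurable_row_box.
Qed.

Lemma lebesgue_box_le a b : (forall i, (a 0 i <= b 0 i)%R) ->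
  lebesgue (box a b) <= (box_volume a b)%:E.
Proof.
move=> ab; pose a' (k : nat) : V := if k is 0%N then a else 0%R.
pose b' (k : nat) : V := if k is 0%N then b else 0%R.
have /lebesgue_le_cover/le_trans -> // : box_cover (box a b) a' b'.
  by split => [[|k] i//|x abx]; exists 0%N.
rewrite nneseries_recl//=; last first.
  move=> k _; rewrite lee_fin; case: k => [|k]/=; exact: box_volume_ge0.
rewrite eseries0 ?adde0// => -[|k] //= _ _.
by rewrite /box_volume big_ord_recl subrr mul0r.
Qed.

(** A measure with the right values on boxes is below the outer measure, by
    countable subadditivity. Inside a large box the same bound for the
    complement gives the converse. *)
Lemma lebesgue_box_measureE X : measurable X -> lebesgue X = nu X.
Proof.
move=> mX; apply/eqP; rewrite eq_le box_measure_le_lebesgue// andbT.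
pose B (k : nat) := row_box (row_cst d.+1 (- k%:R)%R) (row_cst d.+1 (k%:R : R)).
have k0 (k : nat) i : (row_cst d.+1 (- k%:R) 0 i <= row_cst d.+1 (k%:R : R) 0 i)%R.
  by rewrite !mxE (@le_trans _ _ 0%R)// lerNl oppr0.
have mB k : measurable (B k) by exact: measurable_row_box.
have nuB k : nu (B k) = (row_box_volume (row_cst d.+1 (- k%:R)%R) (row_cst d.+1 (k%:R : R)))%:E.
  by rewrite nu_box.
have lB k : lebesgue (B k) <= nu (B k) by rewrite nuB; exact: lebesgue_box_le.
pose C := caratheodory_type (@lebesgue R d).
pose lam : {measure set C -> \bar R} := @lebesgue_cara R d.
have key k : lebesgue (X `&` B k) <= nu (X `&` B k).
  have mXB : measurable (X `&` B k) by exact: measurableI.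
  have mBX : measurable (B k `\` X) by exact: measurableD.
  have e1 : nu (B k) = nu (X `&` B k) + nu (B k `\` X).
    by rewrite setIC (measureDI _ (mB k) mX) addeC.
  have e2 : lebesgue (B k) = lebesgue (X `&` B k) + lebesgue (B k `\` X).
    by have := borel_lebesgue_measurable mX (B k); rewrite setIC.
  have nufin : nu (B k `\` X) \is a fin_num.
    rewrite ge0_fin_numE// (@le_lt_trans _ _ (nu (B k)))//; last by rewrite nuB ltry.
    by rewrite le_measure ?inE//; exact: subDsetl.
  rewrite -(leeD2rE _ _ nufin) -e1; apply: le_trans (lB k); rewrite e2.
  by rewrite leeD2l// box_measure_le_lebesgue.
have XB : X = \bigcup_k (X `&` B k) by rewrite -setI_bigcupr row_box_cover setIT.
have ndB : nondecreasing_seq (fun k => X `&` B k).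
  move=> i j ij; apply/subsetPset; apply: setIS => x /= h l; have /andP[h1 h2] := h l.
  move: h1 h2; rewrite !mxE => h1 h2.
  by rewrite (le_lt_trans _ h1) ?lerN2 ?ler_nat//= (le_trans h2)// ler_nat.
have c2 : nu (X `&` B k) @[k --> \oo] --> nu X.
  rewrite {2}XB; apply: nondecreasing_cvg_mu => //; last by rewrite -XB.
  by move=> k; exact: measurableI.
have c1 : lam (X `&` B k) @[k --> \oo] --> lam X.
  rewrite {2}XB; apply: nondecreasing_cvg_mu => //.
  - by move=> k; apply: borel_lebesgue_measurable; exact: measurableI.
  - by rewrite -XB; exact: borel_lebesgue_measurable.
rewrite -[leLHS](cvg_lim _ c1)// -(cvg_lim _ c2)//.
by apply: lee_lim; [apply/cvg_ex; eexists; exact: c1|apply/cvg_ex; eexists; exact: c2|exact: nearW].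
Qed.

End borel_lebesgue.

Section lebesgue_basic.
Context (R : realType) (d : nat).
Notation V := 'rV[R]_d.+1.
Local Open Scope ereal_scope.
Implicit Types (X Y : set V) (a b : V).

Lemma lebesgue_measure_repr : exists nu : {sigma_finite_measure set V -> \bar R},
  forall X, measurable X -> lebesgue X = nu X.
Proof.
have [nu nuE] := box_measure_exists R d.+1; exists nu => X mX.
by apply: (lebesgue_box_measureE nuE).
Qed.

Lemma lebesgue_boxE a b : (forall i, (a 0 i <= b 0 i)%R) ->
  lebesgue (box a b) = (box_volume a b)%:E.
Proof.
move=> ab; have [nu nuE] := box_measure_exists R d.+1.
rewrite (lebesgue_box_measureE nuE); last exact: measurable_row_box.
exact: nuE.
Qed.

Lemma lebesgue_null_measurable X : lebesgue X = 0 -> lebesgue_measurable X.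
Proof.
move=> X0; apply: le_caratheodory_measurable => Z.
rewrite [leLHS](_ : _ = lebesgue (Z `&` ~` X)); first exact: le_lebesgue.
rewrite -[RHS]add0e; congr (_ + _).
by apply/eqP; rewrite eq_le outer_measure_ge0 andbT -X0; exact: le_lebesgue.
Qed.

Lemma lebesgue_null_sub X Y : X `<=` Y -> lebesgue Y = 0 -> lebesgue X = 0.
Proof.
by move=> XY Y0; apply/eqP; rewrite eq_le lebesgue_ge0 andbT -Y0 le_lebesgue.
Qed.

(** A Borel set of the same measure around any set: intersect countably many
    unions of boxes whose total volumes decrease to the outer measure. *)
Lemma borel_hull X : exists B, [/\ measurable B, X `<=` B & lebesgue B = lebesgue X].
Proof.
have [Xoo|] := ltP (lebesgue X) +oo; last first.
  rewrite leye_eq => /eqP Xoo; exists setT; split => //.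
  by apply/eqP; rewrite Xoo -leye_eq -Xoo le_lebesgue.
have /choice[ab abP] : forall k : nat, exists ab : (nat -> V) * (nat -> V),
    box_cover X ab.1 ab.2 /\
    \sum_(0 <= j <oo) (box_volume (ab.1 j) (ab.2 j))%:E <= lebesgue X + (k.+1%:R^-1)%:E.
  move=> k; have [|a [b h]] := lebesgue_cover_adherent Xoo (e := (k.+1%:R^-1)%R).
    by rewrite invr_gt0.
  by exists (a, b).
pose U k := \bigcup_j box ((ab k).1 j) ((ab k).2 j).
have mU k : measurable (U k).
  by apply: bigcupT_measurable => j; exact: measurable_box.
have leU k : lebesgue (U k) <= lebesgue X + (k.+1%:R^-1)%:E.
  have [[h1 h2] h3] := abP k; apply: le_trans h3.
  by apply: lebesgue_le_cover; split.
exists (\bigcap_k U k); split.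
- exact: bigcapT_measurable.
- by move=> x Xx k _; have [[_ h] _] := abP k; exact: h.
- apply/eqP; rewrite eq_le; apply/andP; split; last first.
    by apply: le_lebesgue => x Xx k _; have [[_ h] _] := abP k; exact: h.
  apply/lee_addgt0Pr => e e0.
  have [k ke] : exists k : nat, (k.+1%:R^-1 < e)%R.
    have [k _ /(_ k (leqnn k)) kh] := near_infty_natSinv_lt (PosNum e0).
    by exists k.
  apply: (@le_trans _ _ (lebesgue (U k))); first by apply: le_lebesgue => x; exact.
  by apply: le_trans (leU k) _; rewrite leeD2l// lee_fin ltW.
Qed.

(** Finiteness of the measure makes the difference with a hull null. *)
Lemma borel_approx X : lebesgue_measurable X -> lebesgue X < +oo ->
  exists B, [/\ measurable B, X `<=` B & lebesgue (B `\` X) = 0].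
Proof.
move=> mX Xoo; have [B [mB XB BX]] := borel_hull X; exists B; split => //.
have := mX B; rewrite BX (setIidr XB) -setDE => /esym/eqP.
have Xf : lebesgue X \is a fin_num by rewrite ge0_fin_numE ?lebesgue_ge0.
move=> /eqP e; have e' : lebesgue (B `\` X) + lebesgue X = lebesgue X by rewrite addeC.
by have := addeK (lebesgue (B `\` X)) Xf; rewrite e' subee// => <-.
Qed.

Lemma lebesgue_shift_le X (v : V) : lebesgue [set x | X (x + v)%R] <= lebesgue X.
Proof.
apply: le_lebesgue_cover => a b [ab Xab].
rewrite (eq_eseriesr (g := fun k => (box_volume (a k - v)%R (b k - v)%R)%:E)); last first.
  move=> k _; congr (_%:E); apply: eq_bigr => i _; rewrite !mxE; ring.
apply: lebesgue_le_cover; split.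
  by move=> k i; rewrite !mxE lerD2r.
move=> x /= /Xab[k _ h]; exists k => // i; have /andP[h1 h2] := h i.
by move: h1 h2; rewrite !mxE ltrBlDr lerBrDr => -> ->.
Qed.

Lemma lebesgue_shift X (v : V) : lebesgue [set x | X (x + v)%R] = lebesgue X.
Proof.
apply/eqP; rewrite eq_le lebesgue_shift_le/=.
apply: le_trans (lebesgue_shift_le [set x | X (x + v)%R] (- v)%R).
by apply: le_lebesgue => x /=; rewrite subrK.
Qed.

Lemma lebesgue_scale_le X (c : R) : (0 < c)%R ->
  lebesgue [set x | X (c *: x)%R] <= (c^-1 ^+ d.+1)%:E * lebesgue X.
Proof.
move=> c0; have ci : (0 < c^-1 ^+ d.+1)%R by rewrite exprn_gt0// invr_gt0.
rewrite -lee_pdivrMl//; apply: le_lebesgue_cover => a b [ab Xab].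
rewrite lee_pdivrMl// -nneseriesZl; last first.
- by move=> k _; rewrite lee_fin box_volume_ge0.
rewrite (eq_eseriesr (g := fun k => (box_volume (c^-1 *: a k)%R (c^-1 *: b k)%R)%:E)); last first.
  move=> k _; rewrite -EFinM; congr (_%:E).
  rewrite /box_volume [RHS](eq_bigr (fun i => c^-1 * (b k 0 i - a k 0 i))%R).
    by rewrite big_split/= prodr_const card_ord.
  by move=> i _; rewrite !mxE mulrBr.
apply: lebesgue_le_cover; split.
  by move=> k i; rewrite !mxE ler_pM2l// invr_gt0.
move=> x /= /Xab[k _ h]; exists k => // i; have /andP[h1 h2] := h i.
move: h1 h2; rewrite !mxE => h1 h2.
by rewrite ltr_pdivrMl// h1 ler_pdivlMl.
Qed.

End lebesgue_basic.

(** * Euclidean norm and balls *)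

Section dot_product.
Context (R : realType) (d : nat).
Notation V := 'rV[R]_d.+1.
Implicit Types (x y z : V) (c r : R).

Lemma dotC x y : dot x y = dot y x.
Proof. by apply: eq_bigr => i _; rewrite mulrC. Qed.

Lemma dotDl x y z : dot (x + y) z = dot x z + dot y z.
Proof. by rewrite /dot -big_split/=; apply: eq_bigr => i _; rewrite !mxE mulrDl. Qed.

Lemma dotZl c x y : dot (c *: x) y = c * dot x y.
Proof. by rewrite /dot mulr_sumr; apply: eq_bigr => i _; rewrite !mxE mulrA. Qed.

Lemma dotNl x y : dot (- x) y = - dot x y.
Proof. by rewrite -scaleN1r dotZl mulN1r. Qed.

Lemma dotBl x y z : dot (x - y) z = dot x z - dot y z.
Proof. by rewrite dotDl dotNl. Qed.

Lemma dotDr x y z : dot z (x + y) = dot z x + dot z y.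
Proof. by rewrite dotC dotDl ![dot _ z]dotC. Qed.

Lemma dotZr c x y : dot x (c *: y) = c * dot x y.
Proof. by rewrite dotC dotZl dotC. Qed.

Lemma dotNr x y : dot x (- y) = - dot x y.
Proof. by rewrite dotC dotNl dotC. Qed.

Lemma dotBr x y z : dot z (x - y) = dot z x - dot z y.
Proof. by rewrite dotDr dotNr. Qed.

Lemma dot_ge0 x : 0 <= dot x x.
Proof. by apply: sumr_ge0 => i _; rewrite -expr2 sqr_ge0. Qed.

Lemma sqr_coord_le_dot x i : x 0 i ^+ 2 <= dot x x.
Proof.
rewrite /dot (bigD1 i)//= -expr2 lerDl sumr_ge0// => j _.
by rewrite -expr2 sqr_ge0.
Qed.

Lemma dot_eq0 x : (dot x x == 0) = (x == 0).
Proof.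
apply/eqP/eqP => [x0|->]; last by apply: big1 => i _; rewrite mxE mul0r.
apply/rowP => i; rewrite mxE; apply/eqP; rewrite -sqrf_eq0 eq_le sqr_ge0 andbT.
by rewrite -x0 sqr_coord_le_dot.
Qed.

Lemma enorm_ge0 x : 0 <= enorm x.
Proof. exact: sqrtr_ge0. Qed.

Lemma sqr_enorm x : enorm x ^+ 2 = dot x x.
Proof. by rewrite sqr_sqrtr// dot_ge0. Qed.

Lemma enorm_eq0 x : (enorm x == 0) = (x == 0).
Proof. by rewrite -sqrf_eq0 sqr_enorm dot_eq0. Qed.

Lemma enormZ c x : enorm (c *: x) = `|c| * enorm x.
Proof. by rewrite /enorm dotZl dotZr mulrA -expr2 sqrtrM ?sqr_ge0// sqrtr_sqr. Qed.

Lemma enormN x : enorm (- x) = enorm x.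
Proof. by rewrite /enorm dotNl dotNr opprK. Qed.

Lemma enorm_leP x c : 0 <= c -> (enorm x <= c) = (dot x x <= c ^+ 2).
Proof. by move=> c0; rewrite -sqr_enorm ler_pXn2r// nnegrE ?enorm_ge0. Qed.

Lemma enorm_ltP x c : 0 <= c -> (enorm x < c) = (dot x x < c ^+ 2).
Proof. by move=> c0; rewrite -sqr_enorm ltr_pXn2r// nnegrE ?enorm_ge0. Qed.

Lemma CauchySchwarz x y : `|dot x y| <= enorm x * enorm y.
Proof.
rewrite -ler_sqr ?nnegrE ?mulr_ge0 ?enorm_ge0// exprMn !sqr_enorm real_normK ?num_real//.
have [y0|y0] := eqVneq (dot y y) 0.
  move/eqP: (y0); rewrite dot_eq0 => /eqP ->.
  by rewrite -(scale0r 0) !dotZr !mul0r mulr0 expr0n.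
have yy : 0 < dot y y by rewrite lt_neqAle eq_sym y0 dot_ge0.
(* The component of [x] orthogonal to [y], scaled to avoid a division. *)
have := dot_ge0 (dot y y *: x - dot x y *: y).
rewrite dotBl !dotBr !dotZl !dotZr (dotC y x).
have -> : dot y y * (dot y y * dot x x) - dot y y * (dot x y * dot x y) -
   (dot x y * (dot y y * dot x y) - dot x y * (dot x y * dot y y)) =
   dot y y * (dot x x * dot y y - dot x y ^+ 2) by ring.
by rewrite pmulr_rge0// subr_ge0.
Qed.

Lemma enormD x y : enorm (x + y) <= enorm x + enorm y.
Proof.
rewrite enorm_leP ?addr_ge0 ?enorm_ge0// sqrrD !sqr_enorm dotDl !dotDr (dotC y x).
have := le_trans (ler_norm _) (CauchySchwarz x y); lra.
Qed.

Lemma enormB x y : enorm (x - y) <= enorm x + enorm y.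
Proof. by rewrite -(enormN y) enormD. Qed.

Lemma coord_le_enorm x i : `|x 0 i| <= enorm x.
Proof.
by rewrite -ler_sqr ?nnegrE ?enorm_ge0// sqr_enorm real_normK ?num_real// sqr_coord_le_dot.
Qed.

(** The crude constant [d + 1] avoids a square root of the dimension. *)
Lemma enorm_le_bound x c : 0 <= c -> (forall i, `|x 0 i| <= c) ->
  enorm x <= d.+1%:R * c.
Proof.
move=> c0 xc; rewrite enorm_leP ?mulr_ge0// exprMn.
apply: (@le_trans _ _ (\sum_(i < d.+1) c ^+ 2)).
  apply: ler_sum => i _; rewrite -expr2 -(real_normK (num_real (x 0 i))).
  by rewrite ler_sqr ?nnegrE.
rewrite sumr_const card_ord -[c ^+ 2 *+ _]mulr_natl ler_wpM2r ?sqr_ge0//.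
by rewrite -natrX ler_nat expnS expn1 leq_pmulr.
Qed.

Lemma measurable_dotl y : measurable_fun setT (fun x : V => dot x y).
Proof.
apply: measurable_sum => i; apply: measurable_funM; last exact: measurable_cst.
exact: measurable_coord.
Qed.

Lemma measurable_dotxx : measurable_fun setT (fun x : V => dot x x).
Proof.
by apply: measurable_sum => i; apply: measurable_funM; exact: measurable_coord.
Qed.

Lemma measurable_eball r : measurable (eball r : set V).
Proof.
have [r0|r0] := leP 0 r; last first.
  rewrite (_ : eball r = set0)//; apply/seteqP; split => x //=.
  by rewrite /eball/= => /(le_lt_trans (enorm_ge0 x))/(lt_trans r0); rewrite ltxx.
rewrite (_ : eball r = (fun x : V => dot x x) @^-1` `]-oo, r ^+ 2[).
  by rewrite -[X in measurable X]setTI; exact: measurable_dotxx.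
by apply/seteqP; split => x; rewrite /eball/= in_itv/= enorm_ltP.
Qed.

Lemma eball0 : eball 0 = set0 :> set V.
Proof. by apply/seteqP; split => x //; rewrite /eball/= ltNge enorm_ge0. Qed.

Lemma eball_nonpos r : r <= 0 -> eball r = set0 :> set V.
Proof.
move=> r0; apply/seteqP; split => x //; rewrite /eball/= => h.
by have := lt_le_trans h r0; rewrite ltNge enorm_ge0.
Qed.

Lemma eball_sub r s : r <= s -> eball r `<=` (eball s : set V).
Proof. by move=> rs x /= /lt_le_trans; exact. Qed.

Lemma eball_coord r (x : V) i : eball r x -> `|x 0 i| < r.
Proof. by apply: le_lt_trans; exact: coord_le_enorm. Qed.

End dot_product.

Section eball_measure.
Context (R : realType) (d : nat).
Notation V := 'rV[R]_d.+1.
Local Open Scope ereal_scope.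

Lemma lebesgue_eball_fin r : lebesgue (eball r : set V) < +oo.
Proof.
have [r0|r0] := leP 0%R r; last by rewrite eball_nonpos ?ltW// lebesgue0 ltry.
apply: (@le_lt_trans _ _ (lebesgue (box (const_mx (- r)%R) (const_mx r) : set V))).
  apply: le_lebesgue => x xr i; rewrite !mxE.
  have := eball_coord i xr; rewrite ltr_norml => /andP[-> h]; exact: ltW.
by rewrite lebesgue_boxE ?ltry// => i; rewrite !mxE (le_trans _ r0)// oppr_le0.
Qed.

Lemma lebesgue_eball1_gt0 : 0 < lebesgue (eball 1 : set V).
Proof.
pose c : R := (d.+2%:R^-1)%R.
have c0 : (0 < c)%R by rewrite invr_gt0.
apply: (@lt_le_trans _ _ (lebesgue (box (0 : V) (const_mx c)))).
  rewrite lebesgue_boxE => [|i]; last by rewrite !mxE ltW.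
  by rewrite lte_fin prodr_gt0// => i _; rewrite !mxE subr0.
apply: le_lebesgue => x xb; rewrite /eball/=.
apply: (@le_lt_trans _ _ (d.+1%:R * c)%R).
  apply: enorm_le_bound => [|i]; first exact: ltW.
  have := xb i; rewrite !mxE => /andP[h1 h2]; by rewrite ger0_norm// ltW.
by rewrite ltr_pdivrMr// mul1r ltr_nat.
Qed.

(** Balls of every volume exist by scaling, which replaces the continuity of the
    volume in the radius. *)
Lemma lebesgue_eballE r : (0 < r)%R ->
  lebesgue (eball r : set V) = (r ^+ d.+1)%:E * lebesgue (eball 1 : set V).
Proof.
move=> r0; apply/eqP; rewrite eq_le; apply/andP; split.
  have -> : eball r = [set x : V | eball 1 (r^-1 *: x)%R].
    apply/seteqP; split => x /=; rewrite /eball/= enormZ gtr0_norm ?invr_gt0//.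
      by move=> h; rewrite ltr_pdivrMl// mulr1.
    by rewrite ltr_pdivrMl// mulr1.
  have := lebesgue_scale_le (eball 1 : set V) (c := r^-1%R).
  by rewrite invr_gt0 invrK; exact.
have -> : eball 1 = [set x : V | eball r (r *: x)%R].
  apply/seteqP; split => x /=; rewrite /eball/= enormZ gtr0_norm//.
    by move=> h; rewrite gtr_pMr.
  by rewrite gtr_pMr.
rewrite -lee_pdivlMl ?exprn_gt0// -exprVn; exact: lebesgue_scale_le.
Qed.

End eball_measure.

(** * Invariance under linear isometries *)

Section isometry.
Context (R : realType) (d : nat).
Notation V := 'rV[R]_d.+1.
Local Open Scope ereal_scope.
Implicit Types (X Y : set V) (Q : V -> V).

(** The reflections, which exchange any two distinct unit vectors, are such;
    measurability is recorded instead of being derived from linearity. *)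
Record linear_isometry_involution Q : Prop := LinearIsometryInvolution {
  lii_add : forall x y, Q (x + y)%R = (Q x + Q y)%R ;
  lii_scale : forall (c : R) x, Q (c *: x)%R = (c *: Q x)%R ;
  lii_K : forall x, Q (Q x) = x ;
  lii_dot : forall x y, dot (Q x) (Q y) = dot x y ;
  lii_measurable : measurable_fun setT Q }.

Lemma lii_opp Q : linear_isometry_involution Q -> forall x, Q (- x)%R = (- Q x)%R.
Proof. by move=> hQ x; rewrite -scaleN1r (lii_scale hQ)// scaleN1r. Qed.

Lemma lii_sub Q : linear_isometry_involution Q ->
  forall x y, Q (x - y)%R = (Q x - Q y)%R.
Proof. by move=> hQ x y; rewrite (lii_add hQ)// (lii_opp hQ). Qed.

Lemma lii_enorm Q : linear_isometry_involution Q -> forall x, enorm (Q x) = enorm x.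
Proof. by move=> hQ x; rewrite /enorm (lii_dot hQ). Qed.

Lemma lii_oppQ Q : linear_isometry_involution Q ->
  linear_isometry_involution (fun x => - Q x)%R.
Proof.
move=> hQ; split => [x y|c x|x|x y|].
- by rewrite (lii_add hQ)// opprD.
- by rewrite (lii_scale hQ)// scalerN.
- by rewrite (lii_opp hQ)// (lii_K hQ)// opprK.
- by rewrite dotNl dotNr opprK (lii_dot hQ).
- exact: (measurableT_comp (@measurable_rowN R d.+1) (lii_measurable hQ)).
Qed.

Lemma preimage_measurable_vec (f : V -> V) X : measurable_fun setT f ->
  measurable X -> measurable (f @^-1` X).
Proof. by move=> mf mX; rewrite -[X in measurable X]setTI; exact: mf. Qed.

Lemma measurable_row_shift (v : V) : measurable_fun setT (fun y : V => y + v)%R.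
Proof.
apply: measurable_fun_rowP => i; under eq_fun do rewrite mxE.
by apply: measurable_funD; [exact: measurable_coord|exact: measurable_cst].
Qed.

(** The uniqueness of Haar measure, by Fubini: integrate the indicator of
    [x \in A /\ Q y + x \in B] in both orders, substituting [x := z - Q y] in
    one of them. *)
Lemma lebesgue_haar Q A B : linear_isometry_involution Q ->
  measurable A -> measurable B ->
  lebesgue A * lebesgue (Q @^-1` B) =
  lebesgue B * lebesgue [set y | A (- Q y)%R].
Proof.
move=> hQ mA mB; have mQ := lii_measurable hQ.
have [nu nuE] := lebesgue_measure_repr R d.
have mQ2 : measurable_fun setT (fun p : V * V => Q p.2).
  exact: (measurableT_comp mQ measurable_snd).
pose E1 : set (V * V) := [set p | A p.1 /\ B (Q p.2 + p.1)%R].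
pose E2 : set (V * V) := [set p | B p.1 /\ A (p.1 - Q p.2)%R].
have mE1 : measurable E1.
  apply: measurableI.
    by rewrite -[X in measurable X]setTI; exact: measurable_fst.
  rewrite -[X in measurable X]setTI.
  have mf : measurable_fun setT (fun p : V * V => (Q p.2 + p.1)%R).
    apply: (measurableT_comp (@measurable_rowD R d.+1) (g := fun p : V * V => (Q p.2, p.1))).
    by apply/measurable_fun_pairP; split => //; exact: measurable_fst.
  exact: mf.
have mE2 : measurable E2.
  apply: measurableI.
    by rewrite -[X in measurable X]setTI; exact: measurable_fst.
  rewrite -[X in measurable X]setTI.
  have mf : measurable_fun setT (fun p : V * V => (p.1 - Q p.2)%R).
    apply: (measurableT_comp (@measurable_rowD R d.+1) (g := fun p : V * V => (p.1, - Q p.2)%R)).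
    apply/measurable_fun_pairP; split; first exact: measurable_fst.
    exact: (measurableT_comp (@measurable_rowN R d.+1) mQ2).
  exact: mf.
have fub E : measurable E ->
    \int[nu]_x nu (xsection E x) = \int[nu]_y nu (ysection E y).
  move=> mE; have := @indic_fubini_tonelli _ _ _ _ _ nu nu _ mE.
  by rewrite indic_fubini_tonelli_FE// indic_fubini_tonelli_GE.
have sec1 x : nu (xsection E1 x) = (lebesgue (Q @^-1` B)) * (\1_A x)%:E.
  rewrite indicE; have [xA|xA] := boolP (x \in A).
    rewrite mule1 (_ : xsection E1 x = [set y | (Q @^-1` B) (y + Q x)%R]).
      rewrite -nuE ?lebesgue_shift//.
      have := @preimage_measurable_vec (fun y => y + Q x)%R (Q @^-1` B).
      apply; last exact: preimage_measurable_vec.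
      exact: measurable_row_shift.
    apply/seteqP; split => y; rewrite /xsection/= in_setE/= (lii_add hQ)// (lii_K hQ)//.
      by case.
    by move=> h; split => //; rewrite inE in xA.
  rewrite mule0 (_ : xsection E1 x = set0) ?measure0//.
  apply/seteqP; split => y //; rewrite /xsection/= in_setE/= => -[+ _].
  by rewrite notin_setE in xA.
have sec2 x : nu (xsection E2 x) = (lebesgue [set y | A (- Q y)%R]) * (\1_B x)%:E.
  rewrite indicE; have [xB|xB] := boolP (x \in B).
    rewrite mule1 (_ : xsection E2 x = [set y | [set y | A (- Q y)%R] (y + - Q x)%R]).
      rewrite -nuE ?lebesgue_shift//.
      apply: (@preimage_measurable_vec (fun y => - Q (y - Q x))%R) => //.
      apply: (measurableT_comp (lii_measurable (lii_oppQ hQ)) (g := fun y : V => (y - Q x)%R)).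
      exact: measurable_row_shift.
    apply/seteqP; split => y; rewrite /xsection/= in_setE/= (lii_sub hQ)// (lii_K hQ)// opprB.
      by case.
    by move=> h; split => //; rewrite inE in xB.
  rewrite mule0 (_ : xsection E2 x = set0) ?measure0//.
  apply/seteqP; split => y //; rewrite /xsection/= in_setE/= => -[+ _].
  by rewrite notin_setE in xB.
have sec y : nu (ysection E1 y) = nu (ysection E2 y).
  rewrite -!nuE; [|exact: measurable_ysection|exact: measurable_ysection].
  rewrite -(lebesgue_shift (ysection E1 y) (- Q y)%R); congr (lebesgue _).
  apply/seteqP; split => x; rewrite /ysection/= !in_setE /E1 /E2/=.
    by rewrite (addrC (Q y)) subrK => -[].
  by rewrite (addrC (Q y)) subrK => -[].
have intind C : measurable C -> \int[nu]_x (\1_C x)%:E = lebesgue C.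
  by move=> mC; rewrite integral_indic// setIT; exact/esym/nuE.
have int1 : \int[nu]_x nu (xsection E1 x) = lebesgue A * lebesgue (Q @^-1` B).
  rewrite (eq_integral _ _ (fun x _ => sec1 x)) ge0_integralZl//.
  - by rewrite intind// muleC.
  - exact/measurable_EFinP/measurable_indic.
  - exact: lebesgue_ge0.
have int2 : \int[nu]_x nu (xsection E2 x) = lebesgue B * lebesgue [set y | A (- Q y)%R].
  rewrite (eq_integral _ _ (fun x _ => sec2 x)) ge0_integralZl//.
  - by rewrite intind// muleC.
  - exact/measurable_EFinP/measurable_indic.
  - exact: lebesgue_ge0.
rewrite -int1 -int2 (fub _ mE1) (fub _ mE2).
by apply: eq_integral => y _; exact: sec.
Qed.

(** [lebesgue_haar] for [- Q] and the unit ball, which [Q] preserves. *)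
Lemma lebesgue_isometry_borel Q A : linear_isometry_involution Q ->
  measurable A -> lebesgue (Q @^-1` A) = lebesgue A.
Proof.
move=> hQ mA.
have mB : measurable (eball 1 : set V) by exact: measurable_eball.
have := lebesgue_haar (lii_oppQ hQ) mA mB.
have -> : (fun x => - Q x)%R @^-1` (eball 1 : set V) = eball 1.
  by apply/seteqP; split => x; rewrite /eball/= enormN (lii_enorm hQ).
rewrite (_ : [set y | _] = Q @^-1` A); last first.
  by apply/seteqP; split => x /=; rewrite opprK.
have b0 := lebesgue_eball1_gt0 R d.
have bf : lebesgue (eball 1 : set V) \is a fin_num.
  by rewrite ge0_fin_numE ?lebesgue_ge0// lebesgue_eball_fin.
rewrite muleC => e; apply/eqP.
by rewrite eq_le -(lee_pmul2l bf b0) -[X in _ && X](lee_pmul2l bf b0) e lexx.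
Qed.

Lemma lebesgue_isometry Q X : linear_isometry_involution Q ->
  lebesgue (Q @^-1` X) = lebesgue X.
Proof.
move=> hQ; have le Y : lebesgue (Q @^-1` Y) <= lebesgue Y.
  have [B [mB YB <-]] := borel_hull Y.
  by rewrite -(lebesgue_isometry_borel hQ mB) le_lebesgue// => x; exact: YB.
apply/eqP; rewrite eq_le le/=; apply: le_trans (le (Q @^-1` X)).
by apply: le_lebesgue => x /=; rewrite (lii_K hQ).
Qed.

Lemma lebesgue_measurable_isometry Q X : linear_isometry_involution Q ->
  lebesgue_measurable X -> lebesgue_measurable (Q @^-1` X).
Proof.
move=> hQ mX Z; have := mX (Q @^-1` Z).
rewrite (lebesgue_isometry _ hQ) => ->; congr (_ + _).
  rewrite -(lebesgue_isometry (Z `&` _) hQ); congr (lebesgue _).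
  by apply/seteqP; split => x /=; rewrite (lii_K hQ).
rewrite -(lebesgue_isometry (Z `&` _) hQ); congr (lebesgue _).
by apply/seteqP; split => x /=; rewrite (lii_K hQ).
Qed.

End isometry.

Section reflection.
Context (R : realType) (d : nat).
Notation V := 'rV[R]_d.+1.
Implicit Types (w x y e : V).

Definition reflection w x : V := x - (2 * dot x w) *: w.

Lemma reflection_lii w : dot w w = 1 -> linear_isometry_involution (reflection w).
Proof.
move=> w1; split => [x y|c x|x|x y|].
- by rewrite /reflection dotDl mulrDr scalerDl opprD addrACA.
- by rewrite /reflection dotZl scalerBr scalerA; congr (_ - _ *: _); ring.
- rewrite /reflection dotBl dotZl w1 -addrA -opprD -scalerDl.
  rewrite (_ : 2 * dot x w + _ = 0) ?scale0r ?subr0//; ring.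
- rewrite /reflection dotBl !dotBr !dotZl !dotZr w1 (dotC w y); ring.
- apply: measurable_fun_rowP => i; under eq_fun do rewrite !mxE.
  apply: measurable_funB; first exact: measurable_coord.
  apply: measurable_funM; last exact: measurable_cst.
  apply: measurable_funM; [exact: measurable_cst|exact: measurable_dotl].
Qed.

Lemma id_lii : linear_isometry_involution (id : V -> V).
Proof. by split. Qed.

(** Two distinct unit vectors are exchanged by the reflection in their bisecting
    hyperplane. *)
Lemma exists_swap e e' : dot e e = 1 -> dot e' e' = 1 ->
  exists Q : V -> V, linear_isometry_involution Q /\ Q e = e'.
Proof.
move=> e1 e'1; have [<-|ne] := eqVneq e e'; first by exists id; split => //; exact: id_lii.
pose f := e - e'; have f0 : enorm f != 0 by rewrite enorm_eq0 subr_eq0.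
pose w := (enorm f)^-1 *: f.
have w1 : dot w w = 1.
  by rewrite /w dotZl dotZr -sqr_enorm; field.
exists (reflection w); split; first exact: reflection_lii.
rewrite /reflection /w dotZr scalerA.
have ff : dot f f = 2 * (1 - dot e e').
  by rewrite /f dotBl !dotBr e1 e'1 (dotC e' e); ring.
have ef : dot e f = 1 - dot e e' by rewrite /f dotBr e1.
rewrite (_ : _ * _ = 1) ?scale1r; first by rewrite /f opprB addrC subrK.
rewrite ef; have -> : 2 * ((enorm f)^-1 * (1 - dot e e')) / enorm f =
   (2 * (1 - dot e e')) / (enorm f) ^+ 2 by field.
by rewrite sqr_enorm -ff divff// -sqr_enorm sqrf_eq0.
Qed.

End reflection.

(** * Outer length on the line *)

Section outer_length.
Context (R : realType).
Notation L := (@completed_lebesgue_measure R).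
Local Open Scope ereal_scope.
Implicit Types (A B : set R) (g : \bar R).

Let om : {outer_measure set (ocitv_type R) -> \bar R} := ((@wlength R idfun)^*)%mu.

Lemma outer_length_ge0 A : 0 <= L A.
Proof. exact: (outer_measure_ge0 om). Qed.

Lemma le_outer_length A B : A `<=` B -> L A <= L B.
Proof. exact: (le_outer_measure om). Qed.

Lemma outer_length0 : L set0 = 0.
Proof. exact: (outer_measure0 om). Qed.

Lemma outer_lengthU A B : L (A `|` B) <= L A + L B.
Proof. exact: (outer_measureU2 om). Qed.

Lemma outer_length_bigcup_null (F : (set R)^nat) :
  (forall k, L (F k) = 0) -> L (\bigcup_k F k) = 0.
Proof.
move=> F0; apply/eqP; rewrite eq_le outer_length_ge0 andbT.
apply: le_trans (outer_measure_sigma_subadditive om F) _.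
by rewrite eseries0// => k _ _; exact: F0.
Qed.

Lemma outer_length_null_sub A B : A `<=` B -> L B = 0 -> L A = 0.
Proof.
by move=> AB B0; apply/eqP; rewrite eq_le outer_length_ge0 andbT -B0 le_outer_length.
Qed.

Lemma outer_lengthE A : L A = lebesgue_measure A.
Proof. by []. Qed.

Lemma borel_outer_length_split A B : measurable (B : set (measurableTypeR R)) ->
  L A = L (A `&` B) + L (A `\` B).
Proof. by move=> mB; exact: (@sub_caratheodory _ _ _ (@wlength R idfun) _ mB A). Qed.

Lemma outer_length_hull A :
  exists B, [/\ measurable (B : set (measurableTypeR R)), A `<=` B & L B = L A].
Proof.
have [G [oG AG GA]] := outer_measure_Gdelta A; exists (\bigcap_i G i); split => //.
by apply: bigcapT_measurable => i; exact: open_measurable.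
Qed.

Let length_map_le (f : R -> R) A : measurable_fun setT (f : R -> measurableTypeR R) ->
  (forall B, measurable (B : set (measurableTypeR R)) -> L (f @^-1` B) = L B) ->
  L (f @^-1` A) <= L A.
Proof.
move=> mf fB; have [B [mB AB <-]] := outer_length_hull A.
by rewrite -(fB _ mB); apply: le_outer_length => x; exact: AB.
Qed.

Lemma outer_length_shift_borel c B : measurable (B : set (measurableTypeR R)) ->
  L ((fun t => t + c)%R @^-1` B) = L B.
Proof.
move=> mB.
have mf : measurable_fun setT ((fun t => t + c)%R : measurableTypeR R -> measurableTypeR R).
  by apply: measurable_funD; [exact: measurable_id|exact: measurable_cst].
pose nu : {measure set (measurableTypeR R) -> \bar R} :=
  measure_function_pushforward__canonical__measure_function_Measure
    (@lebesgue_measure R) mf.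
rewrite !outer_lengthE; apply/esym.
apply: (lebesgue_measure_unique (mu := nu)) => // _ [[a b] _ <-].
rewrite /nu/= /pushforward (_ : _ @^-1` _ = `](a - c)%R, (b - c)%R]%classic).
  rewrite !lebesgue_measure_itv/= !lte_fin ltrD2r -!EFinB; case: ifPn => // _.
  by congr (_%:E); ring.
by apply/seteqP; split => t /=; rewrite !in_itv/= ltrBlDr lerBrDr.
Qed.

Lemma outer_length_shift c A : L ((fun t => t + c)%R @^-1` A) = L A.
Proof.
have le c' B : L ((fun t => t + c')%R @^-1` B) <= L B.
  apply: length_map_le => [|C]; last exact: outer_length_shift_borel.
  by apply: measurable_funD; [exact: measurable_id|exact: measurable_cst].
apply/eqP; rewrite eq_le le/=; apply: le_trans (le (- c)%R _).
by apply: le_outer_length => t /=; rewrite subrK.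
Qed.

Lemma outer_length_opp A : L (-%R @^-1` A) = L A.
Proof.
have le B : L (-%R @^-1` B) <= L B.
  apply: length_map_le => [|C mC]; first exact: measurable_funN.
  by have := lebesgue_measureN mC.
apply/eqP; rewrite eq_le le/=; apply: le_trans (le _).
by apply: le_outer_length => t /=; rewrite opprK.
Qed.

(** The one-dimensional Brunn-Minkowski inequality for the sum with an
    interval: cut [A] at one of its points [p], push both halves apart by
    [tau], and fit the interval of radius [tau] around [p] in the gap. *)
Lemma outer_length_enlarge A (tau : R) : (0 <= tau)%R -> A !=set0 ->
  L A + (2 * tau)%:E <= L [set t | exists2 s, A s & `|t - s| <= tau]%R.
Proof.
move=> tau0 [p Ap]; set A' := [set t | _].
pose U := [set` `]-oo, (p - tau)%R[]; pose W := [set` `[(p - tau)%R, (p + tau)%R]].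
have mU : measurable (U : set (measurableTypeR R)) by exact: measurable_itv.
have mW : measurable (W : set (measurableTypeR R)) by exact: measurable_itv.
rewrite (borel_outer_length_split A' mU) (borel_outer_length_split (A' `\` U) mW).
pose Al := A `&` [set` `]-oo, p[]; pose Ar := A `\` `]-oo, p]%classic.
have LA : L A <= L Al + L Ar.
  apply: (@le_trans _ _ (L (Al `|` [set p] `|` Ar))).
    apply: le_outer_length => t At; case: (ltgtP t p) => tp.
    - by left; left; split => //=; rewrite in_itv.
    - by right; split => //=; rewrite in_itv/= leNgt tp.
    - by left; right.
  apply: le_trans (outer_lengthU _ _) _; rewrite leeD2r//.
  apply: le_trans (outer_lengthU _ _) _.
  by rewrite (_ : L [set p] = 0) ?adde0// outer_lengthE lebesgue_measure_set1.
apply: (@le_trans _ _ (L Al + L Ar + (2 * tau)%:E)); first by rewrite leeD2r.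
rewrite -addeA [X in _ + X]addeC; apply: leeD.
  rewrite -(outer_length_shift tau Al); apply: le_outer_length => t [/= At].
  rewrite in_itv/= => tp; split; last by rewrite /U/= in_itv/= ltrBrDr.
  exists (t + tau)%R => //; by rewrite opprD addrA subrr sub0r normrN ger0_norm.
apply: leeD.
  have -> : (2 * tau)%:E = L W.
    rewrite outer_lengthE lebesgue_measure_itv/= lte_fin ltrD2l.
    have [t0|] := ltP 0%R tau.
      by rewrite ifT ?gtrN// -EFinB; congr (_%:E); ring.
    rewrite le_eqVlt ltNge tau0 orbF => /eqP ->.
    by rewrite oppr0 ltxx mulr0.
  apply: le_outer_length => t Wt; split => //; split.
    move: Wt; rewrite /W/= in_itv/= => h.
    by exists p => //; rewrite ler_distl.
  by move: Wt; rewrite /U /W/= !in_itv/= => /andP[h _]; apply/negP; rewrite -leNgt.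
rewrite -(outer_length_shift (- tau)%R Ar); apply: le_outer_length => t [/= At].
rewrite in_itv/= => /negP; rewrite -ltNge => tp.
have tp' : (p + tau < t)%R by rewrite -ltrBrDr.
split; last by rewrite /W/= in_itv/= => /andP[_]; rewrite leNgt tp'.
split; last by rewrite /U/= in_itv/= => h; have := lt_trans tp' h; lra.
exists (t - tau)%R => //; by rewrite opprB addrC subrK ger0_norm.
Qed.

(** A length [g] is encoded by the centered open interval of that length; this
    is the section of a symmetrized set. *)
Definition centered_interval g : set R := [set s | (2 * `|s|)%:E < g].

Lemma centered_intervalE (r : R) : centered_interval r%:E = `](- (r / 2))%R, (r / 2)%R[%classic.
Proof.
apply/seteqP; split => s; rewrite /centered_interval/= in_itv/= lte_fin -ltr_norml; lra.
Qed.

Lemma measurable_centered_interval g :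
  measurable (centered_interval g : set (measurableTypeR R)).
Proof.
case: g => [r||]; first by rewrite centered_intervalE; exact: measurable_itv.
  by rewrite (_ : centered_interval _ = setT)//; apply/seteqP; split => // s _ /=; exact: ltry.
by rewrite (_ : centered_interval _ = set0)//; apply/seteqP; split => // s.
Qed.

Lemma outer_length_centered_interval g : 0 <= g -> L (centered_interval g) = g.
Proof.
case: g => [r||//]; last first.
  move=> _; rewrite (_ : centered_interval _ = [set` `]-oo, +oo[]).
    by rewrite outer_lengthE lebesgue_measure_itv.
  by apply/seteqP; split => s _ /=; [rewrite in_itv|exact: ltry].
rewrite lee_fin centered_intervalE => r0; rewrite outer_lengthE lebesgue_measure_itv/= lte_fin.
case: ifPn => [_|h]; first by rewrite -EFinB; congr (_%:E); lra.
by congr (_%:E); move: h; rewrite -leNgt; lra.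
Qed.

Lemma centered_interval_sub g g' : g <= g' -> centered_interval g `<=` centered_interval g'.
Proof. by move=> gg s /= /lt_le_trans; exact. Qed.

(** Concentric intervals are nested, so the length of their difference is the
    difference of the lengths. *)
Lemma centered_interval_contract A B :
  L (centered_interval (L A) `\` centered_interval (L B)) <= L (A `\` B).
Proof.
have [AB|BA] := leP (L A) (L B).
  rewrite (_ : _ `\` _ = set0) ?outer_length0 ?outer_length_ge0//.
  by apply/seteqP; split => s // [/(centered_interval_sub AB)].
have Bf : L B \is a fin_num.
  by rewrite ge0_fin_numE ?outer_length_ge0// (lt_le_trans BA)// leey.
have := borel_outer_length_split (centered_interval (L A)) (measurable_centered_interval (L B)).
rewrite (setIidr (centered_interval_sub (ltW BA))).
rewrite !outer_length_centered_interval ?outer_length_ge0// => e.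
rewrite -(leeD2lE _ _ Bf) -e.
apply: (@le_trans _ _ (L (B `|` (A `\` B)))); last exact: outer_lengthU.
by apply: le_outer_length => t At; have [Bt|Bt] := pselect (B t); [left|right].
Qed.

End outer_length.

(** * Steiner symmetrization along a unit vector *)

Section steiner_direction.
Context (R : realType) (d : nat).
Notation V := 'rV[R]_d.+1.
Notation L := (@completed_lebesgue_measure R).
Local Open Scope ereal_scope.
Implicit Types (X Y : set V) (e y : V).

Definition steiner_dir X e : set V :=
  [set y | ((2 * `|dot y e|)%:E < L (line_section X e (y - dot y e *: e)%R))%E].

Lemma steinerE X u : steiner X u = steiner_dir X (unit_vector u).
Proof. by []. Qed.

Lemma steiner_dirN X e : steiner_dir X (- e)%R = steiner_dir X e.
Proof.
apply/funext => y; rewrite /steiner_dir/= dotNr normrN scalerN scaleNr opprK.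
rewrite -[in RHS](outer_length_opp (line_section X e _)); congr (_ < L _).
by apply/seteqP; split => t; rewrite /line_section/= scalerN scaleNr.
Qed.

(** Symmetrization commutes with isometries, which reduces any direction to the
    first axis. *)
Lemma steiner_dir_isometry Q X e : linear_isometry_involution Q ->
  steiner_dir (Q @^-1` X) (Q e) = Q @^-1` (steiner_dir X e).
Proof.
move=> hQ; apply/funext => y; rewrite /steiner_dir/=.
have -> : dot y (Q e) = dot (Q y) e by rewrite -[in LHS](lii_K hQ y) (lii_dot hQ).
congr (_ < L _); apply/seteqP; split => t; rewrite /line_section/=.
  by rewrite (lii_add hQ) (lii_sub hQ) !(lii_scale hQ) (lii_K hQ).
by rewrite (lii_add hQ) (lii_sub hQ) !(lii_scale hQ) (lii_K hQ).
Qed.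

Lemma le_steiner_dir X Y e : X `<=` Y -> steiner_dir X e `<=` steiner_dir Y e.
Proof.
move=> XY y /= /lt_le_trans; apply; apply: le_outer_length => t; exact: XY.
Qed.

Definition first_axis : V := delta_mx 0%R 0%R.

Lemma dot_first_axis y : dot y first_axis = y 0%R 0%R.
Proof.
rewrite /dot (bigD1 0%R)//= !mxE !eqxx mulr1 big1 ?addr0// => i i0.
by rewrite mxE (negbTE i0) andbF mulr0.
Qed.

Lemma first_axis_unit : dot first_axis first_axis = 1%R.
Proof. by rewrite dot_first_axis mxE !eqxx. Qed.

Definition vsection X (z : 'rV[R]_d) : set R := [set t | X (vcons t z)].

Lemma vcons_first_axis t y : (y - y 0 0 *: first_axis + t *: first_axis)%R = vcons t (vtail y).
Proof.
apply/rowP => i; rewrite !mxE; case: (unliftP ord0 i) => [j|] ->.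
  by rewrite mxE (_ : (lift ord0 j == 0%R :> 'I_d.+1) = false)// andbF !mulr0 subr0 addr0.
by rewrite !eqxx !mulr1 subrr add0r.
Qed.

Lemma steiner_first_axis X : steiner_dir X first_axis =
  [set y : V | (2 * `|y 0%R 0%R|)%:E < L (vsection X (vtail y))].
Proof.
apply/funext => y; rewrite /steiner_dir/= dot_first_axis; congr (_ < L _).
apply/seteqP; split => t; rewrite /line_section/vsection/=.
  by rewrite vcons_first_axis.
by rewrite vcons_first_axis.
Qed.

Lemma vsection_steiner X z :
  vsection (steiner_dir X first_axis) z = centered_interval (L (vsection X z)).
Proof.
by rewrite steiner_first_axis /vsection/centered_interval/=; apply/funext => t/=;
  rewrite vconsK (_ : vcons t z 0%R 0%R = t)//; exact: vcons0.
Qed.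

(** Cavalieri's principle along the first axis. *)
Lemma lebesgue_cavalieri : exists nu : {sigma_finite_measure set 'rV[R]_d -> \bar R},
  forall X, measurable X -> measurable_fun setT (fun z => L (vsection X z)) /\
    lebesgue X = \int[nu]_z L (vsection X z).
Proof.
have [nu nuE] := box_measure_exists R d; exists nu => X mX.
split; first exact: (measurable_cons_section mX).
rewrite (lebesgue_box_measureE (nu := cons_measure nu))//; last first.
  by move=> a b ab; exact: cons_measure_box.
exact: cons_measureE.
Qed.

Lemma measurable_vsection X z : measurable X ->
  measurable (vsection X z : set (measurableTypeR R)).
Proof.
move=> mX; rewrite -[X in measurable X]setTI.
suff mf : measurable_fun setT (fun t : measurableTypeR R => vcons t z) by exact: mf.
apply: measurable_fun_rowP => i; under eq_fun do rewrite mxE.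
case: (unlift ord0 i) => [j|]; [exact: measurable_cst|exact: measurable_id].
Qed.

Lemma measurable_steiner_first_axis X : measurable X ->
  measurable (steiner_dir X first_axis).
Proof.
move=> mX; have [nu nuE] := lebesgue_cavalieri; rewrite steiner_first_axis.
have mg := measurableT_comp (nuE _ mX).1 (@measurable_vtail R d).
have mf : measurable_fun setT (fun y : V => (2 * `|y 0%R 0%R|)%:E : \bar R).
  apply/measurable_EFinP; apply: measurable_funM; first exact: measurable_cst.
  apply: (measurableT_comp (f := fun r : R => `|r|%R)); first exact: normr_measurable.
  exact: measurable_coord.
by have := measurable_lte measurableT mf mg; rewrite setTI.
Qed.

Lemma lebesgue_steiner_first_axis X : measurable X ->
  lebesgue (steiner_dir X first_axis) = lebesgue X.
Proof.
move=> mX; have [nu nuE] := lebesgue_cavalieri.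
rewrite (nuE _ mX).2 (nuE _ (measurable_steiner_first_axis mX)).2.
by apply: eq_integral => z _; rewrite vsection_steiner outer_length_centered_interval// outer_length_ge0.
Qed.

(** The contraction holds section by section, where it is that of lengths. *)
Lemma contract_steiner_first_axis X Y : measurable X -> measurable Y ->
  lebesgue (steiner_dir X first_axis `\` steiner_dir Y first_axis) <= lebesgue (X `\` Y).
Proof.
move=> mX mY; have [nu nuE] := lebesgue_cavalieri.
have mXY : measurable (X `\` Y) by exact: measurableD.
have mTXY : measurable (steiner_dir X first_axis `\` steiner_dir Y first_axis).
  by apply: measurableD; exact: measurable_steiner_first_axis.
rewrite (nuE _ mXY).2 (nuE _ mTXY).2; apply: ge0_le_integral => //.
- exact: (nuE _ mTXY).1.
- exact: (nuE _ mXY).1.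
- move=> z _; rewrite /vsection/=.
  have -> : [set t | (steiner_dir X first_axis `\` steiner_dir Y first_axis) (vcons t z)] =
     vsection (steiner_dir X first_axis) z `\` vsection (steiner_dir Y first_axis) z by [].
  by rewrite !vsection_steiner; exact: centered_interval_contract.
Qed.

(** A null set has null sections over a conull set of base points, which gives
    a null cylinder over the exceptional base points. *)
Lemma null_vsection X : lebesgue X = 0 ->
  lebesgue [set y : V | L (vsection X (vtail y)) != 0] = 0.
Proof.
move=> X0; have [B [mB XB BX]] := borel_hull X; rewrite X0 in BX.
have [nu nuE] := lebesgue_cavalieri; have [mg gE] := nuE _ mB.
pose N : set V := [set y : V | L (vsection B (vtail y)) != 0].
apply: (@lebesgue_null_sub _ _ _ N).
  move=> y /=; apply: contraNN => /eqP h; apply/eqP.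
  by apply: outer_length_null_sub h => t; exact: XB.
have mN : measurable N.
  have := emeasurable_neq measurableT (measurableT_comp mg (@measurable_vtail R d)) 0.
  by rewrite setTI.
rewrite (nuE _ mN).2.
have /ae_eq_integral_abs : \int[nu]_(z in setT) `|L (vsection B z)| = 0.
  rewrite -BX gE; apply: eq_integral => z _; rewrite gee0_abs//.
move=> /(_ measurableT mg) ae0.
have <- : \int[nu]_(z in setT) cst 0 z = 0 by exact: integral0.
apply: ge0_ae_eq_integral => //.
  exact: (nuE _ mN).1.
apply: filterS ae0 => z /= /(_ I) z0 _.
rewrite (_ : vsection N z = set0) ?outer_length0//; apply/seteqP; split => t //.
by rewrite /N /vsection/= vconsK z0 eqxx.
Qed.

(** Almost every section of [X] is contained in that of [Y] up to a null set. *)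
Lemma null_steiner_first_axis X Y : lebesgue (X `\` Y) = 0 ->
  lebesgue (steiner_dir X first_axis `\` steiner_dir Y first_axis) = 0.
Proof.
move=> /null_vsection; apply: lebesgue_null_sub => y.
rewrite !steiner_first_axis/= => -[h1 h2]; apply/eqP => h0; apply: h2.
apply: lt_le_trans h1 _.
apply: (@le_trans _ _ (L (vsection Y (vtail y) `|` vsection (X `\` Y) (vtail y)))).
  apply: le_outer_length => t Xt.
  by have [Yt|Yt] := pselect (Y (vcons t (vtail y))); [left|right].
by apply: le_trans (outer_lengthU _ _) _; rewrite h0 adde0.
Qed.

End steiner_direction.

Section steiner_general_direction.
Context (R : realType) (d : nat).
Notation V := 'rV[R]_d.+1.
Notation L := (@completed_lebesgue_measure R).
Local Open Scope ereal_scope.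
Implicit Types (X Y : set V) (e y : V).

Lemma lebesgue_measurableD X Y :
  lebesgue_measurable X -> lebesgue_measurable Y -> lebesgue_measurable (X `\` Y).
Proof. exact: (caratheodory_measurable_setD (mu := @lebesgue R d)). Qed.

Lemma lebesgue_measurableI X Y :
  lebesgue_measurable X -> lebesgue_measurable Y -> lebesgue_measurable (X `&` Y).
Proof. exact: (caratheodory_measurable_setI (mu := @lebesgue R d)). Qed.

Lemma lebesgue_measurableC X : lebesgue_measurable X -> lebesgue_measurable (~` X).
Proof. exact: (caratheodory_measurable_setC (mu := @lebesgue R d)). Qed.

Lemma lebesgue_measurable_bigcup (F : (set V)^nat) :
  (forall k, lebesgue_measurable (F k)) -> lebesgue_measurable (\bigcup_k F k).
Proof. exact: (caratheodory_measurable_bigcup (mu := @lebesgue R d)). Qed.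

Lemma lebesgueU X Y : lebesgue (X `|` Y) <= lebesgue X + lebesgue Y.
Proof. exact: (outer_measureU2 (@lebesgue R d)). Qed.

Lemma preimage_lii_measurable (Q : V -> V) X : linear_isometry_involution Q ->
  measurable X -> measurable (Q @^-1` X).
Proof. by move=> hQ; exact: (preimage_measurable_vec (lii_measurable hQ)). Qed.

Lemma steiner_dir_rotate e : dot e e = 1%R ->
  exists Q : V -> V, linear_isometry_involution Q /\
    forall X, steiner_dir X e = Q @^-1` steiner_dir (Q @^-1` X) (first_axis R d).
Proof.
move=> e1; have [Q [hQ Qe]] := exists_swap (first_axis_unit R d) e1.
exists Q; split => // X; rewrite -(steiner_dir_isometry _ _ hQ) Qe.
congr (steiner_dir _ _); apply/funext => x /=.
by rewrite (lii_K hQ).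
Qed.

Let preimage_setD (Q : V -> V) X Y : Q @^-1` (X `\` Y) = Q @^-1` X `\` Q @^-1` Y.
Proof. by []. Qed.

Section unit_direction.
Variables (e : V) (e1 : dot e e = 1%R).

Lemma measurable_steiner_dir X : measurable X -> measurable (steiner_dir X e).
Proof.
move=> mX; have [Q [hQ ->]] := steiner_dir_rotate e1.
apply: preimage_lii_measurable => //; apply: measurable_steiner_first_axis.
exact: preimage_lii_measurable.
Qed.

Lemma lebesgue_steiner_borel X : measurable X ->
  lebesgue (steiner_dir X e) = lebesgue X.
Proof.
move=> mX; have [Q [hQ ->]] := steiner_dir_rotate e1.
rewrite (lebesgue_isometry _ hQ) lebesgue_steiner_first_axis.
  by rewrite (lebesgue_isometry _ hQ).
exact: preimage_lii_measurable.
Qed.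

Lemma steiner_contract_borel X Y : measurable X -> measurable Y ->
  lebesgue (steiner_dir X e `\` steiner_dir Y e) <= lebesgue (X `\` Y).
Proof.
move=> mX mY; have [Q [hQ QE]] := steiner_dir_rotate e1; rewrite !QE -preimage_setD.
rewrite (lebesgue_isometry _ hQ) -[leRHS](lebesgue_isometry _ hQ) preimage_setD.
by apply: contract_steiner_first_axis; exact: preimage_lii_measurable.
Qed.

Lemma null_steiner X Y : lebesgue (X `\` Y) = 0 ->
  lebesgue (steiner_dir X e `\` steiner_dir Y e) = 0.
Proof.
move=> XY; have [Q [hQ QE]] := steiner_dir_rotate e1; rewrite !QE -preimage_setD.
rewrite (lebesgue_isometry _ hQ); apply: null_steiner_first_axis.
by rewrite -preimage_setD (lebesgue_isometry _ hQ).
Qed.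

(** Symmetrization respects null sets, so the results for Borel sets extend to
    Lebesgue measurable sets of finite measure. *)
Lemma steiner_borel_hull X : lebesgue_measurable X -> lebesgue X < +oo ->
  exists B, [/\ measurable B, X `<=` B, lebesgue (B `\` X) = 0 &
    lebesgue (steiner_dir B e `\` steiner_dir X e) = 0].
Proof.
move=> mX Xoo; have [B [mB XB BX]] := borel_approx mX Xoo.
by exists B; split => //; exact: null_steiner.
Qed.

Lemma lebesgue_measurable_steiner_dir X : lebesgue_measurable X -> lebesgue X < +oo ->
  lebesgue_measurable (steiner_dir X e).
Proof.
move=> mX Xoo; have [B [mB XB BX TBX]] := steiner_borel_hull mX Xoo.
have -> : steiner_dir X e = steiner_dir B e `\` (steiner_dir B e `\` steiner_dir X e).
  rewrite setDD; apply/esym/setIidr; exact: le_steiner_dir.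
apply: lebesgue_measurableD; last exact: lebesgue_null_measurable.
by apply: borel_lebesgue_measurable; exact: measurable_steiner_dir.
Qed.

Lemma lebesgue_setD_null X Y : Y `<=` X -> lebesgue (X `\` Y) = 0 -> lebesgue X = lebesgue Y.
Proof.
move=> YX XY; apply/eqP; rewrite eq_le (le_lebesgue YX) andbT.
rewrite -(setDUK YX); apply: le_trans (lebesgueU _ _) _.
by rewrite [X in _ + X]XY adde0.
Qed.

Lemma lebesgue_steiner_dir X : lebesgue_measurable X -> lebesgue X < +oo ->
  lebesgue (steiner_dir X e) = lebesgue X.
Proof.
move=> mX Xoo; have [B [mB XB BX TBX]] := steiner_borel_hull mX Xoo.
rewrite -(lebesgue_setD_null XB BX) -(lebesgue_setD_null (le_steiner_dir XB) TBX).
exact: lebesgue_steiner_borel.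
Qed.

Lemma steiner_dir_contract X Y : lebesgue_measurable X -> lebesgue X < +oo ->
  lebesgue_measurable Y -> lebesgue Y < +oo ->
  lebesgue (steiner_dir X e `\` steiner_dir Y e) <= lebesgue (X `\` Y).
Proof.
move=> mX Xoo mY Yoo.
have [B [mB XB BX TBX]] := steiner_borel_hull mX Xoo.
have [C [mC YC CY TCY]] := steiner_borel_hull mY Yoo.
pose T Z := steiner_dir Z e.
apply: (@le_trans _ _ (lebesgue ((T B `\` T C) `|` (T C `\` T Y)))).
  apply: le_lebesgue => x [xX xY]; have [xC|xC] := pselect (T C x); first by right.
  by left; split => //; exact: le_steiner_dir xX.
apply: le_trans (lebesgueU _ _) _.
rewrite [X in _ + X]TCY adde0; apply: le_trans (steiner_contract_borel mB mC) _.
apply: (@le_trans _ _ (lebesgue ((X `\` Y) `|` (B `\` X)))).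
  apply: le_lebesgue => x [xB xC]; have [xX|xX] := pselect (X x); last by right.
  by left; split => // /YC.
apply: le_trans (lebesgueU _ _) _.
by rewrite [X in _ + X]BX adde0.
Qed.

Lemma dot_decomp (x : V) (t : R) : dot x e = 0%R ->
  dot (x + t *: e)%R (x + t *: e)%R = (dot x x + t ^+ 2)%R.
Proof.
move=> xe; rewrite dotDl !dotDr !dotZl !dotZr e1 (dotC e x) xe; ring.
Qed.

Lemma dot_base (y : V) : dot (y - dot y e *: e)%R e = 0%R.
Proof. by rewrite dotBl dotZl e1 mulr1 subrr. Qed.

(** The sections of a centered ball are already centered intervals. *)
Lemma steiner_dir_eball r : steiner_dir (eball r) e = eball r.
Proof.
apply/seteqP; rewrite /steiner_dir; split => y /=; set x := (y - _)%R;
  have yE : y = (x + dot y e *: e)%R by rewrite /x subrK.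
  have xe : dot x e = 0%R by exact: dot_base.
  have [r0|r0] := leP r 0%R.
    rewrite eball_nonpos// (_ : line_section _ _ _ = set0) ?outer_length0.
      by rewrite lte_fin ltNge mulr_ge0.
    by apply/seteqP; split.
  move=> h; rewrite /eball/= enorm_ltP ?ltW// yE dot_decomp//; apply: contraTT h.
  rewrite -!leNgt => h.
  apply: (@le_trans _ _ (L (centered_interval (2 * `|dot y e|)%:E))); last first.
    by rewrite outer_length_centered_interval// lee_fin mulr_ge0.
  apply: le_outer_length => t; rewrite /line_section /eball/= enorm_ltP ?ltW//.
  rewrite dot_decomp// => h2; rewrite /centered_interval/= lte_fin ltr_pM2l//.
  by rewrite -ltr_sqr ?nnegrE// !real_normK ?num_real//; lra.
move=> yr; have r0 : (0 < r)%R by exact: le_lt_trans (enorm_ge0 y) yr.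
have xe : dot x e = 0%R by exact: dot_base.
move: yr; rewrite /eball/= enorm_ltP ?ltW// yE dot_decomp// => yr.
pose rho : R := Num.sqrt (r ^+ 2 - dot x x).
have rho2 : (rho ^+ 2 = r ^+ 2 - dot x x)%R.
  by rewrite sqr_sqrtr//; have := sqr_ge0 (dot y e); lra.
have rho0 : (0 <= rho)%R by exact: sqrtr_ge0.
apply: (@lt_le_trans _ _ (2 * rho)%:E).
  rewrite lte_fin ltr_pM2l// -ltr_sqr ?nnegrE// real_normK ?num_real//.
  rewrite rho2 dotDl dotZl xe e1; lra.
rewrite -[leLHS]outer_length_centered_interval ?lee_fin ?mulr_ge0//.
apply: le_outer_length => t; rewrite /centered_interval/= lte_fin ltr_pM2l//.
rewrite -ltr_sqr ?nnegrE// real_normK ?num_real// rho2 => h.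
by rewrite /line_section/eball/= enorm_ltP ?ltW// dot_decomp//; lra.
Qed.

Definition enlarge X (delta : R) : set V :=
  [set y | exists2 x, X x & (enorm (y - x)%R < delta)%R].

(** Sliding a section along the direction by [t] costs the symmetrized section
    at most [2 |t|], which the enlargement gains by [outer_length_enlarge]. *)
Lemma enlarge_steiner_dir X delta :
  enlarge (steiner_dir X e) delta `<=` steiner_dir (enlarge X delta) e.
Proof.
move=> y' [y]; rewrite /steiner_dir/= => yX; set h := (y' - y)%R => hd.
pose t := dot h e; pose s := dot y e.
have y'E : y' = (y + h)%R by rewrite /h addrC subrK.
have s'E : dot y' e = (s + t)%R by rewrite y'E dotDl.
set A := line_section X e (y - dot y e *: e)%R in yX.
have A0 : A !=set0.
  apply/set0P/eqP => A0; move: yX; rewrite A0 outer_length0 lte_fin.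
  by rewrite ltNge mulr_ge0.
have := outer_length_enlarge (normr_ge0 t) A0 => LA.
apply: (@lt_le_trans _ _ (L A + (2 * `|t|)%:E)).
  apply: (@le_lt_trans _ _ ((2 * `|s|)%:E + (2 * `|t|)%:E)).
    by rewrite -EFinD lee_fin s'E -mulrDr ler_pM2l// ler_normD.
  by rewrite lteD2rE.
apply: le_trans LA _; apply: le_outer_length => t' /= [a Aa at'].
exists (y - s *: e + a *: e)%R; first exact: Aa.
rewrite s'E y'E.
(* The displacement splits into the part of [h] orthogonal to [e] and a motion
   along [e] that is no longer than the one of [h]. *)
have -> : (y + h - (s + t) *: e + t' *: e - (y - s *: e + a *: e) =
   (h - t *: e) + (t' - a) *: e)%R.
  apply/rowP => i; rewrite !mxE; ring.
have he : dot (h - t *: e)%R e = 0%R by exact: dot_base.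
apply: le_lt_trans hd.
rewrite enorm_leP ?enorm_ge0// dot_decomp// sqr_enorm.
have hE : h = ((h - t *: e) + t *: e)%R by rewrite subrK.
rewrite [in leRHS]hE dot_decomp// lerD2l.
by rewrite -(real_normK (num_real t)) -(real_normK (num_real (t' - a)%R)) ler_sqr ?nnegrE.
Qed.

End unit_direction.

End steiner_general_direction.
Section steiner_strict.
Context (R : realType) (d : nat).
Notation V := 'rV[R]_d.+1.
Notation L := (@completed_lebesgue_measure R).
Local Open Scope ereal_scope.
Implicit Types (X Y : set V) (e y : V).

Lemma outer_length_finD0 (A B : set R) : measurable (B : set (measurableTypeR R)) ->
  L A < +oo -> L A <= L (A `&` B) -> L (A `\` B) = 0.
Proof.
move=> mB Aoo h; have ABf : L (A `&` B) \is a fin_num.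
  rewrite ge0_fin_numE ?outer_length_ge0//; apply: le_lt_trans Aoo.
  by apply: le_outer_length; exact: subIsetl.
apply/eqP; rewrite eq_le outer_length_ge0 andbT -(leeD2lE _ _ ABf) adde0.
by rewrite -(borel_outer_length_split A mB).
Qed.

Lemma lebesgue_finD0 X Y : lebesgue_measurable Y -> lebesgue X < +oo ->
  lebesgue X <= lebesgue (X `&` Y) -> lebesgue (X `\` Y) = 0.
Proof.
move=> mY Xoo h; have XYf : lebesgue (X `&` Y) \is a fin_num.
  rewrite ge0_fin_numE ?lebesgue_ge0//; apply: le_lt_trans Xoo.
  by apply: le_lebesgue; exact: subIsetl.
apply/eqP; rewrite eq_le lebesgue_ge0 andbT -(leeD2lE _ _ XYf) adde0.
by have := mY X => /esym e; rewrite [X in X <= _](_ : _ = lebesgue X).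
Qed.

Lemma vsection_null (nu : {sigma_finite_measure set 'rV[R]_d -> \bar R}) X :
  measurable X -> measurable_fun setT (fun z => L (vsection X z)) ->
  lebesgue X = \int[nu]_z L (vsection X z) -> lebesgue X = 0 <->
  \forall z \ae nu, L (vsection X z) = 0.
Proof.
move=> mX mg ->; have := ae_eq_integral_abs nu measurableT mg.
rewrite (eq_integral (fun z => L (vsection X z))); last first.
  by move=> z _; rewrite gee0_abs.
move=> ->; split=> h; apply: filterS h => z; first exact.
by move=> zE _.
Qed.

(** A section of a ball is a centered interval because balls are fixed by the
    symmetrization, so no explicit length is needed. *)
Let vball (q : R) z : vsection (eball q) z = centered_interval (L (vsection (eball q : set V) z)).
Proof. by rewrite -vsection_steiner steiner_dir_eball// first_axis_unit. Qed.

Let vball_fin (q : R) z : L (vsection (eball q : set V) z) < +oo.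
Proof.
apply: (@le_lt_trans _ _ (L `[(- `|q|)%R, `|q|%R]%classic)).
  apply: le_outer_length => t; rewrite /vsection/= => /(eball_coord ord0).
  rewrite vcons0 in_itv/= -ler_norml => h; apply: ltW; apply: lt_le_trans h _.
  exact: ler_norm.
by rewrite outer_lengthE lebesgue_measure_itv/=; case: ifP => _; rewrite ?ltry.
Qed.

Lemma dot_vcons t (z : 'rV[R]_d) :
  dot (vcons t z) (vcons t z) = (t ^+ 2 + \sum_i z 0 i * z 0 i)%R.
Proof.
rewrite /dot big_ord_recl (_ : vcons t z 0%R ord0 = t); last exact: vcons0.
by rewrite -expr2; congr (_ + _)%R; apply: eq_bigr => i _; rewrite vconsS.
Qed.

(** Inside every ball symmetrization can only gain measure; if it never does,
    almost every section is full inside each concentric interval shorter than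
    itself, hence is that interval. *)
Lemma steiner_first_axis_eq X : measurable X -> lebesgue X < +oo ->
  (forall q : rat, lebesgue (steiner_dir X (first_axis R d) `&` eball (ratr q)) <=
                   lebesgue (X `&` eball (ratr q))) ->
  lebesgue (steiner_dir X (first_axis R d) `\` X) = 0.
Proof.
move=> mX Xoo h; have [nu nuE] := lebesgue_cavalieri R d.
set T := fun Y => steiner_dir Y (first_axis R d).
have mT Y : measurable Y -> measurable (T Y) by exact: measurable_steiner_first_axis.
have mXq (q : rat) : measurable (X `&` eball (ratr q)).
  by apply: measurableI => //; exact: measurable_eball.
have mTXq (q : rat) : measurable (T X `&` eball (ratr q)).
  by apply: measurableI; [exact: mT|exact: measurable_eball].
have Tsub (q : rat) : T (X `&` eball (ratr q)) `<=` T X `&` eball (ratr q).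
  move=> y Ty; split; first by apply: le_steiner_dir Ty; exact: subIsetl.
  rewrite -(steiner_dir_eball (first_axis_unit R d) (ratr q)).
  by apply: le_steiner_dir Ty; exact: subIsetr.
have null (q : rat) : lebesgue ((T X `&` eball (ratr q)) `\` T (X `&` eball (ratr q))) = 0.
  apply: lebesgue_finD0.
  - by apply: borel_lebesgue_measurable; exact: mT.
  - apply: le_lt_trans (lebesgue_eball_fin _ (ratr q)).
    by apply: le_lebesgue; exact: subIsetr.
  - apply: le_trans (h q) _; rewrite (setIidr (Tsub q)).
    by rewrite lebesgue_steiner_first_axis.
have nullae : \forall z \ae nu, forall k : nat,
    let q := odflt 0%R (unpickle k : option rat) in
    L (vsection ((T X `&` eball (ratr q)) `\` T (X `&` eball (ratr q))) z) = 0.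
  apply: ae_foralln => k; set q := odflt _ _.
  have mD : measurable ((T X `&` eball (ratr q)) `\` T (X `&` eball (ratr q))).
    by apply: measurableD => //; exact: mT.
  have [mg gE] := nuE _ mD.
  by apply/(vsection_null mD mg gE).
have mTD : measurable (T X `\` X) by apply: measurableD => //; exact: mT.
have [mg gE] := nuE _ mTD; apply/(vsection_null mTD mg gE).
apply: filterS nullae => z nz.
have nz' (q : rat) : L (vsection ((T X `&` eball (ratr q)) `\` T (X `&` eball (ratr q))) z) = 0.
  by have := nz (pickle q); rewrite pickleK.
set g := L (vsection X z).
have mXz : measurable (vsection X z : set (measurableTypeR R)) by exact: measurable_vsection.
pose b q := vsection (eball (ratr q) : set V) z.
have full (q : rat) : b q `<=` centered_interval g -> L (b q `\` vsection X z) = 0.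
  move=> bg; apply: outer_length_finD0 => //; first exact: vball_fin.
  have := nz' q.
  have -> : vsection ((T X `&` eball (ratr q)) `\` T (X `&` eball (ratr q))) z =
      (vsection (T X) z `&` b q) `\` vsection (T (X `&` eball (ratr q))) z by [].
  rewrite !vsection_steiner (setIidr bg) => n0.
  rewrite -[leLHS](outer_length_centered_interval (outer_length_ge0 _)) -vball.
  set c := L (vsection (X `&` eball (ratr q)) z) in n0 *.
  have -> : L (b q `&` vsection X z) = c by rewrite setIC.
  apply: (@le_trans _ _ (L ((b q `\` centered_interval c) `|` centered_interval c))).
    by apply: le_outer_length => t bt; have [|] := pselect (centered_interval c t); [right|left].
  apply: le_trans (outer_lengthU _ _) _; rewrite [X in X + _]n0 add0e.
  by rewrite outer_length_centered_interval// outer_length_ge0.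
apply: (@outer_length_null_sub _ _
  (\bigcup_k [set t | let q := odflt 0%R (unpickle k : option rat) in
     b q `<=` centered_interval g /\ (b q `\` vsection X z) t])); last first.
  apply: outer_length_bigcup_null => k; set q := odflt _ _.
  have [bg|bg] := pselect (b q `<=` centered_interval g).
    by apply: outer_length_null_sub (full q bg) => t [].
  by apply: outer_length_null_sub (outer_length0 R) => t [].
have -> : vsection (T X `\` X) z = vsection (T X) z `\` vsection X z by [].
rewrite vsection_steiner => s [sg nXs].
(* Room between [s] and the end of the interval, for a rational ball whose
   section contains [s] and is contained in the interval. *)
have [r [sr rg]] : exists r : R, (`|s| < r)%R /\ ((2 * r)%:E <= g)%E.
  move: sg; rewrite /centered_interval/= -/g; case: (g) (outer_length_ge0 (vsection X z) : 0 <= g) => [g'|//|//] _.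
    rewrite lte_fin => sg; exists (g' / 2)%R; rewrite lee_fin; lra.
  by move=> _; exists (`|s| + 1)%R; rewrite leey; split => //; lra.
have r0 : (0 < r)%R by exact: le_lt_trans sr.
have lt1 : (enorm (vcons s z) < enorm (vcons r z))%R.
  rewrite enorm_ltP ?enorm_ge0// sqr_enorm !dot_vcons ltrD2r.
  by rewrite -(real_normK (num_real s)) ltr_pXn2r ?nnegrE// ltW.
have [q] := rat_in_itvoo lt1; rewrite in_itv/= => /andP[q1 q2].
exists (pickle q); first exact: I.
rewrite /mkset pickleK /odflt /oapp; split.
  move=> t; rewrite /b /vsection/= /eball/= => tq.
  have : (enorm (vcons t z) < enorm (vcons r z))%R by exact: lt_trans tq q2.
  rewrite enorm_ltP ?enorm_ge0// sqr_enorm !dot_vcons ltrD2r.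
  rewrite -(real_normK (num_real t)) ltr_pXn2r ?nnegrE ?(ltW r0)// => tr.
  by rewrite /centered_interval/=; apply: lt_le_trans rg; rewrite lte_fin ltr_pM2l.
by split.
Qed.

(** Rotate to the first axis and pass to a Borel hull; neither changes the
    volumes in balls. *)
Lemma steiner_dir_eq X e : dot e e = 1%R -> lebesgue_measurable X -> lebesgue X < +oo ->
  (forall q : rat, lebesgue (steiner_dir X e `&` eball (ratr q)) <=
                   lebesgue (X `&` eball (ratr q))) ->
  lebesgue (steiner_dir X e `\` X) = 0.
Proof.
move=> e1 mX Xoo h.
have [B [mB XB BX TBX]] := steiner_borel_hull e1 mX Xoo.
have [Q [hQ QE]] := steiner_dir_rotate e1.
have Qball r : Q @^-1` eball r = eball r.
  by apply/seteqP; split => x; rewrite /eball/= (lii_enorm hQ).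
have Boo : lebesgue B < +oo by rewrite (lebesgue_setD_null XB BX).
have mQB : measurable (Q @^-1` B) by exact: preimage_lii_measurable.
have key : lebesgue (steiner_dir (Q @^-1` B) (first_axis R d) `\` (Q @^-1` B)) = 0.
  apply: steiner_first_axis_eq => //; first by rewrite (lebesgue_isometry _ hQ).
  move=> q; rewrite -(lebesgue_isometry _ hQ).
  rewrite [leLHS](_ : _ = lebesgue (steiner_dir B e `&` eball (ratr q))); last first.
    by rewrite QE -[in RHS]Qball.
  rewrite [leRHS](_ : _ = lebesgue (B `&` eball (ratr q))); last first.
    by rewrite -[in LHS]Qball; exact: (lebesgue_isometry (B `&` eball (ratr q)) hQ).
  apply: (@le_trans _ _ (lebesgue (steiner_dir X e `&` eball (ratr q)))).
    rewrite (@lebesgue_setD_null _ _ _ (steiner_dir X e `&` eball (ratr q)))//.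
      by apply: setSI; exact: le_steiner_dir.
    apply: lebesgue_null_sub TBX => x [[x1 x2] x3]; split => // x4.
    by apply: x3.
  by apply: le_trans (h q) _; apply: le_lebesgue; exact: setSI.
apply: (@lebesgue_null_sub _ _ _ ((steiner_dir B e `\` B) `|` (B `\` X))).
  move=> x [xT xX]; have [xB|xB] := pselect (B x); first by right.
  by left; split => //; exact: le_steiner_dir xT.
apply/eqP; rewrite eq_le lebesgue_ge0 andbT; apply: le_trans (lebesgueU _ _) _.
rewrite BX adde0 QE -(lebesgue_isometry _ hQ).
rewrite [leLHS](_ : _ = lebesgue (steiner_dir (Q @^-1` B) (first_axis R d) `\` (Q @^-1` B))).
  by rewrite key.
by congr (lebesgue _); apply/seteqP; split => x /=; rewrite (lii_K hQ).
Qed.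

End steiner_strict.

(** * The symmetric difference distance and tame sets *)

Section symmetric_difference.
Context (R : realType) (d : nat).
Notation V := 'rV[R]_d.+1.
Local Open Scope ereal_scope.
Implicit Types (X Y Z : set V).

Definition sdist X Y := lebesgue (X `+` Y).

Lemma sdist_ge0 X Y : 0 <= sdist X Y.
Proof. exact: lebesgue_ge0. Qed.

Lemma sdistC X Y : sdist X Y = sdist Y X.
Proof. by rewrite /sdist setYC. Qed.

Lemma sdistXX X : sdist X X = 0.
Proof. by rewrite /sdist setYK lebesgue0. Qed.

Lemma sdist_triangle Y X Z : sdist X Z <= sdist X Y + sdist Y Z.
Proof.
apply: le_trans (lebesgueU _ _); apply: le_lebesgue => x.
by rewrite /setY/=; have [Yx|Yx] := pselect (Y x); tauto.
Qed.

Lemma sdist_setDE X Y : lebesgue_measurable Y ->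
  sdist X Y = lebesgue (X `\` Y) + lebesgue (Y `\` X).
Proof.
move=> mY; rewrite /sdist (mY (X `+` Y)) addeC; congr (_ + _); congr (lebesgue _);
  by apply/seteqP; split => x; rewrite /setY/=; tauto.
Qed.

Lemma sdist_le_setD X Y : sdist X Y <= lebesgue (X `\` Y) + lebesgue (Y `\` X).
Proof. exact: lebesgueU. Qed.

Lemma le_lebesgue_sdist X Y : lebesgue X <= lebesgue Y + sdist X Y.
Proof.
apply: le_trans (lebesgueU _ _); apply: le_lebesgue => x Xx.
by have [Yx|Yx] := pselect (Y x); [left|right; left].
Qed.

Lemma sdistI X Y Z : sdist (X `&` Z) (Y `&` Z) <= sdist X Y.
Proof. by apply: le_lebesgue => x; rewrite /setY/=; tauto. Qed.

Lemma lebesgue_setDC X Y : lebesgue_measurable X -> lebesgue_measurable Y ->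
  lebesgue X = lebesgue Y -> lebesgue X < +oo -> lebesgue (X `\` Y) = lebesgue (Y `\` X).
Proof.
move=> mX mY XY Xoo; have If : lebesgue (X `&` Y) \is a fin_num.
  rewrite ge0_fin_numE ?lebesgue_ge0//; apply: le_lt_trans Xoo.
  by apply: le_lebesgue; exact: subIsetl.
have e1 : lebesgue (X `&` Y) + lebesgue (X `\` Y) = lebesgue X by rewrite [RHS](mY X).
have e2 : lebesgue (X `&` Y) + lebesgue (Y `\` X) = lebesgue X.
  by rewrite XY [RHS](mX Y) setIC.
by apply/eqP; rewrite eq_le -(leeD2lE _ _ If) -[X in _ && X](leeD2lE _ _ If) e1 e2 lexx.
Qed.

Lemma sdist_isometry Q X Y : linear_isometry_involution Q ->
  sdist (Q @^-1` X) (Q @^-1` Y) = sdist X Y.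
Proof. by move=> hQ; rewrite /sdist -[RHS](lebesgue_isometry _ hQ). Qed.

Lemma steiner_dir_sdist X Y e : dot e e = 1%R ->
  lebesgue_measurable X -> lebesgue X < +oo ->
  lebesgue_measurable Y -> lebesgue Y < +oo ->
  sdist (steiner_dir X e) (steiner_dir Y e) <= sdist X Y.
Proof.
move=> e1 mX Xoo mY Yoo; apply: le_trans (sdist_le_setD _ _) _.
by rewrite sdist_setDE//; apply: leeD; exact: steiner_dir_contract.
Qed.

(** The two sets having the same measure, it is enough that one difference
    be null. *)
Lemma steiner_dir_sdist_eq0 X e : dot e e = 1%R -> lebesgue_measurable X -> lebesgue X < +oo ->
  (forall q : rat, lebesgue (steiner_dir X e `&` eball (ratr q)) <=
                   lebesgue (X `&` eball (ratr q))) ->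
  sdist (steiner_dir X e) X = 0.
Proof.
move=> e1 mX Xoo h; have mT := lebesgue_measurable_steiner_dir e1 mX Xoo.
have TX := lebesgue_steiner_dir e1 mX Xoo.
by rewrite sdist_setDE// -(lebesgue_setDC mT) ?TX// steiner_dir_eq// adde0.
Qed.

End symmetric_difference.

Section tame_approximation.
Context (R : realType) (d : nat).
Notation V := 'rV[R]_d.+1.
Local Open Scope ereal_scope.
Implicit Types (X Y Z K : set V).

(** Bounded sets whose small enlargements have little extra measure; finite
    unions of boxes are such. *)
Definition tame K := [/\ lebesgue_measurable K, exists r, K `<=` eball r &
  forall eps : R, (0 < eps)%R -> exists delta K', [/\ (0 < delta)%R,
    lebesgue_measurable K', lebesgue K' < +oo, enlarge K delta `<=` K' &
    lebesgue (K' `\` K) <= eps%:E]].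

Lemma tame0 : tame set0.
Proof.
split; first by apply: lebesgue_null_measurable; rewrite lebesgue0.
  by exists 0%R.
move=> eps e0; exists 1%R, set0; split => //.
- by apply: lebesgue_null_measurable; rewrite lebesgue0.
- by rewrite lebesgue0 ltry.
- by move=> x [].
- by rewrite set0D lebesgue0 lee_fin ltW.
Qed.

Lemma lebesgue_measurableU X Y :
  lebesgue_measurable X -> lebesgue_measurable Y -> lebesgue_measurable (X `|` Y).
Proof. exact: (caratheodory_measurable_setU (mu := @lebesgue R d)). Qed.

Lemma tameU K L : tame K -> tame L -> tame (K `|` L).
Proof.
move=> [mK [r Kr] hK] [mL [s Ls] hL]; split; first exact: lebesgue_measurableU.
  exists (Num.max r s) => x [/Kr|/Ls]; apply: eball_sub; by rewrite le_max lexx ?orbT.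
move=> eps e0; have e20 : (0 < eps / 2)%R by rewrite divr_gt0.
have [dK [K' [dK0 mK' K'oo KK' K'e]]] := hK _ e20.
have [dL [L' [dL0 mL' L'oo LL' L'e]]] := hL _ e20.
exists (Num.min dK dL), (K' `|` L'); split.
- by rewrite lt_min dK0.
- exact: lebesgue_measurableU.
- by apply: le_lt_trans (lebesgueU _ _) _; exact: lte_add_pinfty.
- move=> y [x [Kx|Lx]]; rewrite lt_min => /andP[h1 h2].
    by left; apply: KK'; exists x.
  by right; apply: LL'; exists x.
- rewrite (splitr eps) EFinD; apply: le_trans (leeD K'e L'e).
  apply: le_trans (lebesgueU _ _); apply: le_lebesgue => x [[xK|xL] xn].
    by left; split => // h; apply: xn; left.
  by right; split => // h; apply: xn; right.
Qed.

Lemma tame_box (a b : V) : (forall i, (a 0 i <= b 0 i)%R) -> tame (box a b).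
Proof.
move=> ab; have mB (u v : V) : lebesgue_measurable (box u v).
  by apply: borel_lebesgue_measurable; exact: measurable_box.
split => //.
  pose M : R := (\sum_i (`|a 0 i| + `|b 0 i|))%R.
  have M0 : (0 <= M)%R by apply: sumr_ge0 => i _; rewrite addr_ge0.
  exists (d.+1%:R * M + 1)%R => x xb; rewrite /eball/=.
  apply: (@le_lt_trans _ _ (d.+1%:R * M)%R); last by rewrite ltrDl.
  apply: enorm_le_bound => // i; apply: (@le_trans _ _ (`|a 0 i| + `|b 0 i|)%R).
    have /andP[h1 h2] := xb i; rewrite ler_norml.
    have := ler_norm (b 0 i)%R; have := ler_norm (- a 0 i)%R; rewrite normrN.
    have := normr_ge0 (a 0 i)%R; have := normr_ge0 (b 0 i)%R; lra.
  by rewrite /M (bigD1 i)//= lerDl; apply: sumr_ge0 => j _; rewrite addr_ge0.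
move=> eps e0; pose c (eta : R) : V := const_mx eta.
(* The volume of the box enlarged by [eta] is a polynomial in [eta]. *)
pose p : {poly R} := (\prod_(i < d.+1) ((b 0 i - a 0 i)%:P + 2%:P * 'X))%R.
have pE eta : p.[eta]%R = box_volume (a - c eta)%R (b + c eta)%R.
  rewrite /p horner_prod /box_volume; apply: eq_bigr => i _.
  by rewrite !hornerE !mxE; ring.
have p0 : p.[0]%R = box_volume a b.
  rewrite pE; congr box_volume; apply/rowP => i; rewrite !mxE ?subr0 ?addr0//.
have /cvgrPdist_lt /(_ eps e0) : (horner p x @[x --> 0%R] --> horner p 0%R)%R.
  exact: continuous_horner.
case/nbhs_ballP => eta /= eta0 hball.
pose del := (eta / 2)%R; have del0 : (0 < del)%R by rewrite divr_gt0.
have ab' i : ((a - c del) 0 i <= (b + c del) 0 i)%R.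
  by rewrite !mxE; have := ab i; lra.
have subB : box a b `<=` box (a - c del)%R (b + c del)%R.
  by move=> x xb i; have := xb i; rewrite !mxE => /andP[h1 h2]; apply/andP; lra.
exists del, (box (a - c del)%R (b + c del)%R); split => //.
- by rewrite lebesgue_boxE// ltry.
- move=> y [x xb yx] i; have := xb i; have := le_lt_trans (coord_le_enorm (y - x)%R i) yx.
  by rewrite !mxE ltr_norml => /andP[h1 h2] /andP[h3 h4]; apply/andP; lra.
- have h : (`|box_volume a b - box_volume (a - c del)%R (b + c del)%R| < eps)%R.
    rewrite -p0 -pE; apply: hball.
    by rewrite /ball/= sub0r normrN gtr0_norm// /del; lra.
  have e : lebesgue (box (a - c del)%R (b + c del)%R) =
      lebesgue (box a b) + lebesgue (box (a - c del)%R (b + c del)%R `\` box a b).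
    by rewrite [LHS](mB a b) (setIidr subB).
  have bf : lebesgue (box a b) \is a fin_num by rewrite lebesgue_boxE.
  rewrite -(leeD2lE _ _ bf) -e !lebesgue_boxE// -EFinD lee_fin.
  by move: h; rewrite ltr_distlC => /andP[_ /ltW].
Qed.

Lemma tame_bigsetU (F : (set V)^nat) N : (forall k, tame (F k)) ->
  tame (\big[setU/set0]_(k < N) F k).
Proof. by move=> h; elim/big_ind : _ => //; [exact: tame0|exact: tameU]. Qed.

(** Cover [X] efficiently by boxes and keep finitely many of them. *)
Lemma tame_approx X (eps : R) : lebesgue_measurable X -> lebesgue X < +oo ->
  (0 < eps)%R -> exists K, tame K /\ sdist X K <= eps%:E.
Proof.
move=> mX Xoo e0; have e20 : (0 < eps / 2)%R by rewrite divr_gt0.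
have [a [b [[ab Xab] Sle]]] := lebesgue_cover_adherent Xoo e20.
pose F k := box (a k) (b k); pose U := \bigcup_k F k.
have Xf : lebesgue X \is a fin_num by rewrite ge0_fin_numE// lebesgue_ge0.
have Ule : lebesgue U <= lebesgue X + (eps / 2)%:E.
  by apply: le_trans Sle; apply: lebesgue_le_cover; split.
have UX : lebesgue (U `\` X) <= (eps / 2)%:E.
  rewrite -(leeD2lE _ _ Xf); apply: le_trans Ule.
  by rewrite [leRHS](mX U) (setIidr Xab).
have Soo : \sum_(0 <= k <oo) (box_volume (a k) (b k))%:E < +oo.
  by apply: le_lt_trans Sle _; rewrite lte_add_pinfty// ltry.
have v0 k : 0 <= (box_volume (a k) (b k))%:E by rewrite lee_fin box_volume_ge0.
have tail := nneseries_tail_cvg Soo (fun k _ => v0 k).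
have [N UN] : exists N, \sum_(N <= k <oo) (box_volume (a k) (b k))%:E <= (eps / 2)%:E.
  have e2 : 0 < (eps / 2)%:E by rewrite lte_fin.
  have nb : nbhs (0 : \bar R) [set y | y < (eps / 2)%:E].
    by apply: open_nbhs_nbhs; split => //; exact: open_ereal_lt_ereal.
  have [N _ /(_ N (leqnn N)) h] := tail _ nb.
  by exists N; exact: ltW.
exists (\big[setU/set0]_(k < N) F k); split.
  by apply: tame_bigsetU => k; exact: tame_box.
have FU : \big[setU/set0]_(k < N) F k `<=` U.
  by rewrite -bigcup_mkord => x [k _ Fx]; exists k.
have UUN : lebesgue (U `\` \big[setU/set0]_(k < N) F k) <= (eps / 2)%:E.
  apply: le_trans UN; apply: (@le_trans _ _ (lebesgue (\bigcup_(n in ~` `I_N) F n))).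
    apply: le_lebesgue => x [[k _ Fx] nx]; exists k => //= kN; apply: nx.
    by rewrite -bigcup_mkord; exists k.
  apply: le_trans (outer_measure_sigma_subadditive_tail (@lebesgue R d) N F) _.
  by apply: lee_nneseries => // k _; exact: lebesgue_box_le.
rewrite (splitr eps) EFinD addeC; apply: le_trans (leeD UUN UX).
apply: le_trans (lebesgueU _ _); apply: le_lebesgue => x [[Xx nx]|[Fx nx]].
  by left; split => //; exact: Xab.
by right; split => //; exact: FU.
Qed.

End tame_approximation.

(** * Continuity in the direction *)

Section steiner_continuity.
Context (R : realType) (d : nat).
Notation V := 'rV[R]_d.+1.
Local Open Scope ereal_scope.
Implicit Types (X Y Z K : set V) (e w : V).

(** Measure-preserving maps close to the identity move measurable sets little:
    it suffices to see this on tame sets. *)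
Lemma near_identity_sdist X (eps : R) : lebesgue_measurable X -> lebesgue X < +oo ->
  (0 < eps)%R -> exists2 eta : R, (0 < eta)%R & forall Q1 Q2 : V -> V,
  linear_isometry_involution Q1 -> linear_isometry_involution Q2 ->
  (forall x, enorm (Q1 (Q2 x) - x)%R <= eta * enorm x)%R ->
  sdist (Q2 @^-1` (Q1 @^-1` X)) X <= eps%:E.
Proof.
move=> mX Xoo e0; have e40 : (0 < eps / 4)%R by rewrite divr_gt0.
have [K [[mK [r Kr] hK] XK]] := tame_approx mX Xoo e40.
have [delta [K' [del0 mK' K'oo KK' K'e]]] := hK _ e40.
pose M : R := (`|r| + 1)%R; have M0 : (0 < M)%R by rewrite /M ltr_wpDl.
exists (delta / M)%R; first by rewrite divr_gt0.
move=> Q1 Q2 h1 h2 near; pose QK := Q2 @^-1` (Q1 @^-1` K).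
have QX : sdist (Q2 @^-1` (Q1 @^-1` X)) QK = sdist X K.
  by rewrite (sdist_isometry _ _ h2) (sdist_isometry _ _ h1).
have mQK : lebesgue_measurable QK.
  by apply: (lebesgue_measurable_isometry h2); exact: (lebesgue_measurable_isometry h1).
have QKE : lebesgue QK = lebesgue K by rewrite (lebesgue_isometry _ h2) (lebesgue_isometry _ h1).
have Koo : lebesgue K < +oo.
  by apply: le_lt_trans (lebesgue_eball_fin _ r); exact: le_lebesgue.
have QKK : lebesgue (QK `\` K) <= (eps / 4)%:E.
  apply: le_trans K'e; apply: le_lebesgue => x [xQ nx]; split => //.
  apply: KK'; exists (Q1 (Q2 x)); first exact: xQ.
  rewrite -enormN opprB; apply: le_lt_trans (near x) _.
  have : (enorm x < M)%R.
    have := Kr _ xQ; rewrite /eball/= (lii_enorm h1) (lii_enorm h2) => h.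
    by rewrite /M; have := ler_norm r; lra.
  move=> xM; rewrite -mulrA gtr_pMr// mulrC ltr_pdivrMr// mul1r//.
have KQK : lebesgue (K `\` QK) <= (eps / 4)%:E.
  by rewrite -(lebesgue_setDC mQK mK)// QKE.
apply: le_trans (sdist_triangle QK _ _) _.
have -> : eps%:E = (eps / 4)%:E + ((eps / 4)%:E + (eps / 4)%:E + (eps / 4)%:E).
  by rewrite -!EFinD; congr (_%:E); field.
apply: leeD; first by rewrite QX.
apply: le_trans (sdist_triangle K _ _) _; apply: leeD; last by rewrite sdistC.
by apply: le_trans (sdist_le_setD _ _) _; exact: leeD.
Qed.

Lemma reflection_diff e w y : dot e e = 1%R -> dot w w = 1%R ->
  (enorm (reflection w y - reflection e y) <= 4 * enorm (w - e) * enorm y)%R.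
Proof.
move=> e1 w1.
have ne : enorm e = 1%R by rewrite /enorm e1 sqrtr1.
have nw : enorm w = 1%R by rewrite /enorm w1 sqrtr1.
have -> : (reflection w y - reflection e y =
    (2 * dot y e) *: (e - w) + (2 * dot y (e - w)) *: w)%R.
  apply/rowP => i; rewrite /reflection dotBr !mxE; ring.
apply: le_trans (enormD _ _) _; rewrite !enormZ nw mulr1 !normrM normr_nat.
have a1 := CauchySchwarz y e; have a2 := CauchySchwarz y (e - w)%R.
have -> : enorm (w - e)%R = enorm (e - w)%R by rewrite -enormN opprB.
rewrite ne mulr1 in a1.
have a3 : (`|dot y e| * enorm (e - w) <= enorm y * enorm (e - w))%R.
  by apply: ler_wpM2r => //; exact: enorm_ge0.
rewrite -mulrA; lra.
Qed.

(** The normal [w] of the reflection exchanging [- e] and [e'] tends to [e] as [e']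
    does, whereas the normal for [e] and [e'] has no limit. *)
Lemma bisector_near e e' : dot e e = 1%R -> dot e' e' = 1%R ->
  (enorm (e' - e) < 1)%R ->
  exists w, [/\ dot w w = 1%R, reflection w (- e)%R = e' &
    (enorm (w - e) <= enorm (e' - e))%R].
Proof.
move=> e1 e'1 near; pose f := (e + e')%R.
have ne : enorm e = 1%R by rewrite /enorm e1 sqrtr1.
have fE : f = (2 *: e + (e' - e))%R by apply/rowP => i; rewrite !mxE; ring.
have f1 : (enorm f <= 2 + enorm (e' - e))%R.
  rewrite fE; apply: le_trans (enormD _ _) _; by rewrite enormZ normr_nat ne mulr1.
have f2 : (2 - enorm (e' - e) <= enorm f)%R.
  have : (enorm (2 *: e) <= enorm f + enorm (e' - e))%R.
    by rewrite (_ : 2 *: e = f - (e' - e))%R ?enormB// fE addrK.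
  by rewrite enormZ normr_nat ne mulr1; lra.
have f0 : (0 < enorm f)%R by lra.
have f0' : enorm f != 0%R by rewrite gt_eqF.
have ff : (enorm f ^+ 2 = 2 * (1 + dot e e'))%R.
  by rewrite sqr_enorm /f dotDl !dotDr e1 e'1 (dotC e' e); ring.
exists ((enorm f)^-1 *: f)%R; split.
- by rewrite dotZl dotZr -sqr_enorm; field.
- rewrite /reflection dotNl dotZr scalerA.
  have -> : dot e f = (enorm f ^+ 2 / 2)%R by rewrite ff /f dotDr e1; field.
  have -> : (2 * - ((enorm f)^-1 * (enorm f ^+ 2 / 2)) * (enorm f)^-1 = -1)%R by field.
  by rewrite scaleN1r opprK /f addrA addNr add0r.
- have -> : ((enorm f)^-1 *: f - e = (1 - enorm f / 2) *: ((enorm f)^-1 *: f) + 2^-1 *: (e' - e))%R.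
    move: (enorm f) f0' => c c0; apply/rowP => i; rewrite /f !mxE; field.
    exact: c0.
  apply: le_trans (enormD _ _) _; rewrite !enormZ.
  rewrite [X in (_ * (X * _) + _)%R]ger0_norm ?invr_ge0 ?enorm_ge0// mulVf// mulr1.
  rewrite (ger0_norm (x := 2^-1%R))//.
  have : (`|1 - enorm f / 2| <= enorm (e' - e) / 2)%R by rewrite ler_norml; lra.
  by lra.
Qed.

(** Composing the reflections with normals [e] and [w] near [e] gives an isometry
    near the identity that maps one direction to the other. Symmetrizing along
    [e'] is symmetrizing along [e] conjugated by it, and conjugation moves
    measurable sets little. *)
Lemma steiner_dir_continuous X e (eps : R) : dot e e = 1%R ->
  lebesgue_measurable X -> lebesgue X < +oo -> (0 < eps)%R ->
  exists2 eta : R, (0 < eta)%R & forall e', dot e' e' = 1%R ->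
    (enorm (e' - e) < eta)%R ->
    sdist (steiner_dir X e') (steiner_dir X e) <= eps%:E.
Proof.
move=> e1 mX Xoo e0; have e20 : (0 < eps / 2)%R by rewrite divr_gt0.
have mT := lebesgue_measurable_steiner_dir e1 mX Xoo.
have Too : lebesgue (steiner_dir X e) < +oo by rewrite lebesgue_steiner_dir.
have [eta1 eta10 h1] := near_identity_sdist mX Xoo e20.
have [eta2 eta20 h2] := near_identity_sdist mT Too e20.
exists (Num.min 1 (Num.min (eta1 / 4) (eta2 / 4)))%R.
  by rewrite !lt_min ltr01 !divr_gt0.
move=> e' e'1; rewrite !lt_min => /and3P[n1 n2 n3].
have [w [w1 we ne]] := bisector_near e1 e'1 n1.
have hw := reflection_lii w1; have he := reflection_lii e1.
have ee : reflection e e = (- e)%R.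
  by rewrite /reflection e1 mulr1 scaler_nat mulr2n opprD addrA subrr add0r.
have bound (eta : R) (u v : V) : dot u u = 1%R -> dot v v = 1%R ->
    (enorm (u - v) < eta / 4)%R -> forall x,
    (enorm (reflection u (reflection v x) - x) <= eta * enorm x)%R.
  move=> u1 v1 uv x; rewrite -{2}(lii_K (reflection_lii v1) x).
  apply: le_trans (reflection_diff _ v1 u1) _; rewrite (lii_enorm (reflection_lii v1)).
  by apply: ler_wpM2r; [exact: enorm_ge0|lra].
pose Qw := reflection w; pose Qe := reflection e.
have TE : steiner_dir X e' = Qw @^-1` (Qe @^-1` (steiner_dir (Qe @^-1` (Qw @^-1` X)) e)).
  rewrite -(steiner_dir_isometry _ _ he) ee -(steiner_dir_isometry _ _ hw) we.
  congr (steiner_dir _ _); apply/funext => x /=.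
  by rewrite /Qw /Qe (lii_K he) (lii_K hw).
rewrite TE; apply: le_trans (sdist_triangle (Qw @^-1` (Qe @^-1` steiner_dir X e)) _ _) _.
rewrite (splitr eps) EFinD; apply: leeD.
  rewrite (sdist_isometry _ _ hw) (sdist_isometry _ _ he).
  apply: le_trans (h1 _ _ hw he _).
    apply: steiner_dir_sdist => //.
      by apply: (lebesgue_measurable_isometry he); exact: (lebesgue_measurable_isometry hw).
    by rewrite (lebesgue_isometry _ he) (lebesgue_isometry _ hw).
  by apply: bound => //; lra.
apply: h2 => //; apply: bound => //.
by rewrite -enormN opprB; lra.
Qed.

End steiner_continuity.

(** * A countable base of the projective space *)

Section projective_space.
Context (R : realType) (d : nat).
Notation V := 'rV[R]_d.+1.
Notation S := (proj_space R d).
Implicit Types (u : S) (v e : V) (B : set V).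

Lemma proj_space_openE (A : set S) : open A = proj_space_open A.
Proof. by []. Qed.

Lemma line_ofE v : v != 0 -> line (line_of v) = <[v]>%VS.
Proof.
move=> v0; rewrite /line_of /insubd insubT/=; first by rewrite dim_vline v0.
by [].
Qed.

Lemma vpick_neq0 u : vpick (line u) != 0.
Proof. by rewrite vpick0 -dimv_eq0 (eqP (line_dim u)). Qed.

Lemma unit_vector_unit u : dot (unit_vector u) (unit_vector u) = 1.
Proof.
have n0 : enorm (vpick (line u)) != 0 by rewrite enorm_eq0 vpick_neq0.
by rewrite /unit_vector dotZl dotZr -sqr_enorm; field.
Qed.

Lemma unit_neq0 e : dot e e = 1 -> e != 0.
Proof. by move=> e1; rewrite -dot_eq0 e1 oner_eq0. Qed.

Lemma unit_vector_mem u : unit_vector u \in line u.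
Proof. by rewrite memvZ// memv_pick. Qed.

Lemma line_of_mem v u : v != 0 -> v \in line u -> line_of v = u.
Proof.
move=> v0 vu; apply: val_inj; rewrite /= line_ofE//; apply/eqP.
by rewrite eqEdim -memvE vu dim_vline v0 (eqP (line_dim u)).
Qed.

Lemma line_of_unit_vector u : line_of (unit_vector u) = u.
Proof.
apply: line_of_mem; [exact/unit_neq0/unit_vector_unit|exact: unit_vector_mem].
Qed.

Lemma line_ofZ (c : R) v : c != 0 -> v != 0 -> line_of (c *: v) = line_of v.
Proof.
move=> c0 v0; apply: line_of_mem; first by rewrite scaler_eq0 negb_or c0.
by rewrite line_ofE// memvZ// memv_line.
Qed.

Lemma line_of_eq v v' : v != 0 -> v' != 0 -> line_of v = line_of v' ->
  exists2 c : R, c != 0 & v' = c *: v.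
Proof.
move=> v0 v'0 /(congr1 (@line R d)); rewrite !line_ofE// => h.
have /vlineP[c cE] : v' \in <[v]>%VS by rewrite h memv_line.
by exists c => //; apply: contraNneq v'0 => c0; rewrite cE c0 scale0r.
Qed.

Lemma steiner_line_of X v : v != 0 ->
  steiner X (line_of v) = steiner_dir X ((enorm v)^-1 *: v).
Proof.
move=> v0; rewrite steinerE; set e := unit_vector _.
have e1 : dot e e = 1 by exact: unit_vector_unit.
have [c c0 eE] := line_of_eq v0 (unit_neq0 e1) (esym (line_of_unit_vector (line_of v))).
have n0 : enorm v != 0 by rewrite enorm_eq0.
have : `|c| * enorm v = 1 by rewrite -enormZ -eE /enorm e1 sqrtr1.
move=> /(canRL (mulfK n0)); rewrite mul1r => cE.
have [cpos|cneg] := ltP 0 c.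
  by rewrite -cE gtr0_norm// -eE.
by rewrite -cE ler0_norm// scaleNr -eE steiner_dirN.
Qed.

Definition cone B : set S := [set u | exists v, [/\ v != 0, B v & line_of v = u]].

Lemma open_cone B : open B -> open (cone B).
Proof.
move=> oB; rewrite proj_space_openE /proj_space_open.
have -> : [set v | v != 0 /\ cone B (line_of v)] =
    ~` [set 0] `&` \bigcup_(c in [set c : R | c != 0]) ((fun v => c *: v) @^-1` B).
  apply/seteqP; split => v /=.
    move=> [v0 [v' [v'0 Bv' vv']]]; split; first exact/eqP.
    have [c c0 v'E] := line_of_eq v0 v'0 (esym vv').
    by exists c => //=; rewrite -v'E.
  move=> [/eqP v0 [c /= c0 Bcv]]; split => //; exists (c *: v); split => //.
    by rewrite scaler_eq0 negb_or c0.
  exact: line_ofZ.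
apply: openI.
  apply: closed_openC; apply: accessible_closed_set1.
  exact/hausdorff_accessible/norm_hausdorff.
apply: bigcup_open => c _; apply: open_comp => // v _.
exact: scaler_continuous.
Qed.

Lemma cone_nbhs (O : set S) u : open O -> O u ->
  exists2 r : R, 0 < r & cone (ball (unit_vector u) r) `<=` O.
Proof.
rewrite proj_space_openE /proj_space_open => oO Ou.
have uO : [set v | v != 0 /\ O (line_of v)] (unit_vector u).
  by split; [exact/unit_neq0/unit_vector_unit|rewrite line_of_unit_vector].
have /nbhs_ballP[r /= r0 h] := open_nbhs_nbhs (conj oO uO).
by exists r => // u' [v [v0 /h[_ Ov] <-]].
Qed.

(** A countable base: the cones over balls with rational centres. *)
Definition base (k : nat) : set S :=
  if unpickle k is Some (q, m) then
    cone (ball (map_mx ratr (q : 'rV[rat]_d.+1) : V) (m.+1%:R^-1))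
  else set0.

Lemma open_base k : open (base k).
Proof.
rewrite /base; case: unpickle => [[q m]|]; last exact: open0.
by apply: open_cone; exact: ball_open.
Qed.

Lemma base_nbhs (O : set S) u : open O -> O u -> exists k, base k u /\ base k `<=` O.
Proof.
move=> oO Ou; have [r r0 h] := cone_nbhs oO Ou; set e := unit_vector u in h.
have [m mr] : exists m : nat, m.+1%:R^-1 < r / 2.
  have r20 : 0 < r / 2 by rewrite divr_gt0.
  have [m _ /(_ m (leqnn m)) mh] := near_infty_natSinv_lt (PosNum r20).
  by exists m.
have m0 : 0 < m.+1%:R^-1 :> R by rewrite invr_gt0.
have /choice[q qP] : forall i : 'I_d.+1, exists q : rat, `|ratr q - e 0 i| < m.+1%:R^-1.
  move=> i; have lt : e 0 i - m.+1%:R^-1 < e 0 i + m.+1%:R^-1.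
    by rewrite ltrBlDr -addrA ltrDl addr_gt0.
  have [q] := rat_in_itvoo lt; rewrite in_itv/= => qq; exists q.
  by rewrite ltr_distl.
pose qv : 'rV[rat]_d.+1 := \row_i q i.
have eq_ball : ball (map_mx ratr qv : V) (m.+1%:R^-1) e.
  split => // i j; rewrite ord1 (_ : map_mx _ _ _ _ = ratr (q j)); last by rewrite !mxE.
  exact: (qP j).
exists (pickle (qv, m)); rewrite /base pickleK; split.
  exists e; split => //; first exact/unit_neq0/unit_vector_unit.
  exact: line_of_unit_vector.
move=> u' [v [v0 qv' <-]]; apply: h; exists v; split => //.
apply: (@le_ball _ _ _ (m.+1%:R^-1 + m.+1%:R^-1)).
  by rewrite (splitr r) lerD// ltW.
by apply: ball_triangle qv'; exact: ball_sym.
Qed.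

(** The continuity for unit vectors, expressed with the countable base. *)
Lemma steiner_continuous (X : set V) u (eps : R) :
  lebesgue_measurable X -> (lebesgue X < +oo)%E -> 0 < eps ->
  exists k, base k u /\
    forall u', base k u' -> (sdist (steiner X u') (steiner X u) <= eps%:E)%E.
Proof.
move=> mX Xoo e0; set e := unit_vector u.
have e1 : dot e e = 1 by exact: unit_vector_unit.
have [eta eta0 h] := steiner_dir_continuous e1 mX Xoo e0.
pose r : R := eta / 4 / d.+1%:R.
have r0 : 0 < r by rewrite !divr_gt0.
have Ou : cone (ball e r) u.
  exists e; split; [exact: unit_neq0|exact: ballxx|exact: line_of_unit_vector].
have [k [ku kO]] := base_nbhs (open_cone (ball_open e r)) Ou.
exists k; split => // u' /kO[v [v0 ev <-]]; rewrite steiner_line_of// [steiner X u]steinerE.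
have n0 : enorm v != 0 by rewrite enorm_eq0.
have ne : enorm e = 1 by rewrite /enorm e1 sqrtr1.
apply: h; first by rewrite dotZl dotZr -sqr_enorm; field.
have ve : enorm (v - e) <= d.+1%:R * r.
  apply: enorm_le_bound => [|i]; first exact: ltW.
  have := ev.2 0 i; rewrite /ball/= distrC => h'.
  by rewrite [(v - e) _ _]mxE [(- e) _ _]mxE ltW.
have r1 : d.+1%:R * r = eta / 4 by rewrite mulrC divfK.
have v1 : enorm v <= 1 + enorm (v - e) by rewrite -ne -{1}(subrK e v) addrC enormD.
have v2 : 1 <= enorm v + enorm (v - e).
  have := enormB v (v - e); rewrite (_ : v - (v - e) = e) ?ne//.
  by rewrite opprB addrC subrK.
have -> : (enorm v)^-1 *: v - e = ((enorm v)^-1 - 1) *: v + (v - e).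
  by rewrite scalerBl scale1r addrA subrK.
apply: le_lt_trans (enormD _ _) _; rewrite enormZ.
have vpos : 0 < enorm v by rewrite lt_neqAle eq_sym n0 enorm_ge0.
have -> : `|(enorm v)^-1 - 1| * enorm v = `|1 - enorm v|.
  rewrite -[X in _ * X](gtr0_norm vpos) -normrM mulrBl mul1r mulVf//.
have : `|1 - enorm v| <= enorm (v - e) by rewrite ler_norml; lra.
by rewrite r1 in ve; lra.
Qed.

End projective_space.

(** * Iterated symmetrizations *)

Section steiner_orbits.
Context (R : realType) (d : nat).
Notation V := 'rV[R]_d.+1.
Notation S := (proj_space R d).
Local Open Scope ereal_scope.
Implicit Types (X Y Z K : set V) (u : S) (w us : seq S).

Definition finite_measurable X := lebesgue_measurable X /\ lebesgue X < +oo.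

Lemma finite_measurable_fin X : finite_measurable X -> lebesgue X \is a fin_num.
Proof. by move=> [_ Xoo]; rewrite ge0_fin_numE// lebesgue_ge0. Qed.

Lemma lebesgue_steiner X u : finite_measurable X -> lebesgue (steiner X u) = lebesgue X.
Proof. by move=> [mX Xoo]; apply: lebesgue_steiner_dir => //; exact: unit_vector_unit. Qed.

Lemma finite_measurable_steiner X u : finite_measurable X -> finite_measurable (steiner X u).
Proof.
move=> fX; split; last by rewrite lebesgue_steiner//; case: fX.
by case: fX => mX Xoo; apply: lebesgue_measurable_steiner_dir => //; exact: unit_vector_unit.
Qed.

Lemma finite_measurable_seq X us : finite_measurable X -> finite_measurable (steiner_seq X us).
Proof. by elim: us X => //= u us IH X fX; apply: IH; exact: finite_measurable_steiner. Qed.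

Lemma lebesgue_steiner_seq X us : finite_measurable X ->
  lebesgue (steiner_seq X us) = lebesgue X.
Proof.
elim: us X => //= u us IH X fX; rewrite [LHS]IH ?lebesgue_steiner//.
exact: finite_measurable_steiner.
Qed.

Lemma steiner_sdist X Y u : finite_measurable X -> finite_measurable Y ->
  sdist (steiner X u) (steiner Y u) <= sdist X Y.
Proof.
move=> [mX Xoo] [mY Yoo]; apply: steiner_dir_sdist => //; exact: unit_vector_unit.
Qed.

Lemma steiner_seq_sdist X Y us : finite_measurable X -> finite_measurable Y ->
  sdist (steiner_seq X us) (steiner_seq Y us) <= sdist X Y.
Proof.
elim: us X Y => //= u us IH X Y fX fY; apply: le_trans (IH _ _ _ _) _;
  by [exact: finite_measurable_steiner|exact: steiner_sdist].
Qed.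

Lemma steiner_setD X Y u : finite_measurable X -> finite_measurable Y ->
  lebesgue (steiner X u `\` steiner Y u) <= lebesgue (X `\` Y).
Proof.
move=> [mX Xoo] [mY Yoo]; apply: steiner_dir_contract => //; exact: unit_vector_unit.
Qed.

Lemma steiner_seq_setD X Y us : finite_measurable X -> finite_measurable Y ->
  lebesgue (steiner_seq X us `\` steiner_seq Y us) <= lebesgue (X `\` Y).
Proof.
elim: us X Y => //= u us IH X Y fX fY; apply: le_trans (IH _ _ _ _) _;
  by [exact: finite_measurable_steiner|exact: steiner_setD].
Qed.

Lemma le_steiner X Y u : X `<=` Y -> steiner X u `<=` steiner Y u.
Proof. exact: le_steiner_dir. Qed.

Lemma le_steiner_seq X Y us : X `<=` Y -> steiner_seq X us `<=` steiner_seq Y us.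
Proof. by elim: us X Y => //= u us IH X Y XY; apply: IH; exact: le_steiner. Qed.

Lemma steiner_eball r u : steiner (eball r) u = eball r.
Proof. by apply: steiner_dir_eball; exact: unit_vector_unit. Qed.

Lemma steiner_seq_eball r us : steiner_seq (eball r) us = eball r.
Proof. by elim: us => //= u us; rewrite /steiner_seq/= steiner_eball. Qed.

Lemma enlarge_steiner_seq X delta us :
  enlarge (steiner_seq X us) delta `<=` steiner_seq (enlarge X delta) us.
Proof.
elim: us X => [|u us IH] X x; first by [].
move=> /IH; apply: le_steiner_seq.
exact: (enlarge_steiner_dir (unit_vector_unit u)).
Qed.

Lemma steiner_seq_cat X us vs : steiner_seq X (us ++ vs) = steiner_seq (steiner_seq X us) vs.
Proof. by rewrite /steiner_seq foldl_cat. Qed.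

(** Balls are fixed and symmetrization is monotone. *)
Lemma lebesgue_ball_steiner X u r : finite_measurable X ->
  lebesgue (X `&` eball r) <= lebesgue (steiner X u `&` eball r).
Proof.
move=> [mX Xoo]; have fXr : finite_measurable (X `&` eball r).
  split; last by apply: le_lt_trans Xoo; apply: le_lebesgue; exact: subIsetl.
  by apply: lebesgue_measurableI => //; apply: borel_lebesgue_measurable; exact: measurable_eball.
rewrite -(lebesgue_steiner u fXr); apply: le_lebesgue => x Tx; split.
  by apply: le_steiner Tx; exact: subIsetl.
by rewrite -(steiner_eball r u); apply: le_steiner Tx; exact: subIsetr.
Qed.

Lemma lebesgue_ball_steiner_seq X us r : finite_measurable X ->
  lebesgue (X `&` eball r) <= lebesgue (steiner_seq X us `&` eball r).
Proof.
elim: us X => //= u us IH X fX; apply: le_trans (lebesgue_ball_steiner u r fX) _.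
by apply: IH; exact: finite_measurable_steiner.
Qed.

Lemma steiner_sdist_eq0 X u : finite_measurable X ->
  (forall q : rat, lebesgue (steiner X u `&` eball (ratr q)) <=
                   lebesgue (X `&` eball (ratr q))) ->
  sdist (steiner X u) X = 0.
Proof. by move=> [mX Xoo]; apply: steiner_dir_sdist_eq0 => //; exact: unit_vector_unit. Qed.

Section rearrangement.

(** The open ball of radius [0] serves the null sets. *)
Lemma exists_eball X : lebesgue X < +oo ->
  exists r : R, (0 <= r)%R /\ lebesgue (eball r : set V) = lebesgue X.
Proof.
move=> Xoo; have [v0|v0] := eqVneq (lebesgue X) 0.
  by exists 0%R; rewrite eball0 lebesgue0 v0.
have Xf : lebesgue X \is a fin_num by rewrite ge0_fin_numE// lebesgue_ge0.
have cf : lebesgue (eball 1 : set V) \is a fin_num.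
  by rewrite ge0_fin_numE ?lebesgue_ge0// lebesgue_eball_fin.
have c0 := lebesgue_eball1_gt0 R d.
pose v := fine (lebesgue X); pose c := fine (lebesgue (eball 1 : set V)).
have vpos : (0 < v)%R.
  by rewrite -lte_fin fineK// lt_neqAle eq_sym v0 lebesgue_ge0.
have cpos : (0 < c)%R by rewrite -lte_fin fineK.
pose r := ((v / c) `^ (d.+1%:R^-1))%R.
have rpos : (0 < r)%R by rewrite powR_gt0// divr_gt0.
exists r; split; first exact: ltW.
rewrite lebesgue_eballE// -(fineK cf) -(fineK Xf) -EFinM -/c -/v; congr (_%:E).
rewrite -powR_mulrn; last exact: ltW.
by rewrite /r -powRrM mulVf// powRr1 ?divfK// ?gt_eqF// ltW// divr_gt0.
Qed.

Lemma rearrangementP X : lebesgue X < +oo -> exists r : R,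
  [/\ (0 <= r)%R, rearrangement X = eball r & lebesgue (rearrangement X) = lebesgue X].
Proof.
move=> /exists_eball[r [r0 rX]]; rewrite /rearrangement.
case: xgetP => [B _ [s [s0 -> sX]]|]; first by exists s.
by move=> /(_ (eball r)) []; exists r.
Qed.

Lemma eq_rearrangement X Y : lebesgue X = lebesgue Y -> rearrangement X = rearrangement Y.
Proof. by rewrite /rearrangement => ->. Qed.

Lemma finite_measurable_eball (r : R) : finite_measurable (eball r : set V).
Proof.
split; last exact: lebesgue_eball_fin.
by apply: borel_lebesgue_measurable; exact: measurable_eball.
Qed.

Lemma finite_measurable_rearrangement X : lebesgue X < +oo ->
  finite_measurable (rearrangement X).
Proof. by move=> /rearrangementP[r [_ -> _]]; exact: finite_measurable_eball. Qed.

Lemma steiner_seq_rearrangement X us : lebesgue X < +oo ->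
  steiner_seq (rearrangement X) us = rearrangement X.
Proof. by move=> /rearrangementP[r [_ -> _]]; exact: steiner_seq_eball. Qed.

End rearrangement.

End steiner_orbits.

(** * Compactness of orbits *)

Section steiner_compactness.
Context (R : realType) (d : nat).
Notation V := 'rV[R]_d.+1.
Notation S := (proj_space R d).
Local Open Scope ereal_scope.
Implicit Types (X Y Z K : set V) (u : S) (w us : seq S).

(** All iterates of a tame set have the same modulus of enlargement, hence up to
    a small error each is determined by the finitely many cells of a fine grid
    that it meets. *)
Lemma orbit_totally_bounded X (eps : R) : finite_measurable X -> (0 < eps)%R ->
  exists (F : finType) (c : seq S -> F), forall us vs, c us = c vs ->
    sdist (steiner_seq X us) (steiner_seq X vs) <= eps%:E.
Proof.
move=> fX e0; have [mX Xoo] := fX; have e40 : (0 < eps / 4)%R by rewrite divr_gt0.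
have [K [[mK [r0 Kr0] hK] XK]] := tame_approx mX Xoo e40.
have [delta [K' [del0 mK' K'oo KK' K'e]]] := hK _ e40.
pose r : R := `|r0|%R.
have Kr : K `<=` eball r by apply: subset_trans Kr0 _; apply: eball_sub; exact: ler_norm.
have fK : finite_measurable K.
  by split => //; apply: le_lt_trans (lebesgue_eball_fin _ r); exact: le_lebesgue.
pose eta : R := (delta / d.+2%:R)%R; have eta0 : (0 < eta)%R by rewrite divr_gt0.
pose N := Num.truncn (2 * r / eta)%R.
pose cell (x : V) : {ffun 'I_d.+1 -> 'I_N.+1} :=
  [ffun i => inord (Num.truncn ((x 0%R i + r) / eta))].
have cell_near (x y : V) : eball r x -> eball r y -> cell x = cell y ->
    (enorm (x - y) < delta)%R.
  move=> xr yr xy; apply: (@le_lt_trans _ _ (d.+1%:R * eta)%R); last first.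
    rewrite /eta mulrA ltr_pdivrMr// mulrC ltr_pM2l// ltr_nat//.
  apply: enorm_le_bound => [|i]; first exact: ltW.
  have pos (z : V) : eball r z -> (0 <= (z 0 i + r) / eta)%R /\
      (Num.truncn ((z 0%R i + r) / eta) < N.+1)%N.
    move=> /(eball_coord i); rewrite ltr_norml => /andP[z1 z2].
    split; first by rewrite divr_ge0 ?(ltW eta0)//; lra.
    rewrite ltnS; apply: le_truncn; rewrite ler_pM2r ?invr_gt0//; lra.
  have [px Nx] := pos _ xr; have [py Ny] := pos _ yr.
  move/ffunP : xy => /(_ i); rewrite !ffunE => /(congr1 val).
  rewrite /= !inordK// => t.
  have := truncn_itv px; have := truncn_itv py; rewrite -t.
  move: (Num.truncn _) => k /andP[y1 y2] /andP[x1 x2].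
  rewrite ler_pdivlMr// in y1; rewrite ler_pdivlMr// in x1.
  rewrite ltr_pdivrMr// -natr1 mulrDl mul1r in y2.
  rewrite ltr_pdivrMr// -natr1 mulrDl mul1r in x2.
  by rewrite [(x - y)%R _ _]mxE [(- y)%R _ _]mxE ler_norml; lra.
(* Only finitely many sets of cells are possible. Two iterates meeting the same
   cells are each inside the enlargement of the other. *)
pose c us := [set q : {ffun 'I_d.+1 -> 'I_N.+1} |
  `[< exists x, steiner_seq K us x /\ cell x = q >]]%SET.
have sub_ball us : steiner_seq K us `<=` eball r.
  by rewrite -(steiner_seq_eball r us); exact: le_steiner_seq.
have half us vs : c us = c vs ->
    lebesgue (steiner_seq K us `\` steiner_seq K vs) <= (eps / 4)%:E.
  move=> /setP uv; apply: le_trans K'e; apply: le_trans (steiner_seq_setD vs _ fK) => //.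
  apply: le_lebesgue => x [xu xv]; split => //.
  apply: (le_steiner_seq KK'); apply: enlarge_steiner_seq.
  have := uv (cell x); rewrite !inE => e.
  have : `[< exists x', steiner_seq K us x' /\ cell x' = cell x >].
    by apply/asboolP; exists x.
  rewrite e => /asboolP[y [yv yx]]; exists y => //.
  by apply: cell_near => //; apply: sub_ball; [exact: xu|exact: yv].
exists {set {ffun 'I_d.+1 -> 'I_N.+1}}, c => us vs uv.
have -> : eps%:E = (eps / 4)%:E + ((eps / 4)%:E + (eps / 4)%:E + (eps / 4)%:E).
  by rewrite -!EFinD; congr (_%:E); field.
apply: le_trans (sdist_triangle (steiner_seq K us) _ _) _; apply: leeD.
  by apply: le_trans (steiner_seq_sdist _ fX fK) XK.
apply: le_trans (sdist_triangle (steiner_seq K vs) _ _) _; apply: leeD; last first.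
  by rewrite sdistC; apply: le_trans (steiner_seq_sdist _ fX fK) XK.
by apply: le_trans (sdist_le_setD _ _) _; apply: leeD; exact: half.
Qed.

End steiner_compactness.

Section steiner_completeness.
Context (R : realType) (d : nat).
Notation V := 'rV[R]_d.+1.
Notation S := (proj_space R d).
Local Open Scope ereal_scope.
Implicit Types (X Y Z K : set V) (u : S) (w us : seq S).

(** Completeness for the symmetric difference: a fast Cauchy sequence converges
    to its upper limit. *)
Lemma sdist_complete (Y : (set V)^nat) : (forall k, finite_measurable (Y k)) ->
  (forall k, sdist (Y k) (Y k.+1) <= (2^-1 ^+ k)%:E) ->
  exists Z, finite_measurable Z /\ forall k, sdist (Y k) Z <= (2 * 2^-1 ^+ k)%:E.
Proof.
move=> fY Ycauchy; pose Z := \bigcap_n \bigcup_j Y (n + j)%N.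
have dist k : sdist (Y k) Z <= (2 * 2^-1 ^+ k)%:E.
  apply: (@le_trans _ _ (lebesgue (\bigcup_j (Y (k + j)%N `+` Y (k + j).+1)))).
    apply: le_lebesgue => x; apply: contraPP => nx.
    have const j : Y (k + j)%N x <-> Y k x.
      elim: j => [|j IH]; first by rewrite addn0.
      rewrite -IH addnS; have [h1|h1] := pselect (Y (k + j)%N x);
        have [h2|h2] := pselect (Y (k + j).+1 x) => //.
        by exfalso; apply: nx; exists j => //; left.
      by exfalso; apply: nx; exists j => //; right.
    have ZY : Z x <-> Y k x.
      split=> [/(_ k I)[j _ /const]//|Yx n _].
      by exists k => //; rewrite addnC; apply/const.
    by rewrite /setY/=; tauto.
  apply: le_trans (lebesgue_sigma_subadditive _) _.
  have e2 : (0 <= 2 * 2^-1 ^+ k :> R)%R by rewrite mulr_ge0.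
  have := epsilon_trick (R := R) xpredT (A := fun=> 0) (fun=> lexx 0) e2.
  rewrite [X in _ <= X + _]eseries0// add0e; apply: le_trans.
  apply: lee_nneseries => [j _ _|j _]; first exact: lebesgue_ge0.
  apply: le_trans (Ycauchy (k + j)%N) _; rewrite add0e lee_fin exprD natrX exprS.
  by rewrite -mulf_div divff// mul1r !exprVn.
exists Z; split => //; split.
  have -> : Z = ~` (\bigcup_n ~` (\bigcup_j Y (n + j)%N)) by rewrite setC_bigcup; apply: eq_bigcapr => n _; rewrite setCK.
  apply: lebesgue_measurableC; apply: lebesgue_measurable_bigcup => n.
  apply: lebesgue_measurableC; apply: lebesgue_measurable_bigcup => j.
  by have [] := fY (n + j)%N.
apply: le_lt_trans (le_lebesgue_sdist Z (Y 0%N)) _; rewrite sdistC.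
apply: lte_add_pinfty; first by have [] := fY 0%N.
by apply: le_lt_trans (dist 0%N) _; rewrite ltry.
Qed.

End steiner_completeness.

Section steiner_ultralimit.
Context (R : realType) (d : nat).
Notation V := 'rV[R]_d.+1.
Notation S := (proj_space R d).
Local Open Scope ereal_scope.

Lemma ultra_finite_pigeonhole (T : Type) (F : finType) (c : T -> F)
    (G : set_system T) : UltraFilter G -> exists f, G [set t | c t = f].
Proof.
move=> UG; apply: contrapT => /forallNP nG.
have sub (s : seq F) : G [set t | c t \notin s].
  elim: s => [|f s IH]; first by apply: filterS filterT.
  have [/nG//|Gf] := in_ultra_setVsetC [set t | c t = f] UG.
  apply: filterS (filterI Gf IH) => t [/= cf cs].
  by rewrite in_cons negb_or cs andbT; apply/eqP.
have := filter_ex (sub (enum F)) => -[t] /=.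
by rewrite mem_enum.
Qed.

(** Iterates of a fixed set converge along any ultrafilter, by total
    boundedness and completeness. *)
Lemma steiner_ultralimit (G : set_system nat) (w : nat -> seq S) (X : set V) :
  UltraFilter G -> finite_measurable X ->
  exists Y, finite_measurable Y /\ forall eps : R, (0 < eps)%R ->
    G [set k | sdist (steiner_seq X (w k)) Y <= eps%:E].
Proof.
move=> UG fX; pose q (m : nat) : R := (2^-1 ^+ m)%R.
have q0 m : (0 < q m)%R by rewrite exprn_gt0.
have /choice[N NP] : forall m, exists N : set nat, G N /\ forall k l, N k -> N l ->
    sdist (steiner_seq X (w k)) (steiner_seq X (w l)) <= (q m)%:E.
  move=> m; have [F [c cP]] := orbit_totally_bounded fX (q0 m).
  have [f Gf] := ultra_finite_pigeonhole (fun k => c (w k)) UG.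
  exists [set k | c (w k) = f]; split => // k l /= ck cl; apply: cP.
  by rewrite ck cl.
(* A time in all of the first [m] selected sets, so that consecutive choices are
   close to each other. *)
have /choice[k kP] : forall m, exists k, forall i, (i <= m)%N -> N i k.
  move=> m; have : G [set k | forall i, (i <= m)%N -> N i k].
    elim: m => [|m IH].
      by apply: filterS (NP 0%N).1 => k Nk i; rewrite leqn0 => /eqP ->.
    apply: filterS (filterI IH (NP m.+1).1) => k [h1 h2] i.
    by rewrite leq_eqVlt => /orP[/eqP ->//|]; rewrite ltnS; exact: h1.
  by move/filter_ex => [k]; exists k.
have [Y [fY Ylim]] := sdist_complete
  (fun m => finite_measurable_seq (w (k m)) fX)
  (fun m => (NP m).2 _ _ (kP m m (leqnn m)) (kP m.+1 m (leqnSn m))).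
exists Y; split => // eps e0.
have [m me] : exists m : nat, (3 * q m <= eps)%R.
  have e3 : (0 < eps / 3)%R by rewrite divr_gt0.
  have h : (fun m : nat => (2^-1 ^+ m : R)%R) @ \oo --> (0%R : R).
    by apply: cvg_expr; rewrite ger0_norm// invf_lt1// ltr1n.
  have /cvgrPdist_lt /(_ _ e3) [m _ /(_ m (leqnn m)) mh] := h.
  exists m; move: mh; rewrite sub0r normrN ger0_norm; last exact: ltW.
  by rewrite ltr_pdivlMr// mulrC => /ltW.
apply: filterS (NP m).1 => l Nl /=.
apply: le_trans (sdist_triangle (steiner_seq X (w (k m))) _ _) _.
apply: (@le_trans _ _ ((q m)%:E + (2 * q m)%:E)); last first.
  by rewrite -EFinD lee_fin; lra.
by apply: leeD (Ylim m); apply: (NP m).2 => //; exact: kP.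
Qed.

End steiner_ultralimit.

(** * Iterated kernels on products of basic sets *)

Section null_integral.
Local Open Scope ereal_scope.
Context dT (T : measurableType dT) (R : realType) (m : {measure set T -> \bar R}).

(** The integral of a nonnegative function, measurable or not, is a supremum over
    the simple functions below it. [iter_kernel] integrates such functions. *)
Lemma ge0_le_integral_nomeas (f g : T -> \bar R) :
  (forall x, 0 <= f x) -> (forall x, f x <= g x) -> \int[m]_x f x <= \int[m]_x g x.
Proof.
move=> f0 fg; have g0 x : 0 <= g x by exact: le_trans (fg x).
rewrite !ge0_integralTE//; apply: ereal_sup_le => _ [h /= hf <-].
by exists h => // x; exact: le_trans (hf x) (fg x).
Qed.

Lemma ge0_ae_integral0 (f : T -> \bar R) : (forall x, 0 <= f x) ->
  (\forall x \ae m, f x = 0) -> \int[m]_x f x = 0.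
Proof.
move=> f0 [N [mN N0 fN]]; apply/eqP; rewrite eq_le integral_ge0// andbT.
pose g x : \bar R := +oo * (\1_N x)%:E.
have fg x : f x <= g x.
  rewrite /g indicE; have [xN|xN] := boolP (x \in N).
    by rewrite mule1 leey.
  rewrite mule0; rewrite notin_setE in xN.
  by rewrite leNgt; apply/negP => fx; apply: xN; apply: fN => fx0; rewrite fx0 ltxx in fx.
apply: le_trans (ge0_le_integral_nomeas f0 fg) _.
rewrite /g ge0_integralZl//.
- by rewrite integral_indic// setIT N0 mule0.
- exact/measurable_EFinP/measurable_indic.
Qed.

End null_integral.

Section rectangles.
Local Open Scope ereal_scope.
Context (R : realType) dS (S : measurableType dS) (P : R.-pker S ~> S).
Variables (B : nat -> set S) (mB : forall k, measurable (B k)).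

Fixpoint in_rect (l : seq nat) (w : seq S) : Prop :=
  match l, w with
  | [::], [::] => True
  | k :: l', u :: w' => B k u /\ in_rect l' w'
  | _, _ => False
  end.

Lemma in_rect_size l w : in_rect l w -> size l = size w.
Proof. by elim: l w => [|k l IH] [|u w]//= [_ /IH ->]. Qed.

Definition word n (t : 'I_n -> S) : seq S := [seq t i | i <- enum 'I_n].

Lemma size_word n (t : 'I_n -> S) : size (word t) = n.
Proof. by rewrite size_map size_enum_ord. Qed.

Lemma word0 (t : 'I_0 -> S) : word t = [::].
Proof. by apply: size0nil; exact: size_word. Qed.

Lemma word_fcons n s (t : 'I_n -> S) : word (fcons s t) = s :: word t.
Proof.
rewrite /word enum_ordSl/= /fcons unlift_none -map_comp; congr (_ :: _).
by apply: eq_map => i /=; rewrite liftK.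
Qed.

(** The iterated kernel of such a product; unlike that of an arbitrary set, it is
    a measurable function of the state by construction. *)
Fixpoint rect_kernel (l : seq nat) (s : S) : \bar R :=
  match l with
  | [::] => 1
  | k :: l' => \int[P s]_s1 ((\1_(B k) s1)%:E * rect_kernel l' s1)
  end.

Lemma rect_kernel_ge0 l s : 0 <= rect_kernel l s.
Proof.
elim: l s => [|k l IH] s /=; first exact: lee01.
by apply: integral_ge0 => s1 _; rewrite mule_ge0// lee_fin.
Qed.

Lemma measurable_rect_kernel l : measurable_fun setT (rect_kernel l).
Proof.
elim: l => [|k l IH]; first exact: measurable_cst.
apply: measurable_fun_integral_kernel.
- by move=> U mU; exact: measurable_kernel.
- by move=> s; rewrite mule_ge0 ?rect_kernel_ge0// lee_fin.
- apply: emeasurable_funM => //.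
  exact/measurable_EFinP/measurable_indic.
Qed.

Lemma iter_kernel_ge0 n s (A : set ('I_n -> S)) : 0 <= iter_kernel P s A.
Proof.
elim: n s A => [|n IH] s A /=; first by rewrite lee_fin.
by apply: integral_ge0 => s1 _.
Qed.

Lemma iter_kernel0 n s : iter_kernel P s (set0 : set ('I_n -> S)) = 0.
Proof.
elim: n s => [|n IH] s /=; first by rewrite indic0.
by rewrite integral0_eq// => s1 _; rewrite -[RHS](IH s1).
Qed.

Lemma iter_kernel_rect n l s : size l = n ->
  iter_kernel P s [set t : 'I_n -> S | in_rect l (word t)] = rect_kernel l s.
Proof.
elim: n l s => [|n IH] [|k l]//= s.
  by move=> _; rewrite indicE mem_set//= word0.
move=> [ln]; apply: eq_integral => s1 _; rewrite indicE.
have [sB|sB] := boolP (s1 \in B k).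
  rewrite mul1e -IH//; congr iter_kernel; apply/seteqP; split => t /=.
    by rewrite word_fcons => -[].
  by rewrite word_fcons => h; split => //; rewrite inE in sB.
rewrite mul0e -[RHS](iter_kernel0 n s1); congr iter_kernel.
apply/seteqP; split => t //=; rewrite word_fcons => -[+ _].
by rewrite notin_setE in sB.
Qed.

(** The products being countably many, a set covered by null ones is null, even if
    it is not measurable. *)
Lemma iter_kernel_null n (D : set (seq nat)) s (A : set ('I_n -> S)) :
  (forall t, A t -> exists2 l, D l & in_rect l (word t)) ->
  (forall l, D l -> rect_kernel l s = 0) ->
  iter_kernel P s A = 0.
Proof.
elim: n D s A => [|n IH] D s A cov null /=.
  rewrite indicE memNset//= => As; have [[|k l] Dl]// := cov _ As; last by rewrite word0.
  by move=> _; have := null _ Dl => /= /eqP; rewrite onee_eq0.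
apply: ge0_ae_integral0 => [s1|]; first exact: iter_kernel_ge0.
have aeN : \forall s1 \ae P s, forall j : nat,
    if unpickle j is Some (k, l) then
      D (k :: l) -> (\1_(B k) s1)%:E * rect_kernel l s1 = 0
    else True.
  apply: ae_foralln => j; case: unpickle => [[k l]|]; last exact: aeW.
  have [Dkl|nD] := pselect (D (k :: l)); last by apply: aeW => s1 /nD.
  have mf : measurable_fun setT (fun s1 => (\1_(B k) s1)%:E * rect_kernel l s1).
    apply: emeasurable_funM; last exact: measurable_rect_kernel.
    exact/measurable_EFinP/measurable_indic.
  have f0 s1 : 0 <= (\1_(B k) s1)%:E * rect_kernel l s1.
    by rewrite mule_ge0 ?rect_kernel_ge0// lee_fin.
  have : \int[P s]_s1 `|(\1_(B k) s1)%:E * rect_kernel l s1| = 0.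
    rewrite -[RHS](null _ Dkl)/=; apply: eq_integral => s1 _.
    by rewrite gee0_abs.
  move/(ae_eq_integral_abs (P s) measurableT mf) => h.
  by apply: filterS h => s1 /(_ I) h _.
apply: filterS aeN => s1 h.
apply: (IH [set l | exists2 k, D (k :: l) & B k s1]).
  move=> t /cov[[|k l] Dl]; rewrite word_fcons//= => -[Bk lt].
  by exists l => //; exists k.
move=> l [k Dkl Bk]; have := h (pickle (k, l)); rewrite pickleK => /(_ Dkl).
by rewrite indicE mem_set// mul1e.
Qed.

End rectangles.

(** * A conditional Borel-Cantelli lemma *)

Section conditional_borel_cantelli.
Local Open Scope ereal_scope.
Context (R : realType) dO (Omega : measurableType dO) (Pr : probability Omega R).
Variables (F : nat -> set (set Omega)) (E G : nat -> set Omega) (eps : R).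
Hypothesis Fsigma : forall l, sigma_algebra setT (F l).
Hypothesis FS : forall l, F l `<=` F l.+1.
Hypothesis Fm : forall l, F l `<=` measurable.
Hypothesis EF : forall l, F l (E l).
Hypothesis GF : forall l, F l.+1 (G l).
Hypothesis eps0 : (0 < eps)%R.
Hypothesis eps1 : (eps <= 1)%R.
Hypothesis escape : forall l A, F l A ->
  Pr ((A `&` E l) `\` G l) <= (1 - eps)%:E * Pr (A `&` E l).

Let F_le k l : (k <= l)%N -> F k `<=` F l.
Proof.
elim: l => [|l IH]; first by rewrite leqn0 => /eqP ->.
by rewrite leq_eqVlt => /orP[/eqP ->//|]; rewrite ltnS => /IH h A /h /FS.
Qed.

Let FC l (C : set Omega) : F l C -> F l (~` C).
Proof. by have [_ h _] := Fsigma l; move=> /h; rewrite setTD. Qed.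

Let F_forall l (C : (set Omega)^nat) : (forall k, F l (C k)) -> F l [set w | forall k, C k w].
Proof.
move=> h; have -> : [set w | forall k, C k w] = ~` (\bigcup_k ~` (C k)).
  rewrite setC_bigcup; apply/seteqP; split => w /= Cw k => [_ nC|]; first exact/nC/Cw.
  by apply: contrapT; exact: (Cw k I).
by apply: FC; have [_ _] := Fsigma l; apply => k; exact: FC.
Qed.

Let F_imply l (b : bool) (C : set Omega) : (b -> F l C) -> F l [set w | b -> C w].
Proof.
case: b => h; first by rewrite (_ : [set w | _] = C)//; [exact: h|apply/seteqP; split => w /=; exact].
rewrite (_ : [set w | _] = ~` set0); last by rewrite setC0; apply/seteqP; split.
by apply: FC; have [] := Fsigma l.
Qed.

Let FI l (C D : set Omega) : F l C -> F l D -> F l (C `&` D).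
Proof.
move=> FlC FlD.
have -> : C `&` D = [set w | forall k : nat, (if k is 0%N then C else D) w].
  apply/seteqP; split => w; first by move=> [Cw Dw] [|k].
  by move=> h; split; [exact: (h 0%N)|exact: (h 1%N)].
by apply: F_forall => -[|k].
Qed.

Section fixed_start.
Variable N : nat.

(* Fix [N] and suppose that no [E l] with [N <= l] is followed by [G l]. [W M j]
   and [E (M + j)] say that [M + j] is the first occurrence of [E] from time [M]
   on, there having been no success before [M]; [V M] is their union. *)
Let quiet M := [set w | forall l, (N <= l < M)%N -> (~` (E l `&` G l)) w].
Let W M j := quiet M `&` [set w | forall l, (M <= l < M + j)%N -> (~` E l) w].
Let V M := quiet M `&` [set w | exists j, E (M + j)%N w].

Let FW M j : F (M + j)%N (W M j).
Proof.
have leM l : (l < M)%N -> (l < M + j)%N by move=> lM; rewrite (leq_trans lM)// leq_addr.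
apply: FI; apply: F_forall => l; apply: F_imply => /andP[_ lM]; apply: FC.
  apply: FI; first exact: (F_le (ltnW (leM _ lM)) (EF l)).
  exact: (F_le (leM _ lM) (GF l)).
exact: (F_le (ltnW lM) (EF l)).
Qed.

Let mE l : measurable (E l). Proof. exact/Fm/EF. Qed.
Let mG l : measurable (G l). Proof. exact/Fm/GF. Qed.
Let mW M j : measurable (W M j). Proof. exact/Fm/FW. Qed.

Let VE M : V M = \bigcup_j (W M j `&` E (M + j)%N).
Proof.
apply/seteqP; split => w.
  move=> [qw exE].
  have exb : exists j, `[< E (M + j)%N w >] by case: exE => j Ej; exists j; apply/asboolP.
  exists (ex_minn exb) => //; case: ex_minnP => j /asboolP Ej jmin; split => //; split => //.
  move=> l /andP[Ml lj] El; have : (j <= l - M)%N.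
    by apply: jmin; apply/asboolP; rewrite subnKC.
  by rewrite leqNgt => /negP; apply; rewrite ltn_subLR.
by move=> [j _ [[qw _] Ej]]; split => //; exists j.
Qed.

Let mV M : measurable (V M).
Proof. by rewrite VE; apply: bigcupT_measurable => j; exact: measurableI. Qed.

Let trivW M : trivIset setT (fun j => W M j `&` E (M + j)%N).
Proof.
apply/trivIsetP => i j _ _; wlog : i j / (i < j)%N.
  move=> h ij; case: (ltngtP i j) => [|ji|/eqP]; first by move/h; exact.
    by rewrite setIC; apply: h ji _; rewrite eq_sym.
  by rewrite (negbTE ij).
move=> ij _; apply/seteqP; split => // w [[[_ _] Ei] [[_ nE] _]].
by apply: (nE (M + i)%N) => //; rewrite leq_addr ltn_add2l.
Qed.

Let Z := [set w | (forall n, exists2 l, (n <= l)%N & E l w) /\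
  forall l, (N <= l)%N -> ~ (E l w /\ G l w)].

Let ZE : Z = \bigcap_M V M.
Proof.
apply/seteqP; split => w.
  move=> [io nEG] M _; split; first by move=> l /andP[/nEG].
  by have [l Ml El] := io M; exists (l - M)%N; rewrite subnKC.
move=> VZ; split.
  by move=> n; have [_ [j Ej]] := VZ n I; exists (n + j)%N => //; exact: leq_addr.
move=> l Nl; have [q _] := VZ l.+1 I; have := q l; rewrite Nl ltnSn/=.
by move=> /(_ isT) nEG [? ?]; apply: nEG.
Qed.

Let mZ : measurable Z.
Proof. by rewrite ZE; exact: bigcapT_measurable. Qed.

(* On [Z], the first occurrence of [E] from time [M] on fails to be a success. *)
Let Z_le M : (N <= M)%N -> Pr Z <= (1 - eps)%:E * Pr (V M).
Proof.
move=> NM; have mWE j : measurable (W M j `&` E (M + j)%N) by exact: measurableI.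
have mWEG j : measurable ((W M j `&` E (M + j)%N) `\` G (M + j)%N) by exact: measurableD.
have VS : Pr (V M) = \sum_(0 <= j <oo) Pr (W M j `&` E (M + j)%N).
  apply/esym/cvg_lim => //; rewrite VE.
  by apply: measure_semi_sigma_additive => //; rewrite -VE; exact: mV.
have e1 : 0 <= (1 - eps)%:E by rewrite lee_fin subr_ge0.
rewrite VS -nneseriesZl; last by move=> j _; exact: measure_ge0.
apply: (@le_trans _ _ (\sum_(0 <= j <oo) Pr ((W M j `&` E (M + j)%N) `\` G (M + j)%N))).
  apply: measure_sigma_subadditive => //.
  move=> w Zw; have : V M w by have := Zw; rewrite ZE; exact.
  rewrite VE => -[j _ [Wj Ej]]; exists j => //; split => // Gj.
  by have [_ /(_ (M + j)%N)] := Zw; apply => //; rewrite (leq_trans NM)// leq_addr.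
by apply: lee_nneseries => [j _ _|j _]; [exact: measure_ge0|exact: escape].
Qed.

(** The [V M] decrease to [Z], so [Pr Z <= (1 - eps) * Pr Z] in the limit. *)
Lemma conditional_borel_cantelli_from : measurable Z /\ Pr Z = 0.
Proof.
split; first exact: mZ.
have cv : (1 - eps)%:E * Pr (V M) @[M --> \oo] --> (1 - eps)%:E * Pr Z.
  apply: cvgeZl => //; rewrite ZE; apply: nonincreasing_cvg_mu => //.
  - by rewrite (le_lt_trans (probability_le1 _ _)) ?ltry.
  - exact: bigcapT_measurable.
  - move=> i j ij; apply/subsetPset => w [q [k Ek]]; split.
      by move=> l /andP[Nl li]; apply: q; rewrite Nl (leq_trans li).
    by exists (j + k - i)%N; rewrite subnKC// (leq_trans ij)// leq_addr.
have : Pr Z <= (1 - eps)%:E * Pr Z.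
  rewrite -(cvg_lim _ cv)//; apply: lime_ge; first by apply/cvg_ex; eexists; exact: cv.
  by near=> M; apply: Z_le; near: M; exact: nbhs_infty_ge.
have Zf : Pr Z \is a fin_num by exact: fin_num_measure.
rewrite -(fineK Zf) -EFinM lee_fin => h; congr (_%:E).
have : (0 <= fine (Pr Z))%R by rewrite fine_ge0.
have := eps0; set p := fine _ in h *; move=> e0 p0.
apply/eqP; rewrite eq_le p0 andbT -(pmulr_rle0 _ e0); lra.
Unshelve. all: by end_near. Qed.

End fixed_start.

(** The hypothesis [escape] says that, given the past, [E l] is followed by [G l]
    with conditional probability at least [eps]; so the successes cannot stop
    while the attempts go on. *)
Lemma conditional_borel_cantelli :
  {ae Pr, forall w, (forall n, exists2 l, (n <= l)%N & E l w) ->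
     forall n, exists2 l, (n <= l)%N & E l w /\ G l w}.
Proof.
pose Z N := [set w | (forall n, exists2 l, (n <= l)%N & E l w) /\
  forall l, (N <= l)%N -> ~ (E l w /\ G l w)].
exists (\bigcup_N Z N); split.
- by apply: bigcupT_measurable => N; have [] := conditional_borel_cantelli_from N.
- apply/eqP; rewrite eq_le measure_ge0 andbT.
  apply: le_trans (measure_sigma_subadditive _ _ _ (@subset_refl _ _)) _.
  + by move=> N; have [] := conditional_borel_cantelli_from N.
  + by apply: bigcupT_measurable => N; have [] := conditional_borel_cantelli_from N.
  + by rewrite eseries0// => N _ _; have [] := conditional_borel_cantelli_from N.
- move=> w /= /not_implyP[io /existsNP[N nN]]; exists N => //; split => // l Nl EG.
  by apply: nN; exists l.
Qed.

End conditional_borel_cantelli.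

(** * The Markov property *)

Section restricted_kernel.
Local Open Scope ereal_scope.
Context (R : realType) dO (Omega : measurableType dO) dS (S : measurableType dS)
  (Pr : probability Omega R).
Variables (k : Omega -> {measure set S -> \bar R}) (C : set Omega).
Hypothesis mk : forall U, measurable U -> measurable_fun setT (k ^~ U).
Hypothesis k1 : forall w, k w setT = 1.
Hypothesis mC : measurable C.

Definition restricted_kernel (p : unit * Omega) : {measure set S -> \bar R} :=
  if p.2 \in C then k p.2 else mzero.

Let restricted_kernelE p U : restricted_kernel p U = (\1_C p.2)%:E * k p.2 U.
Proof. by rewrite /restricted_kernel indicE; case: ifP; rewrite ?mul1e ?mul0e. Qed.

Let measurable_restricted U : measurable U ->
  measurable_fun setT (restricted_kernel ^~ U).
Proof.
move=> mU; under eq_fun do rewrite restricted_kernelE.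
apply: emeasurable_funM; last exact: measurableT_comp (mk mU) measurable_snd.
apply/measurable_EFinP; exact: measurableT_comp (measurable_indic mC) measurable_snd.
Qed.

HB.instance Definition _ := isKernel.Build _ _ _ _ R restricted_kernel measurable_restricted.

Let restricted_uub : measure_fam_uub restricted_kernel.
Proof.
exists 2%R => p; rewrite restricted_kernelE k1 mule1 lte_fin indicE.
by case: (_ \in _); rewrite ltr_nat.
Qed.

HB.instance Definition _ := Kernel_isFinite.Build _ _ _ _ R restricted_kernel restricted_uub.

(** The law of a point drawn from [k w] when [w] is random in [C]. *)
Definition mixture : {measure set S -> \bar R} :=
  kcomp (kprobability (measurable_cst (Pr : pprobability Omega R))) restricted_kernel tt.

Lemma mixtureE A : mixture A = \int[Pr]_(w in C) k w A.
Proof.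
rewrite integral_mkcond; apply: eq_integral => w _; rewrite patchE.
by rewrite restricted_kernelE/= indicE; case: (w \in C); rewrite ?mul1e ?mul0e.
Qed.

Lemma integral_mixture (f : S -> \bar R) : (forall z, 0 <= f z) -> measurable_fun setT f ->
  \int[mixture]_z f z = \int[Pr]_(w in C) \int[k w]_z f z.
Proof.
move=> f0 mf; rewrite integral_kcomp// [RHS]integral_mkcond.
apply: eq_integral => w _; rewrite patchE /= /restricted_kernel/=.
by case: ifP => // _; rewrite integral_measure_zero.
Qed.

End restricted_kernel.

Section markov_property.
Local Open Scope ereal_scope.
Context (R : realType) dS (S : measurableType dS) (P : R.-pker S ~> S)
  (mu : probability S R) dO (Omega : measurableType dO) (Pr : probability Omega R).
Variable X : nat -> {mfun Omega >-> S}.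
Hypothesis markovX : markov_process Pr P mu X.

Lemma sigma_past_sigma n : sigma_algebra setT (sigma_past X n).
Proof. exact: smallest_sigma_algebra. Qed.

Lemma sigma_past_preimage i n A : (i <= n)%N -> measurable A ->
  sigma_past X n (X i @^-1` A).
Proof. by move=> ile mA; apply: sub_gen_smallest; exists i, A. Qed.

Lemma sigma_past_S n : sigma_past X n `<=` sigma_past X n.+1.
Proof.
apply: smallest_sub; first exact: sigma_past_sigma.
by move=> _ [i [A [ile mA ->]]]; apply: sigma_past_preimage => //; exact: leqW.
Qed.

Lemma sigma_past_measurable n : sigma_past X n `<=` measurable.
Proof.
apply: smallest_sub; first exact: sigma_algebra_measurable.
by move=> _ [i [A [ile mA ->]]]; rewrite -[X in measurable X]setTI; exact: measurable_funPT.
Qed.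

Lemma measurable_state_kernel n A : measurable A ->
  measurable_fun setT (fun w => P (X n w) A).
Proof.
by move=> mA; apply: (measurableT_comp (measurable_kernel P A mA)); exact: measurable_funPT.
Qed.

Lemma markov_indic n A C : measurable A -> sigma_past X n C ->
  Pr (C `&` X n.+1 @^-1` A) = \int[Pr]_(w in C) P (X n w) A.
Proof.
move=> mA FC; have [_ /(_ n A mA)[g [mg ig Ig] gP]] := markovX.
have mC : measurable C := sigma_past_measurable FC.
rewrite setIC -Ig//; apply: ae_eq_integral => //.
- apply: measurable_funTS.
  by move=> _ B mB; rewrite setTI; have := mg B mB; exact: sigma_past_measurable.
- by apply: measurable_funTS; exact: measurable_state_kernel.
- by apply: filterS gP => w + _.
Qed.

(** On the event [C], the next state and a point drawn from [P] at the present
    state have the same law, by [markov_indic]. *)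
Lemma markov_integral n C (f : S -> \bar R) : sigma_past X n C ->
  (forall z, 0 <= f z) -> measurable_fun setT f ->
  \int[Pr]_(w in C) f (X n.+1 w) = \int[Pr]_(w in C) (\int[P (X n w)]_z f z).
Proof.
move=> FC f0 mf; have mC := sigma_past_measurable FC.
pose D w : {measure set S -> \bar R} := \d_(X n.+1 w).
have mD U : measurable U -> measurable_fun setT (D ^~ U).
  move=> mU; apply/measurable_EFinP.
  exact: measurableT_comp (measurable_indic mU) (measurable_funPT _).
have D1 w : D w setT = 1 by exact: diracT.
have P1 w : P (X n w) setT = 1 by exact: prob_kernel.
transitivity (\int[Pr]_(w in C) \int[D w]_z f z).
  by apply: eq_integral => w _; rewrite integral_dirac// diracT mul1e.
rewrite -(integral_mixture Pr mD D1 mC f0 mf).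
rewrite -(integral_mixture Pr (@measurable_state_kernel n) P1 mC f0 mf).
apply: eq_measure_integral => A mA _; rewrite !mixtureE -markov_indic//.
have mXA : measurable (X n.+1 @^-1` A) by exact: measurable_funPTI.
by rewrite setIC -integral_indic.
Qed.

Variables (B : nat -> set S) (mB : forall k, measurable (B k)).

Definition visits (l : seq nat) n : set Omega :=
  [set w | in_rect B l [seq X i w | i <- iota n.+1 (size l)]].

Lemma visits_cons j l n : visits (j :: l) n = X n.+1 @^-1` B j `&` visits l n.+1.
Proof. by []. Qed.

Lemma sigma_past_le k n : (k <= n)%N -> sigma_past X k `<=` sigma_past X n.
Proof.
elim: n => [|n IH]; first by rewrite leqn0 => /eqP ->.
by rewrite leq_eqVlt => /orP[/eqP ->//|]; rewrite ltnS => /IH h A /h /sigma_past_S.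
Qed.

Lemma sigma_pastI n C D : sigma_past X n C -> sigma_past X n D -> sigma_past X n (C `&` D).
Proof.
move=> FC FD; have [F0 FN FU] := sigma_past_sigma n.
rewrite -[C `&` D]setCK setCI -!setTD; apply: (FN _).
rewrite -bigcup2E; apply: FU => -[|[|i]]//=; exact: FN.
Qed.

Lemma sigma_past_visits l n : sigma_past X (n + size l) (visits l n).
Proof.
elim: l n => [|j l IH] n /=.
  have [F0 FN _] := sigma_past_sigma (n + 0).
  have -> : visits [::] n = setT `\` set0 by rewrite setD0; apply/seteqP; split.
  exact: FN.
rewrite visits_cons; apply: sigma_pastI.
  by apply: sigma_past_preimage => //; rewrite addnS ltnS leq_addr.
by rewrite addnS -addSn; exact: IH.
Qed.

(** Integrate out the last state first: by [markov_integral], the kernel at time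
    [n + 1] averages to the kernel at time [n]. *)
Lemma markov_visits l n C : sigma_past X n C ->
  Pr (C `&` visits l n) = \int[Pr]_(w in C) rect_kernel P B l (X n w).
Proof.
elim: l n C => [|j l IH] n C FC /=.
  rewrite (_ : visits _ _ = setT) ?setIT; last by apply/seteqP; split.
  by rewrite integral_cst ?mul1e//; exact: sigma_past_measurable FC.
rewrite visits_cons setIA IH; last first.
  apply: sigma_pastI; first exact: sigma_past_S.
  exact: sigma_past_preimage.
rewrite -(markov_integral FC); last 2 first.
- by move=> z; rewrite mule_ge0 ?rect_kernel_ge0// lee_fin.
- apply: emeasurable_funM; last exact: measurable_rect_kernel.
  exact/measurable_EFinP/measurable_indic.
rewrite integral_mkcondr; apply: eq_integral => w _.
rewrite patchE indicE (_ : (w \in _) = (X n.+1 w \in B j))//.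
by case: ifP => _; rewrite ?mul1e ?mul0e.
Qed.

Lemma markov_escape l n C (eps : R) : sigma_past X n C -> (0 <= eps)%R ->
  (forall w, C w -> eps%:E <= rect_kernel P B l (X n w)) ->
  Pr (C `\` visits l n) <= (1 - eps)%:E * Pr C.
Proof.
move=> FC e0 Ceps; have mC := sigma_past_measurable FC.
have mV : measurable (visits l n).
  have : sigma_past X (n + size l) (visits l n) by exact: sigma_past_visits.
  exact: sigma_past_measurable.
have fC : Pr C \is a fin_num by exact: fin_num_measure.
rewrite measureD//; last by rewrite -ge0_fin_numE.
rewrite EFinB muleBl// mul1e; apply: leeB => //.
rewrite [leRHS](_ : _ = \int[Pr]_(w in C) rect_kernel P B l (X n w)); last first.
  exact: markov_visits.
rewrite -integral_cst//.
apply: ge0_le_integral => //.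
apply: measurable_funTS.
exact: measurableT_comp (measurable_rect_kernel P mB l) (measurable_funPT _).
Qed.

End markov_property.

Section recurring_visits.
Local Open Scope ereal_scope.
Context (R : realType) dS (S : measurableType dS) (P : R.-pker S ~> S)
  (mu : probability S R) dO (Omega : measurableType dO) (Pr : probability Omega R).
Variable X : nat -> {mfun Omega >-> S}.
Hypothesis markovX : markov_process Pr P mu X.
Variables (B : nat -> set S) (mB : forall k, measurable (B k)).

(** Starting times in one residue class modulo the length of [l] are far enough
    apart for the outcome of each visit to be known at the next starting time;
    one of these classes contains infinitely many of the times when [E] occurs. *)
Lemma recurring_visits (l : seq nat) (E : nat -> set Omega) (eps : R) :
  (0 < size l)%N -> (0 < eps)%R -> (eps <= 1)%R ->
  (forall k, sigma_past X k (E k)) ->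
  (forall k w, E k w -> eps%:E <= rect_kernel P B l (X k w)) ->
  {ae Pr, forall w, (forall n, exists2 k, (n <= k)%N & E k w) ->
    forall n, exists2 k, (n <= k)%N & E k w /\ visits X B l k w}.
Proof.
move=> l0 e0 e1 FE Eeps; set r := size l in l0 *.
have BC c : {ae Pr, forall w,
    (forall n, exists2 m, (n <= m)%N & E (c + m * r)%N w) ->
    forall n, exists2 m, (n <= m)%N &
      E (c + m * r)%N w /\ visits X B l (c + m * r) w}.
  apply: (@conditional_borel_cantelli _ _ _ Pr (fun m => sigma_past X (c + m * r))
    (fun m => E (c + m * r)%N) (fun m => visits X B l (c + m * r)) eps) => //.
  - by move=> m; exact: sigma_past_sigma.
  - by move=> m; apply: sigma_past_le; rewrite leq_add2l leq_mul2r leqnSn orbT.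
  - by move=> m; exact: sigma_past_measurable.
  - move=> m; have : sigma_past X (c + m * r + r) (visits X B l (c + m * r)).
      exact: sigma_past_visits.
    by rewrite -addnA mulSnr.
  - move=> m A FA; apply: (markov_escape markovX mB).
    + by apply: sigma_pastI => //; exact: FE.
    + exact: ltW.
    + by move=> w [_]; exact: Eeps.
have := ae_foralln BC; apply: filterS => w h io n.
have [c ioc] : exists c, forall n, exists2 m, (n <= m)%N & E (c + m * r)%N w.
  apply: contrapT => /forallNP nio.
  have /choice[N hN] : forall c, exists N, forall m, (N <= m)%N -> ~ E (c + m * r)%N w.
    move=> c; have /existsNP[N nN] := nio c; exists N => m Nm Em.
    by apply: nN; exists m.
  have [k Mk Ek] := io ((\max_(c < r) N c) * r)%N.
  apply: (hN (k %% r)%N (k %/ r)%N); last by rewrite addnC -divn_eq.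
  rewrite leq_divRL//; apply: leq_trans Mk; rewrite leq_mul2r.
  have kr : (k %% r < r)%N by rewrite ltn_mod.
  by rewrite (leq_bigmax (F := fun c : 'I_r => N c) (Ordinal kr)) orbT.
have [m nm Em] := h c ioc n; exists (c + m * r)%N => //.
by rewrite (leq_trans nm)// (leq_trans (leq_pmulr m l0))// leq_addl.
Qed.

(** The complement of such a set of words is a countable union of products of the
    [B k]. *)
Lemma sigma_past_closed_words (A : set (seq S)) k :
  (forall w, ~ A w -> exists l, in_rect B l w /\ forall w', in_rect B l w' -> ~ A w') ->
  sigma_past X k [set omega | A [seq X i omega | i <- iota 0 k.+1]].
Proof.
move=> clA; have [F0 FN FU] := sigma_past_sigma (fun i => X i) k.
pose out l := forall w', in_rect B l w' -> ~ A w'.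
pose rect l := [set omega | in_rect B l [seq X i omega | i <- iota 0 k.+1]].
have Frect l : sigma_past X k (rect l).
  case: l => [|j l]; first by rewrite (_ : rect _ = set0); [exact: F0|apply/seteqP; split].
  have [lk|lk] := eqVneq (size l) k; last first.
    rewrite (_ : rect _ = set0); first exact: F0.
    apply/seteqP; split => // omega /in_rect_size.
    by rewrite size_map size_iota => -[] /eqP; rewrite (negbTE lk).
  rewrite (_ : rect _ = X 0%N @^-1` B j `&` visits X B l 0); last first.
    by rewrite /rect /visits lk.
  apply: sigma_pastI; first exact: sigma_past_preimage.
  have : sigma_past X (0 + size l) (visits X B l 0) by exact: sigma_past_visits.
  by rewrite add0n lk.
move: (sigma_past _ _) F0 FN FU Frect => F F0 FN FU Frect.
pose bad m := if unpickle m is Some l then if `[< out l >] then rect l else set0 else set0.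
rewrite (_ : [set omega | _] = setT `\` \bigcup_m bad m).
  apply: (FN _); apply: FU => m; rewrite /bad; case: unpickle => [l|//].
  by case: ifP => // _; exact: Frect.
apply/seteqP; split => omega /=.
  move=> Aw; split => // -[m _]; rewrite /bad; case: unpickle => [l|//]; case: ifP => // /asboolP out_l.
  by move=> /out_l.
move=> [_ h]; apply: contrapT => /clA[l [lw out_l]]; apply: h.
by exists (pickle l) => //; rewrite /bad pickleK asboolT.
Qed.

End recurring_visits.

(** * Volume gained in centered balls *)

Section ball_mass.
Context (R : realType) (d : nat).
Notation V := 'rV[R]_d.+1.
Notation S := (proj_space R d).
Local Open Scope ereal_scope.
Implicit Types (X Y : set V) (u : S) (w us : seq S) (q : rat).

Definition mass q Y : R := fine (lebesgue (Y `&` eball (ratr q))).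

Lemma massE q Y : finite_measurable Y -> lebesgue (Y `&` eball (ratr q)) = (mass q Y)%:E.
Proof.
move=> [_ Yoo]; rewrite /mass fineK// ge0_fin_numE ?lebesgue_ge0//.
by apply: le_lt_trans Yoo; apply: le_lebesgue; exact: subIsetl.
Qed.

Lemma mass_le q Y : finite_measurable Y -> (mass q Y <= fine (lebesgue Y))%R.
Proof.
move=> fY; rewrite -lee_fin -massE// fineK ?finite_measurable_fin//.
by apply: le_lebesgue; exact: subIsetl.
Qed.

Lemma mass_sdist q X Y (eps : R) : finite_measurable X -> finite_measurable Y ->
  sdist X Y <= eps%:E -> (mass q X <= mass q Y + eps)%R.
Proof.
move=> fX fY XY; rewrite -lee_fin EFinD -!massE//.
apply: le_trans (le_lebesgue_sdist _ (Y `&` eball (ratr q))) _.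
by apply: leeD => //; apply: le_trans (sdistI _ _ _) XY.
Qed.

Lemma mass_steiner_seq q X us : finite_measurable X ->
  (mass q X <= mass q (steiner_seq X us))%R.
Proof.
move=> fX; rewrite -lee_fin -!massE//; last exact: finite_measurable_seq.
exact: lebesgue_ball_steiner_seq.
Qed.

(** The directions can be perturbed one at a time, the remaining symmetrizations
    being contractions. *)
Lemma steiner_seq_continuous X w (eps : R) : finite_measurable X -> (0 < eps)%R ->
  exists l, in_rect (@base R d) l w /\ forall w', in_rect (@base R d) l w' ->
    sdist (steiner_seq X w') (steiner_seq X w) <= eps%:E.
Proof.
elim: w X eps => [|u w IH] X eps fX e0.
  exists [::]; split => // -[|//] _; rewrite sdistXX lee_fin; exact: ltW.
have e2 : (0 < eps / 2)%R by rewrite divr_gt0.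
have [l [lw hl]] := IH _ _ (finite_measurable_steiner u fX) e2.
have [mX Xoo] := fX; have [k [ku hk]] := steiner_continuous u mX Xoo e2.
exists (k :: l); split => // -[//|u' w'] [/hk uu' /hl ww'] /=.
rewrite [eps]splitr EFinD.
apply: le_trans (sdist_triangle (steiner_seq (steiner X u) w') _ _) _.
apply: leeD; last exact: ww'.
refine (le_trans _ uu').
by apply: steiner_seq_sdist; exact: finite_measurable_steiner.
Qed.

(** Quantifying over the whole product makes this a closed condition on [Y]. *)
Definition gains l q (delta : R) Y : Prop := forall us, in_rect (@base R d) l us ->
  (mass q Y + delta <= mass q (steiner_seq Y us))%R.

Lemma gains_closed X l q (delta : R) w : finite_measurable X ->
  ~ gains l q delta (steiner_seq X w) ->
  exists l', in_rect (@base R d) l' w /\ forall w', in_rect (@base R d) l' w' ->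
    ~ gains l q delta (steiner_seq X w').
Proof.
move=> fX /existsNP[us /not_implyP[lus /negP]]; rewrite -ltNge.
set Y := steiner_seq X w => lt.
have fY : finite_measurable Y by exact: finite_measurable_seq.
set gap := (mass q Y + delta - mass q (steiner_seq Y us))%R.
have gap0 : (0 < gap / 4)%R by rewrite divr_gt0// subr_gt0.
have [l' [l'w hl']] := steiner_seq_continuous w fX gap0.
exists l'; split => // w' /hl' w'w g; have := g _ lus.
have fY' : finite_measurable (steiner_seq X w') by exact: finite_measurable_seq.
have fZ Z : finite_measurable Z -> finite_measurable (steiner_seq Z us).
  exact: finite_measurable_seq.
have m1 : (mass q Y <= mass q (steiner_seq X w') + gap / 4)%R.
  by apply: mass_sdist => //; rewrite sdistC.
have m2 : (mass q (steiner_seq (steiner_seq X w') us) <=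
           mass q (steiner_seq Y us) + gap / 4)%R.
  apply: mass_sdist; [exact: fZ|exact: fZ|].
  by refine (le_trans _ w'w); exact: steiner_seq_sdist.
by move: m1 m2 gap0; rewrite /gap; lra.
Qed.

(** Half the gain survives a perturbation by a quarter of it, since volumes in
    balls are Lipschitz for the symmetric difference. *)
Lemma gains_near l q (delta : R) X Y : finite_measurable X -> finite_measurable Y ->
  gains l q delta Y -> sdist X Y <= (delta / 4)%:E -> gains l q (delta / 2) X.
Proof.
move=> fX fY g XY us /g.
have m1 : (mass q X <= mass q Y + delta / 4)%R by exact: mass_sdist.
have m2 : (mass q (steiner_seq Y us) <= mass q (steiner_seq X us) + delta / 4)%R.
  apply: mass_sdist; [exact: finite_measurable_seq|exact: finite_measurable_seq|].
  by rewrite sdistC; refine (le_trans _ XY); exact: steiner_seq_sdist.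
lra.
Qed.

(** By monotonicity the first letter moves no volume into any ball, so it acts
    trivially and can be dropped from the word. *)
Lemma mass_steiner_seq_fixed X us u : finite_measurable X ->
  (forall q, (mass q (steiner_seq X us) <= mass q X)%R) ->
  u \in us -> sdist (steiner X u) X = 0.
Proof.
elim: us => // v us IH fX le_mass; rewrite inE.
have fv : finite_measurable (steiner X v) by exact: finite_measurable_steiner.
have v0 : sdist (steiner X v) X = 0.
  apply: steiner_sdist_eq0 => // q; rewrite !massE// lee_fin.
  by refine (le_trans _ (le_mass q)); exact: mass_steiner_seq.
move=> /predU1P[->//|]; apply: IH => // q.
refine (le_trans _ (le_mass q)); rewrite -[leRHS]addr0; apply: mass_sdist.
- exact: finite_measurable_seq.
- exact: finite_measurable_seq.
- by rewrite -[0%:E]v0 [leRHS]sdistC; exact: steiner_seq_sdist.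
Qed.

(** The word moves volume into some ball by [mass_steiner_seq_fixed], and by
    continuity half of that gain remains for all the words nearby. *)
Lemma gains_exists Y us u : finite_measurable Y -> u \in us ->
  sdist (steiner Y u) Y != 0 ->
  exists l q (delta : R), [/\ (0 < delta)%R, in_rect (@base R d) l us & gains l q delta Y].
Proof.
move=> fY uus Yu.
have [q qlt] : exists q, (mass q Y < mass q (steiner_seq Y us))%R.
  apply: contrapT => /forallNP h; move/eqP: Yu; apply.
  by apply: (mass_steiner_seq_fixed fY) uus => q; rewrite leNgt; apply/negP/h.
set gap := (mass q (steiner_seq Y us) - mass q Y)%R.
have gap0 : (0 < gap / 2)%R by rewrite divr_gt0// subr_gt0.
have [l [lus hl]] := steiner_seq_continuous us fY gap0.
exists l, q, (gap / 2)%R; split => // us' /hl h.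
have : (mass q (steiner_seq Y us) <= mass q (steiner_seq Y us') + gap / 2)%R.
  apply: mass_sdist; [exact: finite_measurable_seq|exact: finite_measurable_seq|].
  by rewrite sdistC.
by rewrite /gap; lra.
Qed.

End ball_mass.

Lemma bounded_gains (R : realType) (f : nat -> R) (M delta : R) :
  {homo f : m n / (m <= n)%N >-> m <= n} -> (forall n, f n <= M) -> 0 < delta ->
  ~ (forall n, exists2 k, (n <= k)%N & exists m, f k + delta <= f m).
Proof.
move=> ndf fM d0 io.
have reach j : exists k, f 0%N + j%:R * delta <= f k.
  elim: j => [|j [k hk]]; first by exists 0%N; rewrite mul0r addr0.
  have [k' kk' [m hm]] := io k; exists m; have := ndf _ _ kk'.
  by rewrite -natr1 mulrDl mul1r; lra.
have [k] := reach (Num.truncn ((M - f 0%N) / delta)).+1.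
apply/negP; rewrite -ltNge; apply: le_lt_trans (fM _) _.
by rewrite -ltrBlDl -ltr_pdivrMr// truncnS_gt.
Qed.

(** * Convergence along recurrent trajectories *)

Section recurring_state.
Context (R : realType) (d : nat).
Notation V := 'rV[R]_d.+1.
Notation S := (proj_space R d).
Notation base := (@base R d).
Local Open Scope ereal_scope.

Lemma measurable_base k : measurable (base k).
Proof. by apply: sub_gen_smallest; exact: open_base. Qed.

Lemma in_rect_wordP n l (t : 'I_n -> S) : size l = n ->
  in_rect base l (word t) <-> forall i : 'I_n, base (nth 0%N l i) (t i).
Proof.
elim: n l t => [|n IH] [|j l]//= t; first by rewrite word0; split => // _ [].
move=> [/IH {}IH].
have tE : t = fcons (t ord0) (fun i => t (lift ord0 i)).
  by apply/funext => i; rewrite /fcons; case: unliftP => [j' ->|->].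
rewrite tE word_fcons -tE /=; split.
  by move=> [tj /IH tl] i; case: (unliftP ord0 i) => [i' ->|->] //; exact: tl.
by move=> h; split; [exact: (h ord0)|apply/IH => i; exact: (h (lift ord0 i))].
Qed.

Lemma open_rect n l : size l = n ->
  open [set t : {ptws 'I_n -> S} | in_rect base l (word t)].
Proof.
move=> ln; rewrite openE => t /= /(in_rect_wordP _ ln) lt.
have near_i (i : 'I_n) : nbhs t (fun t' => base (nth 0%N l i) (t' i)).
  apply: (@proj_continuous _ (fun=> S) i t).
  by apply: open_nbhs_nbhs; split; [exact: open_base|exact: lt].
have := filter_forall (nbhs_filter t) near_i.
by apply: filterS => t' h; apply/(in_rect_wordP _ ln).
Qed.

Variable P : R.-pker S ~> S.

(** Lower semicontinuity spreads a positive probability of visiting a box from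
    [s0] to the states near [s0]. *)
Lemma rect_kernel_near n l s0 : size l = n.+1 ->
  (forall O : set {ptws 'I_n.+1 -> S}, open O -> lsc_at (fun s => iter_kernel P s O) s0) ->
  rect_kernel P base l s0 != 0 ->
  exists j (eps : R), [/\ base j s0, (0 < eps)%R, (eps <= 1)%R &
    forall s, base j s -> eps%:E <= rect_kernel P base l s].
Proof.
move=> ln lsc l0.
have pos : 0 < rect_kernel P base l s0.
  by rewrite lt_def l0 rect_kernel_ge0.
have [eps [e0 e1 es]] : exists eps : R,
    [/\ (0 < eps)%R, (eps <= 1)%R & eps%:E < rect_kernel P base l s0].
  case: (rect_kernel P base l s0) pos => [r||//]; last first.
    by move=> _; exists 1%R; rewrite ltry.
  rewrite lte_fin => r0; exists (Order.min 1 (r / 2))%R.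
  have r2 : (0 < r / 2)%R by rewrite divr_gt0.
  rewrite lt_min ltr01 r2 ge_min lexx; split => //.
  by rewrite lte_fin gt_min ltr_pdivrMr//; apply/orP; right; lra.
have := lsc _ (open_rect ln) eps; rewrite (iter_kernel_rect _ _ _ ln) => /(_ es).
rewrite /prop_near1 nbhsE; move=> [U [oU Us] hU].
have [j [js jU]] := base_nbhs oU Us.
exists j, eps; split => // s /jU /hU; rewrite (iter_kernel_rect _ _ _ ln).
exact: ltW.
Qed.

End recurring_state.

Section convergence.
Context (R : realType) (d : nat).
Notation V := 'rV[R]_d.+1.
Notation S := (proj_space R d).
Notation base := (@base R d).
Local Open Scope ereal_scope.
Variables (P : R.-pker S ~> S) (s0 : S).
Implicit Types (X Y : set V) (l : seq nat) (q : rat).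

(** The directions [S_0, ..., S_k], so that time [k] comes after [k + 1]
    symmetrizations. *)
Definition trajectory (xs : nat -> S) k := [seq xs i | i <- iota 0 k.+1].

Lemma trajectoryD xs k r :
  trajectory xs (k + r) = trajectory xs k ++ [seq xs i | i <- iota k.+1 r].
Proof. by rewrite /trajectory -addSn iotaD map_cat. Qed.

Definition occurs X l q (delta : R) j (xs : nat -> S) k : Prop :=
  base j (xs k) /\ gains l q delta (steiner_seq X (trajectory xs k)).

Definition escapes l j : Prop := exists eps : R,
  [/\ (0 < eps)%R, (eps <= 1)%R & forall s, base j s -> eps%:E <= rect_kernel P base l s].

Lemma mass_trajectory X q (xs : nat -> S) : finite_measurable X ->
  {homo (fun k => mass q (steiner_seq X (trajectory xs k))) : m n / (m <= n)%N >-> (m <= n)%R}.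
Proof.
move=> fX m n mn; rewrite -(subnKC mn) trajectoryD steiner_seq_cat.
by apply: mass_steiner_seq; exact: finite_measurable_seq.
Qed.

(** Each visit to [l] would move the volume [delta] into the ball of radius [q],
    and this volume never decreases. *)
Lemma occurs_finitely_often (mu : probability S R) dO (Omega : measurableType dO)
    (Pr : probability Omega R) (Sn : nat -> {mfun Omega >-> S}) X l q (delta : R) j :
  markov_process Pr P mu Sn -> finite_measurable X -> (0 < size l)%N ->
  (0 < delta)%R -> escapes l j ->
  {ae Pr, forall w,
    ~ forall n, exists2 k, (n <= k)%N & occurs X l q delta j (fun i => Sn i w) k}.
Proof.
move=> markovS fX l0 d0 [eps [e0 e1 epsl]].
pose E k := [set w | occurs X l q delta j (fun i => Sn i w) k].
have FE k : sigma_past Sn k (E k).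
  rewrite (_ : E k = Sn k @^-1` base j `&` [set w |
    [set us | gains l q delta (steiner_seq X us)] [seq Sn i w | i <- iota 0 k.+1]]).
    apply: sigma_pastI; first by apply: sigma_past_preimage => //; exact: measurable_base.
    by apply: sigma_past_closed_words => //; [exact: measurable_base|move=> w; exact: gains_closed].
  by apply/seteqP; split.
have := recurring_visits markovS (@measurable_base R d) l0 e0 e1 FE _.
have Eeps k w : E k w -> eps%:E <= rect_kernel P base l (Sn k w) by move=> [/epsl].
move=> /(_ Eeps); apply: filterS => w h io.
pose f k := mass q (steiner_seq X (trajectory (fun i => Sn i w) k)).
apply: (@bounded_gains R f (fine (lebesgue X)) delta) => //.
- exact: mass_trajectory.
- move=> k; rewrite /f -(lebesgue_steiner_seq (trajectory (fun i => Sn i w) k) fX).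
  by apply: mass_le; exact: finite_measurable_seq.
- move=> n; have [k nk [[_ gk] vk]] := h io n; exists k => //.
  by exists (k + size l)%N; rewrite /f trajectoryD steiner_seq_cat; exact: gk.
Qed.

Hypothesis lsc : forall (n : nat) (O : set {ptws 'I_n.+1 -> S}),
  open O -> lsc_at (fun s => iter_kernel P s O) s0.
Hypothesis discrimination : forall X,
  lebesgue_measurable X -> lebesgue X < +oo -> 0 < lebesgue (X `+` rearrangement X) ->
  0 < \sum_(0 <= n <oo) iter_kernel P s0
    [set t : 'I_n.+1 -> S | 0 < lebesgue (X `+` steiner X (t ord_max))].

(** Otherwise the words provided by the discrimination hypothesis would be covered
    by null products, by [gains_exists]. *)
Lemma discriminating_rect Y : finite_measurable Y -> 0 < sdist Y (rearrangement Y) ->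
  exists n l q (delta : R), [/\ size l = n.+1, (0 < delta)%R, gains l q delta Y &
    rect_kernel P base l s0 != 0].
Proof.
move=> fY Y0; have [mY Yoo] := fY; apply: contrapT => none.
have := discrimination mY Yoo Y0; rewrite eseries0 ?ltxx// => n _ _.
pose D := [set l | size l = n.+1 /\ exists q (delta : R), (0 < delta)%R /\ gains l q delta Y].
apply: (iter_kernel_null (@measurable_base R d) (D := D)) => [t /= tY|l [ln [q [delta [d0 g]]]]].
  have tw : t ord_max \in word t by apply: map_f; rewrite mem_enum.
  have Yt : sdist (steiner Y (t ord_max)) Y != 0 by rewrite sdistC gt_eqF.
  have [l [q [delta [d0 lt g]]]] := gains_exists fY tw Yt.
  exists l => //; split; last by exists q, delta.
  by rewrite (in_rect_size lt) size_word.
apply/eqP; apply: contrapT => /negP l0.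
by apply: none; exists n, l, q, delta.
Qed.

Lemma gains_le l q (d1 d2 : R) Y : (d1 <= d2)%R -> gains l q d2 Y -> gains l q d1 Y.
Proof. by move=> d12 g us /g; apply: le_trans; rewrite lerD2l. Qed.

Lemma sdist_trajectory X (xs : nat -> S) m n : finite_measurable X -> (m <= n)%N ->
  sdist (steiner_seq X (trajectory xs n)) (rearrangement X) <=
  sdist (steiner_seq X (trajectory xs m)) (rearrangement X).
Proof.
move=> fX mn; have [_ Xoo] := fX; rewrite -(subnKC mn) trajectoryD steiner_seq_cat.
rewrite -[in leLHS](steiner_seq_rearrangement [seq xs i | i <- iota m.+1 (n - m)] Xoo).
apply: steiner_seq_sdist; first exact: finite_measurable_seq.
exact: finite_measurable_rearrangement.
Qed.

(** By recurrence, the sets of late times spent near [s0] generate a proper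
    filter. *)
Lemma ultra_recurrent (xs : nat -> S) :
  (forall j, base j s0 -> forall N, exists2 n, (N <= n)%N & base j (xs n)) ->
  exists G : set_system nat, UltraFilter G /\
    forall j N, base j s0 -> G [set k | (N <= k)%N /\ base j (xs k)].
Proof.
move=> rec; pose G0 : set_system nat := [set A | exists j N, base j s0 /\
  forall k, (N <= k)%N -> base j (xs k) -> A k].
have PG0 : ProperFilter G0.
  apply: Build_ProperFilter_ex.
    move=> A [j [N [js h]]]; have [n Nn jn] := rec j js N.
    by exists n; exact: h.
  split.
  - have [j [js _]] := @base_nbhs R d setT s0 openT I.
    by exists j, 0%N.
  - move=> A B [j [N [js hA]]] [j' [N' [js' hB]]].
    have oU : open (base j `&` base j') by apply: openI; exact: open_base.
    have [i [is0 ijj']] := base_nbhs oU (conj js js').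
    exists i, (maxn N N'); split => // k; rewrite geq_max => /andP[Nk N'k] /ijj'[jk j'k].
    by split; [exact: hA|exact: hB].
  - move=> A B AB [j [N [js hA]]]; exists j, N; split => // k Nk jk.
    by apply: AB; exact: hA.
have [G [UG G0G]] := ultraFilterLemma PG0.
by exists G; split => // j N js; apply: G0G; exists j, N.
Qed.

(** The deterministic core: a limit point of the orbit along times approaching
    [s0] that is not a ball would make some gain occur infinitely often. *)
Lemma sdist_trajectory_small X (xs : nat -> S) : finite_measurable X ->
  (forall j, base j s0 -> forall N, exists2 n, (N <= n)%N & base j (xs n)) ->
  (forall l q m j, (0 < size l)%N -> escapes l j ->
    ~ forall n, exists2 k, (n <= k)%N & occurs X l q m.+1%:R^-1 j xs k) ->
  forall e : R, (0 < e)%R ->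
    exists k, sdist (steiner_seq X (trajectory xs k)) (rearrangement X) < e%:E.
Proof.
move=> fX rec nogain e e0; have [mX Xoo] := fX.
apply: contrapT => /forallNP far.
have {}far k : e%:E <= sdist (steiner_seq X (trajectory xs k)) (rearrangement X).
  by rewrite leNgt; apply/negP/far.
have [G [UG Grec]] := ultra_recurrent rec.
have [Y [fY Ylim]] := steiner_ultralimit (trajectory xs) UG fX.
have PG : ProperFilter G by exact: ultra_proper.
(* Hence [X] and [Y] have the same rearrangement. *)
have YX : lebesgue Y = lebesgue X.
  have near_le (e' : R) : (0 < e')%R ->
      lebesgue Y <= lebesgue X + e'%:E /\ lebesgue X <= lebesgue Y + e'%:E.
    move=> /Ylim /filter_ex[k /= hk]; rewrite -(lebesgue_steiner_seq (trajectory xs k) fX).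
    split; apply: le_trans (le_lebesgue_sdist _ _) (leeD2l _ _); last exact: hk.
    by rewrite sdistC; exact: hk.
  by apply/eqP; rewrite eq_le; apply/andP; split; apply/lee_addgt0Pr => e' /near_le[].
have Y0 : 0 < sdist Y (rearrangement Y).
  rewrite (eq_rearrangement YX).
  have e2 : (0 < e / 2)%R by rewrite divr_gt0.
  have [k /= hk] := filter_ex (Ylim _ e2).
  have := le_trans (far k) (sdist_triangle Y _ _).
  rewrite lt_def sdist_ge0 andbT => h; apply/eqP => Y0; move: h; rewrite Y0 adde0.
  move=> /le_trans /(_ hk); rewrite lee_fin; lra.
have [n [l [q [delta [ln d0 g l0]]]]] := discriminating_rect fY Y0.
have [j [eps [js e1 e2 epsl]]] := rect_kernel_near ln (@lsc n) l0.
have [m md] : exists m : nat, (m.+1%:R^-1 <= delta / 2)%R.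
  have d2 : (0 < delta / 2)%R by rewrite divr_gt0.
  exists (Num.truncn (delta / 2)^-1); rewrite invf_ple ?posrE//.
  exact/ltW/truncnS_gt.
apply: (nogain l q m j); [by rewrite ln|by exists eps|move=> N].
have d4 : (0 < delta / 4)%R by rewrite divr_gt0.
have [k [hk [Nk jk]]] := filter_ex (filterI (Ylim _ d4) (Grec j N js)).
exists k => //; split => //; apply: gains_le md _.
by refine (gains_near _ fY g hk); exact: (finite_measurable_seq (trajectory xs k) fX).
Qed.

End convergence.

Local Open Scope ereal_scope.

Theorem theorem1p2 (R : realType) (d : nat)
    (dO : measure_display) (Omega : measurableType dO)
    (Pr : probability Omega R)
    (P : R.-pker (proj_space R d) ~> (proj_space R d))
    (mu : probability (proj_space R d) R)
    (Sn : nat -> {mfun Omega >-> proj_space R d})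
    (Sn_markov : markov_process Pr P mu Sn)
    (s0 : proj_space R d)
    (recurrence : forall O : set (proj_space R d), open O -> O s0 ->
      Pr [set w | forall N, exists2 n, (N <= n)%N & O (Sn n w)] = 1)
    (continuity : forall (n : nat) (O : set {ptws 'I_n.+1 -> proj_space R d}),
      open O -> lsc_at (fun s => iter_kernel P s O) s0)
    (discrimination : forall X : set 'rV[R]_d.+1,
      lebesgue_measurable X -> lebesgue X < +oo ->
      0 < lebesgue (X `+` rearrangement X) ->
      0 < \sum_(0 <= n <oo) iter_kernel P s0
            [set t : 'I_n.+1 -> proj_space R d |
              0 < lebesgue (X `+` steiner X (t ord_max))]) :
  forall X : set 'rV[R]_d.+1, lebesgue_measurable X -> lebesgue X < +oo ->
    {ae Pr, forall w,
      (fun n => lebesgue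
        (steiner_seq X [seq Sn i w | i <- iota 0 n.+1] `+` rearrangement X))
      @ \oo --> 0}.
Proof.
move=> X mX Xoo; have fX : finite_measurable X by [].
have rec : {ae Pr, forall w, forall j, base j s0 ->
    forall N, exists2 n, (N <= n)%N & base j (Sn n w)}.
  apply: ae_foralln => j; have [js|js] := pselect (base j s0); last by apply: aeW => w /js.
  pose io := [set w | forall N, exists2 n, (N <= n)%N & base j (Sn n w)].
  have ioE : io = \bigcap_N \bigcup_(n in [set n | (N <= n)%N]) (Sn n @^-1` base j).
    apply/seteqP; split => w h N; first by move=> _; have [n Nn jn] := h N; exists n.
    by have [n Nn jn] := h N I; exists n.
  have mio : measurable io.
    rewrite ioE; apply: bigcapT_measurable => N; apply: bigcup_measurable => n _.
    by apply: measurable_funPTI; exact: (@measurable_base R d j).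
  exists (~` io); split; first exact: measurableC.
  - apply: etrans (probability_setC Pr mio) _.
    have -> : Pr io = 1 by apply: recurrence => //; exact: open_base.
    by rewrite subee.
  - by move=> w /= nw ioW; apply: nw => _; exact: ioW.
(* The gains are indexed by countably many data, so they can be excluded almost
   surely all at once. *)
pose data := (seq nat * rat * nat * nat)%type.
have fin : {ae Pr, forall w, forall i : nat,
    if @unpickle data i is Some (l, q, m, j) then
      (0 < size l)%N -> escapes P l j ->
      ~ forall n, exists2 k, (n <= k)%N & occurs X l q m.+1%:R^-1 j (fun i => Sn i w) k
    else True}.
  apply: ae_foralln => i; case: unpickle => [[[[l q] m] j]|]; last exact: aeW.
  have [l0|l0] := pselect (0 < size l)%N; last by apply: aeW => w /l0.
  have [lj|lj] := pselect (escapes P l j); last by apply: aeW => w _ /lj.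
  have m0 : (0 < m.+1%:R^-1 :> R)%R by rewrite invr_gt0.
  by have := occurs_finitely_often q Sn_markov fX l0 m0 lj; apply: filterS => w h _ _.
apply: filterS2 rec fin => w rec fin.
have nogain l q m j : (0 < size l)%N -> escapes P l j ->
    ~ forall n, exists2 k, (n <= k)%N & occurs X l q m.+1%:R^-1 j (fun i => Sn i w) k.
  by have := fin (pickle ((l, q, m, j) : data)); rewrite pickleK.
pose a k := sdist (steiner_seq X (trajectory (fun i => Sn i w) k)) (rearrangement X).
have a_ni : nonincreasing_seq a by move=> m n mn; exact: sdist_trajectory.
have <- : ereal_inf (range a) = 0; last exact: ereal_nonincreasing_cvgn.
apply/eqP; rewrite eq_le; apply/andP; split.
  apply/lee_addgt0Pr => e e0; rewrite add0e.
  have [k /ltW ke] := sdist_trajectory_small continuity discrimination fX rec nogain e0.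
  by apply: le_trans ke; apply: ereal_inf_lbound; exists k.
by apply: le_ereal_inf_tmp => _ [k _ <-]; exact: sdist_ge0.
Qed.
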